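(* There exist absolute constants $c,C>0$ such that the following holds. Let $N$ be a positive integer, let $\delta>0$, and let $f:\mathbb{Z}\to\mathbb{C}$ be a 1-bounded function supported in the interval $[N]$. Suppose that $$\left|\sum_{x\in\mathbb{Z}}\ \sum_{y\in[N^{1/2}]}f(x)f(x+y)f(x+y^2)\right|\geq\delta N^{3/2}.$$ Then either $N\leq C\delta^{-C}$, or there exist positive integers $q\leq C\delta^{-C}$ and $N'\geq c\,\delta^{C}N^{1/2}$ such that $$\sum_{x\in\mathbb{Z}}\left|\sum_{y\in[N']}f(x+qy)\right|\geq c\,\delta^{C}NN'.$$
   Context: For real $X\ge 1$, $[X]=\{1,2,\dots,\lfloor X\rfloor\}$. A complex-valued function is 1-bounded if its modulus never exceeds 1. *)

(* Defs.v *)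
From mathcomp Require Import all_boot all_order all_algebra.
From mathcomp Require Import complex.
From mathcomp Require Import all_classical all_reals all_analysis.
Set Implicit Arguments.
Unset Strict Implicit.
Unset Printing Implicit Defensive.
Import Order.TTheory GRing.Theory Num.Theory.
Local Open Scope ring_scope.
Local Open Scope complex_scope.

(* {1, 2, ..., floor X} for 1 <= X ([Num.truncn] is the floor on 0 <= X). *)
Definition discrete_interval (R : realType) (X : R) : seq int :=
  [seq n%:Z | n <- iota 1 (Num.truncn X)].

Definition supported_in (R : realType) (f : int -> R[i]) (s : seq int) : Prop :=
  forall x : int, x \notin s -> f x = 0.

(* In R[i] the modulus `|z| is itself an element of R[i], and z <= w means that
   z and w have the same imaginary part and Re z <= Re w. *)
Definition one_bounded (R : realType) (f : int -> R[i]) : Prop :=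
  forall x : int, `|f x| <= 1.

(* Main.v *)
From HB Require Import structures.
Require Import Defs.
From mathcomp Require Import all_boot all_order all_algebra.
From mathcomp Require Import complex.
From mathcomp Require Import all_classical all_reals all_analysis.
From mathcomp Require cyclic separable cyclotomic.
From mathcomp Require Import ring lra zify.

(** Why the theorem holds. Put $M=\lfloor N^{1/2}\rfloor$ and $P=100N$. Since $f$
    lives on $[N]$ and the shifts $y,y^2$ are at most $N$, nothing changes when the
    configuration is counted in $\mathbb Z/P$, where the count is $PM$ times
    $\Lambda(f_0,f_1,f_2)=\mathbb E_x\mathbb E_{y\le M}f_0(x)f_1(x+y)f_2(x+y^2)$ with
    all three functions equal to the lift of $f$. Every bound below loses only a
    power of $\eta$, where $\eta\le|\Lambda|$ and $\eta$ is comparable to $\delta$.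

    First, $\Lambda$ is controlled by a Gowers norm of $f_2$ ([gowers_control]).
    Two van der Corput steps remove $f_0$ and $f_1$ and leave, for each pair of
    differences $h,k$ of size $M$, a system of linear forms in $y$, hence a box
    norm of $f_2$ along the directions $2ht_1$, $2kt_2$, $2(h+k)t_3$
    ([quad_form_box]). These are not independent; with the $t_i$ fixed and
    $(h,k)$ as the variables the cube they span is again a system of linear
    forms, and controlling it gives the directions $2t_1u$, $2t_2v$, $2t_3(u+v)$
    and four directions $2(\alpha u+\beta v)$ with
    $\alpha,\beta$ two combinations of the $t_i$ ([box_seven_forms]). Now comes the
    point at which $P$ being comparable with $M^2$ is used: for most pairs
    $(\alpha,\beta)$ of integers of size $M$ the equation $\alpha u+\beta v=0$ has few
    solutions ([card_bad_pairs]), so that $2(\alpha u+\beta v)$, with $u,v$ of size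
    $M$, is spread over $\mathbb Z/P$ with density bounded in $L^2$ and can be
    replaced with a uniform difference ([rich_average]). This turns the four
    combined directions into four degrees of a Gowers norm; each of the three
    remaining ones becomes a combined direction $2(tu-t'u')$ after a
    Cauchy--Schwarz over $(t,u)$, which costs two degrees ([single_step]).

    Secondly, by Cauchy--Schwarz $f_2$ may be replaced with the conjugate of the
    dual function $F(x)=\mathbb E_yf_0(x-y^2)f_1(x+y-y^2)$ ([quad_form_dual]), and
    a large $U^{s}$ norm of $F$ forces a large $U^{s-1}$ norm as long as $s\ge 3$
    ([degree_lowering]). The derivatives of $F$ correlate with characters $\phi(h)$;
    the alternating sums of $\phi$ over cubes are frequencies $\psi$ for which
    $\Lambda(\cdot,\cdot,e(-\psi\,\cdot))$ is large; Weyl differencing puts those in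
    the major arcs ([major_arc]), which contain only $\eta^{-O(1)}$ frequencies
    ([card_major_arcs]), so that $\phi$ can be eliminated.

    Thirdly, at $s=2$ the dual function has a large Fourier coefficient, that is,
    $\Lambda(f_0,f_1,e(-\psi\,\cdot))$ is large for some $\psi$. Then $\psi$ is close
    to a fraction with denominator $q$, the phase $e(-\psi y^2)$ is nearly constant
    on progressions of difference $q$ and length $\eta^{O(1)}M$, and averaging over
    these progressions gives the conclusion ([major_arc_structure]). *)

Set Implicit Arguments.
Unset Strict Implicit.
Unset Printing Implicit Defensive.
Import Order.TTheory GRing.Theory Num.Theory.
Local Open Scope complex_scope.
Local Open Scope ring_scope.


(** * The modulus of a complex number and averages over finite sets *)

Definition avg (K : fieldType) (I : finType) (A : {set I}) (F : I -> K) : K :=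
  (#|A|%:R)^-1 * \sum_(i in A) F i.

(** The modulus with values in the real field, so that it can be compared with
    and averaged among real numbers. *)
Definition modc (R : rcfType) (z : R[i]) : R := Normc.normc z.

Section Modulus.
Variable R : realType.
Implicit Types z w : R[i].

Lemma modcE z : `|z| = (modc z)%:C. Proof. by rewrite normc_def /modc; case: z. Qed.

Lemma modc_ge0 z : 0 <= modc z.
Proof. by rewrite -ler0c -modcE. Qed.

Lemma modcM z w : modc (z * w) = modc z * modc w.
Proof. exact: Normc.normcM. Qed.

Lemma modcJ z : modc (z^*) = modc z.
Proof. by apply: complexI; rewrite -!modcE norm_conjC. Qed.

Lemma modcN z : modc (- z) = modc z.
Proof. by apply: complexI; rewrite -!modcE normrN. Qed.

Lemma modcD z w : modc (z + w) <= modc z + modc w.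
Proof. by rewrite -lecR rmorphD -!modcE ler_normD. Qed.

Lemma modc0 : modc (0 : R[i]) = 0. Proof. exact: Normc.normc0. Qed.
Lemma modc1 : modc (1 : R[i]) = 1. Proof. exact: Normc.normc1. Qed.

Lemma modc_real (x : R) : 0 <= x -> modc x%:C = x.
Proof. by move=> x0; apply: complexI; rewrite -modcE ger0_norm // ler0c. Qed.

Lemma modcX z n : modc (z ^+ n) = modc z ^+ n.
Proof. by elim: n => [|n IH]; rewrite ?expr0 ?modc1 // !exprS modcM IH. Qed.

Lemma modc_nat n : modc (n%:R : R[i]) = n%:R.
Proof. by rewrite -(rmorph_nat (real_complex R)) modc_real. Qed.

Lemma modcV z : modc z^-1 = (modc z)^-1. Proof. exact: Normc.normcV. Qed.

Lemma sqr_modc z : (modc z ^+ 2)%:C = z * z^*.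
Proof. by rewrite -normCK modcE rmorphXn. Qed.

Lemma modc_sum (I : Type) (r : seq I) (P : pred I) (F : I -> R[i]) :
  modc (\sum_(i <- r | P i) F i) <= \sum_(i <- r | P i) modc (F i).
Proof.
elim/big_ind2 : _ => //; first by rewrite modc0.
by move=> a b c d ab cd; exact: le_trans (modcD _ _) (lerD ab cd).
Qed.

Lemma modc_unit z : modc z = 1 -> z * z^* = 1.
Proof. by move=> z1; rewrite -sqr_modc z1 expr1n. Qed.

Lemma le_modcM z w : modc z <= 1 -> modc w <= 1 -> modc (z * w) <= 1.
Proof. by move=> z1 w1; rewrite modcM mulr_ile1 ?modc_ge0. Qed.

End Modulus.

Section Averages.
Import mathcomp.boot.finset.
Variable R : realType.
Implicit Types (I J : finType).

Lemma eq_avg (K : fieldType) I (A : {set I}) (F G : I -> K) :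
  (forall i, i \in A -> F i = G i) -> avg A F = avg A G.
Proof. by move=> FG; rewrite /avg; congr (_ * _); apply: eq_bigr. Qed.

Lemma avgZ (K : fieldType) I (A : {set I}) (F : I -> K) c :
  avg A (fun i => c * F i) = c * avg A F.
Proof. by rewrite /avg -mulr_sumr mulrCA. Qed.

Lemma avgZr (K : fieldType) I (A : {set I}) (F : I -> K) c :
  avg A (fun i => F i * c) = avg A F * c.
Proof. by rewrite /avg -mulr_suml mulrA. Qed.

Lemma avgD (K : fieldType) I (A : {set I}) (F G : I -> K) :
  avg A (fun i => F i + G i) = avg A F + avg A G.
Proof. by rewrite /avg big_split /= mulrDr. Qed.

Lemma exchange_avg (K : fieldType) I J (A : {set I}) (B : {set J}) (F : I -> J -> K) :
  avg A (fun i => avg B (F i)) = avg B (fun j => avg A (fun i => F i j)).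
Proof.
rewrite /avg -!mulr_sumr mulrCA; congr (_ * (_ * _)).
by rewrite exchange_big.
Qed.

Lemma avg_setX (K : fieldType) I J (A : {set I}) (B : {set J}) (F : I * J -> K) :
  avg (setX A B) F = avg A (fun i => avg B (fun j => F (i, j))).
Proof.
rewrite /avg cardsX natrM invfM -mulr_sumr mulrA; congr (_ * _).
rewrite pair_big /=; apply: eq_big => [[i j]|[i j]] //=.
by rewrite in_setX.
Qed.

Lemma avg_setT2 (K : fieldType) I J (F : I * J -> K) :
  avg setT F = avg setT (fun i => avg setT (fun j => F (i, j))).
Proof.
rewrite -avg_setX; congr avg; apply/setP => -[i j].
by rewrite in_setX !inE.
Qed.

Lemma avg_set0 (K : fieldType) I (F : I -> K) : avg set0 F = 0.
Proof. by rewrite /avg big_set0 mulr0. Qed.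

Lemma avg_reindex (K : fieldType) I J (h : J -> I) (F : I -> K) :
  bijective h -> avg setT F = avg setT (F \o h).
Proof.
move=> bh; rewrite /avg !cardsT (bij_eq_card bh); congr (_ * _).
rewrite [LHS](reindex h); last exact: onW_bij.
by apply: eq_bigl => i; rewrite !inE.
Qed.

Lemma avg_shift (K : fieldType) (G : finZmodType) (a : G) (F : G -> K) :
  avg setT (fun x => F (x + a)) = avg setT F.
Proof.
apply/esym/(@avg_reindex _ _ _ (fun x => x + a)).
by exists (fun x => x - a) => x; rewrite ?addrK ?subrK.
Qed.

Lemma avg_cst (K : numFieldType) I (A : {set I}) (c : K) i :
  i \in A -> avg A (fun=> c) = c.
Proof.
move=> iA; rewrite /avg sumr_const -[c *+ _]mulr_natl mulrA mulVf ?mul1r //.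
by rewrite pnatr_eq0 -lt0n; apply/card_gt0P; exists i.
Qed.

Lemma ler_avg I (A : {set I}) (F G : I -> R) :
  (forall i, i \in A -> F i <= G i) -> avg A F <= avg A G.
Proof. by move=> FG; rewrite ler_wpM2l ?invr_ge0 //; apply: ler_sum. Qed.

Lemma avg_ge0 I (A : {set I}) (F : I -> R) :
  (forall i, i \in A -> 0 <= F i) -> 0 <= avg A F.
Proof. by move=> FG; rewrite mulr_ge0 ?invr_ge0 //; apply: sumr_ge0. Qed.

Lemma avg_le I (A : {set I}) (F : I -> R) c :
  0 <= c -> (forall i, i \in A -> F i <= c) -> avg A F <= c.
Proof.
move=> c0 Fc; case: (set_0Vmem A) => [->|[i iA]]; first by rewrite avg_set0.
by rewrite -[leRHS](avg_cst c iA); apply: ler_avg.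
Qed.

Lemma modc_avg I (A : {set I}) (F : I -> R[i]) :
  modc (avg A F) <= avg A (fun i => modc (F i)).
Proof.
rewrite /avg modcM modcV modc_nat ler_wpM2l ?invr_ge0 //.
exact: modc_sum.
Qed.

Lemma modc_avg_le1 I (A : {set I}) (F : I -> R[i]) :
  (forall i, i \in A -> modc (F i) <= 1) -> modc (avg A F) <= 1.
Proof. by move=> F1; apply: le_trans (modc_avg _ _) _; exact: avg_le. Qed.

Lemma avg_conj I (A : {set I}) (F : I -> R[i]) :
  (avg A F)^* = avg A (fun i => (F i)^*).
Proof. by rewrite /avg rmorphM rmorph_sum fmorphV /= rmorph_nat. Qed.

Lemma avgC I (A : {set I}) (F : I -> R) :
  (avg A F)%:C = avg A (fun i => (F i)%:C).
Proof. by rewrite /avg rmorphM rmorph_sum fmorphV /= rmorph_nat. Qed.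

(** From $\sum_{i,j}(a_i b_j - a_j b_i)^2\ge 0$. *)
Lemma sum_cauchy_schwarz I (A : {set I}) (a b : I -> R) :
  (\sum_(i in A) a i * b i) ^+ 2 <=
  (\sum_(i in A) a i ^+ 2) * (\sum_(i in A) b i ^+ 2).
Proof.
have : 0 <= \sum_(i in A) \sum_(j in A) (a i * b j - a j * b i) ^+ 2.
  by apply: sumr_ge0 => i _; apply: sumr_ge0 => j _; exact: sqr_ge0.
have -> : \sum_(i in A) \sum_(j in A) (a i * b j - a j * b i) ^+ 2 =
  \sum_(i in A) (a i ^+ 2 * \sum_(j in A) b j ^+ 2
    - 2 * (a i * b i) * (\sum_(j in A) a j * b j)
    + b i ^+ 2 * \sum_(j in A) a j ^+ 2).
  apply: eq_bigr => i _; rewrite !mulr_sumr -sumrB -big_split /=.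
  by apply: eq_bigr => j _; ring.
rewrite big_split sumrB /= -!mulr_suml -mulr_sumr.
nra.
Qed.

Lemma avg_cauchy_schwarz I (A : {set I}) (a b : I -> R) :
  (avg A (fun i => a i * b i)) ^+ 2 <=
  avg A (fun i => a i ^+ 2) * avg A (fun i => b i ^+ 2).
Proof.
rewrite /avg mulrACA exprMn -expr2 ler_wpM2l ?sqr_ge0 //.
exact: sum_cauchy_schwarz.
Qed.

Lemma avg_jensen2 I (A : {set I}) (a : I -> R) :
  (avg A a) ^+ 2 <= avg A (fun i => a i ^+ 2).
Proof.
case: (set_0Vmem A) => [->|[i iA]]; first by rewrite !avg_set0 expr0n.
have := avg_cauchy_schwarz A a (fun=> 1).
rewrite (avg_cst _ iA) expr1n mulr1; apply: le_trans.
by rewrite le_eqVlt; apply/orP; left; apply/eqP; congr (_ ^+ 2); apply: eq_avg => j _; rewrite mulr1.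
Qed.

Lemma avg_jensen I (A : {set I}) (a : I -> R) k :
  (forall i, i \in A -> 0 <= a i) ->
  (avg A a) ^+ (2 ^ k) <= avg A (fun i => a i ^+ (2 ^ k)).
Proof.
elim: k a => [|k IH] a a0.
  by rewrite expn0 expr1; apply: ler_avg => i _; rewrite expr1.
rewrite expnS exprM; apply: (@le_trans _ _ ((avg A (fun i => a i ^+ 2)) ^+ (2 ^ k))).
  by rewrite lerXn2r ?nnegrE ?sqr_ge0 ?avg_jensen2 // avg_ge0 // => i _; exact: sqr_ge0.
apply: le_trans (IH _ _) _; first by move=> i _; exact: sqr_ge0.
by apply: ler_avg => i _; rewrite -exprM.
Qed.

Lemma sqr_modc_avg I (A : {set I}) (F : I -> R[i]) :
  modc (avg A F) ^+ 2 <= avg A (fun i => modc (F i) ^+ 2).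
Proof.
apply: le_trans (avg_jensen2 _ _).
by rewrite lerXn2r ?nnegrE ?modc_ge0 ?modc_avg // avg_ge0 // => i _; exact: modc_ge0.
Qed.

(** Cauchy--Schwarz in the form used throughout: a bounded factor is discarded
    at the price of squaring. *)
Lemma sqr_modc_avgM I (A : {set I}) (b F : I -> R[i]) :
  (forall i, i \in A -> modc (b i) <= 1) ->
  modc (avg A (fun i => b i * F i)) ^+ 2 <= avg A (fun i => modc (F i) ^+ 2).
Proof.
move=> b1; apply: le_trans (sqr_modc_avg _ _) _; apply: ler_avg => i iA.
rewrite modcM lerXn2r ?nnegrE ?modc_ge0 ?mulr_ge0 ?modc_ge0 //.
by rewrite ler_piMl ?modc_ge0 ?b1.
Qed.

Lemma sqr_modc_avgE I (A : {set I}) (F : I -> R[i]) :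
  (modc (avg A F) ^+ 2)%:C = avg A (fun i => avg A (fun j => F i * (F j)^*)).
Proof.
rewrite sqr_modc avg_conj -avgZr; apply: eq_avg => i _.
by rewrite -avgZ.
Qed.

End Averages.

(** * Differencing and systems of linear forms *)

(** The multiplicative derivative $\Delta_nf$. *)
Definition mder (R : rcfType) (G : zmodType) (n : G) (f : G -> R[i]) (x : G) : R[i] :=
  f x * (f (x + n))^*.

Definition bounded1 (R : rcfType) (T : Type) (f : T -> R[i]) : Prop :=
  forall x, modc (f x) <= 1.

Section Differencing.
Import mathcomp.boot.finset.
Variable R : realType.
Implicit Types (V G : finZmodType).

Lemma bounded1_mder (G : zmodType) n (f : G -> R[i]) :
  bounded1 f -> bounded1 (mder n f).
Proof. by move=> f1 x; rewrite le_modcM // modcJ. Qed.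

Lemma mderC (G : zmodType) (a b : G) (f : G -> R[i]) :
  mder a (mder b f) = mder b (mder a f).
Proof.
apply/funext => x; rewrite /mder !rmorphM /= !conjCK addrAC -!mulrA; congr (_ * _).
by rewrite mulrCA.
Qed.

Lemma sum_shift (K : nmodType) G (a : G) (F : G -> K) :
  \sum_x F (x + a) = \sum_x F x.
Proof.
rewrite [RHS](reindex (fun x => x + a)) //=.
by exists (fun x => x - a) => x _; rewrite ?addrK ?subrK.
Qed.

(** Used to turn the square of a sum over $B$ into an average over differences;
    $T$ need only contain these. *)
Lemma sum_pairs_by_difference (K : nmodType) V (T B : {set V}) (H : V -> V -> K) :
  (forall u v, u \in B -> v \in B -> v - u \in T) ->
  \sum_(u in B) \sum_(v in B) H u v =
  \sum_(t in T) \sum_(u in [set u in B | u + t \in B]) H u (u + t).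
Proof.
move=> BT; have -> : \sum_(t in T) \sum_(u in [set u in B | u + t \in B]) H u (u + t)
    = \sum_(t in T) \sum_(u in B) (if u + t \in B then H u (u + t) else 0).
  apply: eq_bigr => t _; rewrite -big_mkcondr; apply: eq_bigl => u.
  by rewrite !inE.
rewrite [RHS]exchange_big /=; apply: eq_bigr => u uB.
rewrite -[RHS]big_mkcondr /=.
rewrite (reindex (fun t => u + t)) /=; last first.
  by exists (fun t => t - u) => x _; rewrite ?[u + _]addrC ?addrK ?subrK.
apply: eq_bigl => t; case: (boolP (u + t \in B)) => h; rewrite ?andbF // andbT.
by apply/esym; rewrite -[t](addKr u) addrC BT.
Qed.

(** Van der Corput's inequality: a factor not depending on $v$ is discarded,
    and $v$ is duplicated to a pair with difference $t$. The normalisation by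
    the size of $T$ rather than of $B$ lets it be iterated with $T$ fixed while
    $B$ shrinks. *)
Lemma van_der_corput V G (T B : {set V}) (b : G -> R[i]) (g : V -> G -> R[i]) :
  (forall u v, u \in B -> v \in B -> v - u \in T) -> bounded1 b ->
  (modc (\sum_x b x * \sum_(v in B) g v x) / (#|T|%:R * #|G|%:R)) ^+ 2 <=
  avg T (fun t => modc (\sum_(v in [set v in B | v + t \in B])
                 \sum_x g v x * (g (v + t) x)^*) / (#|T|%:R * #|G|%:R)).
Proof.
move=> BT b1; pose S x := \sum_(v in B) g v x.
have G0 : 0 < #|G|%:R :> R by rewrite ltr0n; apply/card_gt0P; exists 0.
case: (set_0Vmem B) => [B0|[v0 v0B]].
  rewrite [X in modc X]big1 ?modc0 ?mul0r ?expr0n /=; last first.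
    by move=> x _; rewrite B0 big_set0 mulr0.
  by apply: avg_ge0 => t _; rewrite divr_ge0 ?modc_ge0 ?mulr_ge0.
have T0 : 0 < #|T|%:R :> R.
  by rewrite ltr0n; apply/card_gt0P; exists (v0 - v0); exact: BT.
have h1 : modc (\sum_x b x * S x) ^+ 2 <= #|G|%:R * \sum_x modc (S x) ^+ 2.
  have := @sqr_modc_avgM R G [set: G] b S (fun x _ => b1 x).
  rewrite /avg cardsT modcM modcV modc_nat exprMn.
  have -> : \sum_(x in [set: G]) b x * S x = \sum_x b x * S x.
    by apply: eq_bigl => x; rewrite inE.
  have -> : \sum_(x in [set: G]) modc (S x) ^+ 2 = \sum_x modc (S x) ^+ 2.
    by apply: eq_bigl => x; rewrite inE.
  rewrite -(ler_pM2l (exprn_gt0 2 G0)) exprVn mulrA divff ?mul1r ?gt_eqF ?exprn_gt0 //.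
  by rewrite expr2 mulrA mulfK ?gt_eqF.
have h2 : \sum_x modc (S x) ^+ 2 <= \sum_(t in T) modc (\sum_(v in [set v in B | v + t \in B])
                 \sum_x g v x * (g (v + t) x)^*).
  have s0 : 0 <= \sum_x modc (S x) ^+ 2 by apply: sumr_ge0 => x _; exact: sqr_ge0.
  rewrite -[leLHS](modc_real s0) rmorph_sum /=.
  apply: le_trans (modc_sum _ _ _).
  rewrite le_eqVlt; apply/orP; left; apply/eqP; congr modc.
  transitivity (\sum_x \sum_(u in B) \sum_(v in B) g u x * (g v x)^*).
    apply: eq_bigr => x _; rewrite sqr_modc rmorph_sum mulr_suml.
    by apply: eq_bigr => u _; rewrite mulr_sumr.
  rewrite -(@sum_pairs_by_difference _ V T B (fun u v => \sum_x g u x * (g v x)^*)) //.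
  by rewrite exchange_big; apply: eq_bigr => u _; rewrite exchange_big.
rewrite /avg -mulr_suml expr_div_n.
apply: (@le_trans _ _ ((#|G|%:R * \sum_(t in T) modc (\sum_(v in [set v in B | v + t \in B])
                 \sum_x g v x * (g (v + t) x)^*)) / (#|T|%:R * #|G|%:R) ^+ 2)).
  rewrite ler_wpM2r ?invr_ge0 ?sqr_ge0 //; apply: le_trans h1 _.
  by rewrite ler_wpM2l // ltW.
rewrite le_eqVlt; apply/orP; left; apply/eqP; field.
by rewrite !gt_eqF.
Qed.

(** A box norm of $f$ along the directions $L_1(t_1),\dots,L_m(t_m)$, in the
    one-sided form in which the last mean is taken in modulus. *)
Fixpoint box_avg V G (T : {set V}) (Ls : seq (V -> G)) (f : G -> R[i]) : R :=
  if Ls is L :: Ls' then avg T (fun t => box_avg T Ls' (mder (L t) f))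
  else modc (avg [set: G] f).

Lemma box_avg_ge0 V G (T : {set V}) (Ls : seq (V -> G)) f : 0 <= box_avg T Ls f.
Proof.
elim: Ls f => [|L Ls IH] f /=; first exact: modc_ge0.
by apply: avg_ge0 => t _; exact: IH.
Qed.

Lemma box_avg_le1 V G (T : {set V}) (Ls : seq (V -> G)) f :
  bounded1 f -> box_avg T Ls f <= 1.
Proof.
elim: Ls f => [|L Ls IH] f f1 /=; first exact: modc_avg_le1.
by apply: avg_le => // t _; apply/IH/bounded1_mder.
Qed.

(** A system of linear forms is a list of pairs $(L_i,f_i)$, which stands for
    the function $\prod_if_i(x+L_i(v))$. *)
Fixpoint additive_bounded V G (l : seq ((V -> G) * (G -> R[i]))) : Prop :=
  if l is p :: l' then
    [/\ forall u v, p.1 (u + v) = p.1 u + p.1 v, bounded1 p.2 & additive_bounded l']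
  else True.

(** A system of linear forms is controlled, at any one of its functions $f_0$,
    by the box norms along the differences $L_0-L_i$: each application of
    van der Corput's inequality, after a translation making $L_i$ vanish,
    removes $f_i$ and differentiates the others. *)
Lemma linear_forms_box V G (T B : {set V}) (l : seq ((V -> G) * (G -> R[i])))
    (L0 : V -> G) (f0 : G -> R[i]) :
  (forall u v, u \in B -> v \in B -> v - u \in T) -> (0 < #|T|)%N ->
  (forall u v, L0 (u + v) = L0 u + L0 v) -> additive_bounded l ->
  (modc (\sum_(v in B) \sum_x f0 (x + L0 v) * \prod_(p <- l) p.2 (x + p.1 v))
     / (#|T|%:R * #|G|%:R)) ^+ (2 ^ size l) <=
  box_avg T [seq (fun v => L0 v - p.1 v) | p <- l] f0.
Proof.
move=> BT T0; have Tp : 0 < #|T|%:R :> R by rewrite ltr0n.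
have G0 : 0 < #|G|%:R :> R by rewrite ltr0n; apply/card_gt0P; exists 0.
move: {2}(size l) (erefl (size l)) => n.
elim: n l L0 f0 B BT => [|n IH] [|[L1 f1] l] // L0 f0 B BT sl addL0 /=.
  move=> _; rewrite expr1.
  have -> : \sum_(v in B) \sum_x f0 (x + L0 v) * \prod_(p <- [::]) p.2 (x + p.1 v)
    = (\sum_x f0 x) *+ #|B|.
    rewrite -sumr_const; apply: eq_bigr => v _; rewrite -[RHS](sum_shift (L0 v)).
    by apply: eq_bigr => x _; rewrite big_nil mulr1.
  rewrite -[_ *+ #|B|]mulr_natl modcM modc_nat /avg modcM modcV modc_nat cardsT.
  have -> : \sum_(x in [set: G]) f0 x = \sum_x f0 x by apply: eq_bigl => x; rewrite inE.
  have BT' : #|B|%:R <= #|T|%:R :> R.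
    rewrite ler_nat; case: (set_0Vmem B) => [->|[v0 v0B]]; first by rewrite cards0.
    rewrite -(card_imset B (addIr (- v0))); apply/subset_leq_card/fintype.subsetP => t.
    by case/imsetP => v vB ->; exact: BT.
  set m := modc _; have -> : #|G|%:R^-1 * m = #|T|%:R * m / (#|T|%:R * #|G|%:R).
    by field; rewrite !gt_eqF.
  by rewrite ler_wpM2r ?invr_ge0 ?mulr_ge0 // ler_wpM2r ?modc_ge0.
case=> /= addL1 f11 gl.
pose L v := L0 v - L1 v.
pose l1 := [seq (fun v => p.1 v - L1 v, p.2) | p <- l].
pose g v x := f0 (x + L v) * \prod_(p <- l1) p.2 (x + p.1 v).
(* translating $x$ by $-L_1(v)$ frees $f_1$ from $v$ *)
have -> : \sum_(v in B) \sum_x f0 (x + L0 v) * \prod_(p <- (L1, f1) :: l) p.2 (x + p.1 v)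
    = \sum_x f1 x * \sum_(v in B) g v x.
  transitivity (\sum_x \sum_(v in B) f1 x * g v x); last first.
    by apply: eq_bigr => x _; rewrite mulr_sumr.
  rewrite [RHS]exchange_big; apply: eq_bigr => v _ /=.
  rewrite -[RHS](sum_shift (L1 v)); apply: eq_bigr => x _.
  rewrite big_cons mulrCA /g /L /= big_map -addrA [L1 v + _]addrC subrK.
  congr (_ * (_ * _)); apply: eq_bigr => p _ /=.
  by rewrite -addrA [L1 v + _]addrC subrK.
pose l2 t := [seq (p.1, mder (p.1 t) p.2) | p <- l1].
have addL : forall u v, L (u + v) = L u + L v.
  by move=> u v; rewrite /L addL0 addL1 opprD addrACA.
have gl2 t : additive_bounded (l2 t).
  rewrite /l2 /l1; elim: (l) gl => //= p l' IHl [addp p1 gl']; split => //.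
  - by move=> u v; rewrite addp addL1 opprD addrACA.
  - exact: bounded1_mder.
  - exact: IHl.
have gE t v x : g v x * (g (v + t) x)^* =
    mder (L t) f0 (x + L v) * \prod_(p <- l2 t) p.2 (x + p.1 v).
  rewrite /g rmorphM rmorph_prod mulrACA /l2 big_map -big_split /=.
  rewrite /mder addL; congr (_ * _); first by rewrite [x + (_ + _)]addrA.
  rewrite /l1 !big_map /=; elim: (l) gl => [|p l' IHl]; first by rewrite !big_nil.
  case=> addp _ gl'; rewrite !big_cons IHl //.
  suff -> : x + (p.1 (v + t) - L1 (v + t)) = x + (p.1 v - L1 v) + (p.1 t - L1 t) by [].
  by rewrite -[RHS]addrA; congr (x + _); rewrite addp addL1 opprD addrACA.
(* the differentiated system is again a system of linear forms, one shorter *)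
rewrite expnS exprM.
apply: (@le_trans _ _ (avg T (fun t => modc (\sum_(v in [set v in B | v + t \in B])
                 \sum_x g v x * (g (v + t) x)^*) / (#|T|%:R * #|G|%:R)) ^+ (2 ^ size l))).
  have a0 : 0 <= avg T (fun t => modc (\sum_(v in [set v in B | v + t \in B])
                 \sum_x g v x * (g (v + t) x)^*) / (#|T|%:R * #|G|%:R)).
    by apply: avg_ge0 => t _; rewrite divr_ge0 ?modc_ge0 ?mulr_ge0.
  by rewrite lerXn2r ?nnegrE ?sqr_ge0 // van_der_corput.
apply: le_trans (avg_jensen _ _) _.
  by move=> t _; rewrite divr_ge0 ?modc_ge0 ?mulr_ge0.
apply: ler_avg => t tT.
have -> : \sum_(v in [set v in B | v + t \in B]) \sum_x g v x * (g (v + t) x)^* =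
  \sum_(v in [set v in B | v + t \in B]) \sum_x
    mder (L t) f0 (x + L v) * \prod_(p <- l2 t) p.2 (x + p.1 v).
  by apply: eq_bigr => v _; apply: eq_bigr => x _; exact: gE.
have sz : size (l2 t) = size l by rewrite !size_map.
case: sl => sl.
have := IH (l2 t) L (mder (L t) f0) [set v in B | v + t \in B].
have -> : [seq (fun v => L0 v - p.1 v) | p <- l] = [seq (fun v => L v - p.1 v) | p <- l2 t].
  rewrite /l2 /l1 -!map_comp; apply: eq_map => p /=; apply/funext => v.
  by rewrite /L opprB addrA subrK.
rewrite sz; apply => // u v; rewrite !inE => /andP[uB _] /andP[vB _]; exact: BT.
Qed.

End Differencing.

(** * Gowers norms and the box Cauchy--Schwarz inequality *)

HB.instance Definition _ (G H : finZmodType) := Finite.on (G * H)%type.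

(** The group $G^k$, presented as an iterated product so that functions on it
    can be handled one coordinate at a time. *)
Fixpoint cube (G : finZmodType) (k : nat) : finZmodType :=
  if k is k'.+1 then (G * cube G k')%type : finZmodType else 'I_1.

Fixpoint coord_sum (G : finZmodType) k : cube G k -> G :=
  if k is k'.+1 then fun h => h.1 + coord_sum h.2 else fun=> 0.

Section Gowers.
Import mathcomp.boot.finset.
Variables (R : realType) (G : finZmodType).
Implicit Types (f g : G -> R[i]).

Lemma avg_cube0 (K : numFieldType) (F : cube G 0 -> K) :
  avg [set: cube G 0] F = F ord0.
Proof.
rewrite -[RHS](avg_cst _ (in_setT (ord0 : cube G 0))); apply: eq_avg => h _.
by rewrite [h]ord1.
Qed.

(** The $2^{k+1}$-th power of the Gowers $U^{k+1}$-norm. *)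
Fixpoint gowers k f : R :=
  if k is k'.+1 then avg [set: G] (fun n => gowers k' (mder n f))
  else modc (avg [set: G] f) ^+ 2.

Fixpoint cube_der k : cube G k -> (G -> R[i]) -> G -> R[i] :=
  if k is k'.+1 then fun h f => cube_der h.2 (mder h.1 f) else fun _ f => f.

Lemma gowers_ge0 k f : 0 <= gowers k f.
Proof.
elim: k f => [|k IH] f /=; first exact: sqr_ge0.
by apply: avg_ge0 => n _; exact: IH.
Qed.

Lemma mder_conj n f : mder n (fun x => (f x)^*) = fun x => (mder n f x)^*.
Proof. by apply/funext => x; rewrite /mder rmorphM. Qed.

Lemma gowers_conj k f : gowers k (fun x => (f x)^*) = gowers k f.
Proof.
elim: k f => [|k IH] f /=; first by rewrite -avg_conj modcJ.
by apply: eq_avg => n _; rewrite mder_conj IH.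
Qed.

Lemma sqr_modc_avg_mder f :
  (modc (avg [set: G] f) ^+ 2)%:C = avg [set: G] (fun n => avg [set: G] (mder n f)).
Proof.
rewrite sqr_modc_avgE exchange_avg.
rewrite [RHS]exchange_avg exchange_avg; apply: eq_avg => x _.
by rewrite -(avg_shift x); apply: eq_avg => n _; rewrite /mder addrC.
Qed.

Lemma cube_der_mder k (h : cube G k) n f :
  cube_der h (mder n f) = mder n (cube_der h f).
Proof. by elim: k h f => [|k IH] //= h f; rewrite mderC IH. Qed.

Lemma bounded1_cube_der k (h : cube G k) f : bounded1 f -> bounded1 (cube_der h f).
Proof. by elim: k h f => [|k IH] //= h f f1; apply/IH/bounded1_mder. Qed.

(** The norm of higher degree is an average of norms of lower degree of
    derivatives; used with $m=0$ and $m=1$. *)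
Lemma gowers_cube m k f :
  gowers (m + k) f = avg [set: cube G k] (fun h => gowers m (cube_der h f)).
Proof.
elim: k f => [|k IH] f.
  by rewrite addn0 avg_cube0.
rewrite addnS /= (avg_setT2 (fun h : G * cube G k => gowers m (cube_der h.2 (mder h.1 f)))).
by apply: eq_avg => n _; exact: IH.
Qed.

(** Products of bounded functions on $G^k$ each of which ignores one of the
    coordinates: the first factor below ignores the first coordinate. *)
Fixpoint coord_free k : (cube G k -> R[i]) -> Prop :=
  if k is k'.+1 then fun b => exists c d,
    [/\ bounded1 c, forall a : G, @coord_free k' (d a) & forall a h, b (a, h) = c h * d a h]
  else fun b => forall h, b h = 1.

Lemma coord_free_mul k (b b' : cube G k -> R[i]) :
  coord_free b -> coord_free b' -> coord_free (fun h => b h * b' h).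
Proof.
elim: k b b' => [|k IH] b b' /=; first by move=> b1 b1' h; rewrite b1 b1' mulr1.
move=> [c [d [c1 dl bE]]] [c' [d' [c1' dl' bE']]].
exists (fun h => c h * c' h), (fun a h => d a h * d' a h); split.
- by move=> h; rewrite le_modcM.
- by move=> a; apply: IH.
- by move=> a h; rewrite bE bE' mulrACA.
Qed.

Lemma coord_free_conj k (b : cube G k -> R[i]) :
  coord_free b -> coord_free (fun h => (b h)^*).
Proof.
elim: k b => [|k IH] b /=; first by move=> b1 h; rewrite b1 rmorph1.
move=> [c [d [c1 dl bE]]]; exists (fun h => (c h)^*), (fun a h => (d a h)^*); split.
- by move=> h; rewrite modcJ.
- by move=> a; apply: IH.
- by move=> a h; rewrite bE rmorphM.
Qed.

(** All vertices of a derivative other than the top one miss a coordinate. *)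
Lemma cube_der_top k f : bounded1 f ->
  exists b : G -> cube G k -> R[i], forall x, coord_free (b x) /\
    forall h, cube_der h f x = iter k (@Num.conj R[i]) (f (x + coord_sum h)) * b x h.
Proof.
move=> f1; elim: k => [|k [b bP]] /=.
  by exists (fun _ _ => 1) => x; split => // h; rewrite addr0 mulr1.
exists (fun x h => cube_der h.2 f x * (b (x + h.1) h.2)^*) => x; split.
  exists (fun h => cube_der h f x), (fun a h => (b (x + a) h)^*); split => //.
  - by move=> h; apply: bounded1_cube_der.
  - by move=> a; apply/coord_free_conj/(bP _).1.
move=> [a h] /=; rewrite cube_der_mder /mder (bP (x + a)).2 rmorphM /= addrA.
by rewrite mulrCA.
Qed.

(** The product of $u$, suitably conjugated, over the $2^k$ points each
    coordinate of which is taken from $h$ or from $h'$. *)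
Fixpoint vertex_prod k : (cube G k -> R[i]) -> cube G k -> cube G k -> R[i] :=
  if k is k'.+1 then fun u h h' =>
    vertex_prod (fun t => u (h.1, t) * (u (h'.1, t))^*) h.2 h'.2
  else fun u h _ => u h.

(** The box form of the Cauchy--Schwarz--Gowers inequality: one application of
    Cauchy--Schwarz per coordinate removes the factor that ignores it. *)
Lemma box_cauchy_schwarz k (Z : finType) (S : {set Z}) (u b : Z -> cube G k -> R[i]) :
  (forall z, coord_free (b z)) ->
  modc (avg S (fun z => avg [set: cube G k] (fun h => u z h * b z h))) ^+ (2 ^ k) <=
  avg [set: cube G k] (fun h => avg [set: cube G k] (fun h' =>
    modc (avg S (fun z => vertex_prod (u z) h h')))).
Proof.
elim: k Z S u b => [|k IH] Z S u b bl.
  rewrite expr1 !avg_cube0 le_eqVlt; apply/orP; left; apply/eqP; congr modc.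
  by apply: eq_avg => z _; rewrite avg_cube0 bl mulr1.
have /choice[c cP] : forall z, exists c, exists d,
  [/\ bounded1 c, forall a : G, @coord_free k (d a) & forall a h, b z (a, h) = c h * d a h].
  by move=> z; exact: (bl z).
have /choice[d dP] := cP; clear cP.
pose u' a a' z t := u z (a, t) * (u z (a', t))^*.
pose b' a a' z t := d z a t * (d z a' t)^*.
pose Q := avg (setX S [set: cube G k]) (fun zt =>
  modc (avg [set: G] (fun a => u zt.1 (a, zt.2) * d zt.1 a zt.2)) ^+ 2).
have Q0 : 0 <= Q by apply: avg_ge0 => zt _; exact: sqr_ge0.
have h1 : modc (avg S (fun z => avg [set: cube G k.+1] (fun h => u z h * b z h))) ^+ 2 <= Q.
  have -> : avg S (fun z => avg [set: cube G k.+1] (fun h => u z h * b z h)) =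
     avg (setX S [set: cube G k]) (fun zt => c zt.1 zt.2 *
        avg [set: G] (fun a => u zt.1 (a, zt.2) * d zt.1 a zt.2)).
    rewrite avg_setX; apply: eq_avg => z _ /=.
    rewrite (avg_setT2 (fun h : G * cube G k => u z h * b z h)) exchange_avg.
    apply: eq_avg => t _; rewrite -avgZ; apply: eq_avg => a _.
    by have [_ _ ->] := dP z; rewrite mulrCA.
  by apply: sqr_modc_avgM => -[z t] _ /=; have [c1 _ _] := dP z; exact: c1.
have h2 : Q <= avg [set: G] (fun a => avg [set: G] (fun a' =>
    modc (avg S (fun z => avg [set: cube G k] (fun t => u' a a' z t * b' a a' z t))))).
  rewrite -[leLHS](modc_real Q0) avgC avg_setX /=.
  have -> : avg S (fun z => avg [set: cube G k] (fun t =>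
      (modc (avg [set: G] (fun a => u z (a, t) * d z a t)) ^+ 2)%:C)) =
     avg [set: G] (fun a => avg [set: G] (fun a' =>
       avg S (fun z => avg [set: cube G k] (fun t => u' a a' z t * b' a a' z t)))).
    under [RHS]eq_avg do rewrite exchange_avg.
    rewrite [RHS]exchange_avg; apply: eq_avg => z _.
    under [RHS]eq_avg do rewrite exchange_avg.
    rewrite [RHS]exchange_avg; apply: eq_avg => t _.
    rewrite sqr_modc_avgE; apply: eq_avg => a _; apply: eq_avg => a' _.
    by rewrite rmorphM /= mulrACA.
  apply: le_trans (modc_avg _ _) _; apply: ler_avg => a _; exact: modc_avg.
rewrite expnS exprM.
apply: (@le_trans _ _ (avg [set: G] (fun a => avg [set: G] (fun a' =>
    modc (avg S (fun z => avg [set: cube G k] (fun t => u' a a' z t * b' a a' z t)))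
    ^+ (2 ^ k))))).
  have A0 a : 0 <= avg [set: G] (fun a' => modc (avg S (fun z =>
      avg [set: cube G k] (fun t => u' a a' z t * b' a a' z t)))).
    by apply: avg_ge0 => a' _; exact: modc_ge0.
  apply: (@le_trans _ _ (avg [set: G] (fun a => avg [set: G] (fun a' =>
    modc (avg S (fun z => avg [set: cube G k] (fun t => u' a a' z t * b' a a' z t)))))
    ^+ (2 ^ k))).
    by rewrite lerXn2r ?nnegrE ?sqr_ge0 ?(le_trans h1 h2) // avg_ge0.
  apply: le_trans (avg_jensen _ _) _; first by move=> a _; exact: A0.
  apply: ler_avg => a _; apply: avg_jensen => a' _; exact: modc_ge0.
have -> : avg [set: cube G k.+1] (fun h => avg [set: cube G k.+1] (fun h' =>
    modc (avg S (fun z => vertex_prod (u z) h h')))) =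
  avg [set: G] (fun a => avg [set: G] (fun a' => avg [set: cube G k] (fun t =>
    avg [set: cube G k] (fun t' => modc (avg S (fun z => vertex_prod (u' a a' z) t t')))))).
  rewrite (avg_setT2 (fun h : G * cube G k => avg [set: cube G k.+1] (fun h' =>
    modc (avg S (fun z => vertex_prod (u z) h h'))))).
  apply: eq_avg => a _; rewrite [RHS]exchange_avg; apply: eq_avg => t _.
  by rewrite (avg_setT2 (fun h' : G * cube G k => modc (avg S (fun z =>
     @vertex_prod k.+1 (u z) (a, t) h')))).
apply: ler_avg => a _; apply: ler_avg => a' _; apply: IH => z.
have [_ dl _] := dP z.
by apply: coord_free_mul => //; apply: coord_free_conj.
Qed.

End Gowers.

(** * Characters and the Fourier transform on a cyclic group *)

Lemma exists_prim_root (R : realType) n :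
  (0 < n)%N -> exists z : R[i], n.-primitive_root z.
Proof.
move=> n0; pose p : {poly R[i]} := 'X^n - 1.
have [r Dp] := closed_field_poly_normal p.
move: Dp; rewrite (monicP _) ?monicXnsubC // scale1r => Dp.
have rn : all n.-unity_root r by apply/allP => z; rewrite -root_prod_XsubC -Dp.
have sz : (n < (size r).+1)%N by rewrite -(size_prod_XsubC r id) -Dp size_XnsubC.
have ur : uniq r.
  rewrite -separable.separable_prod_XsubC -Dp.
  by rewrite cyclotomic.separable_Xn_sub_1 // pnatr_eq0 -lt0n.
by have /hasP[z _ zP] := cyclic.has_prim_root n0 rn ur sz; exists z.
Qed.

Lemma card_ZpT P : (1 < P)%N -> #|'Z_P| = P.
Proof. by move=> hP; rewrite card_ord Zp_cast. Qed.

(** An additive character, because $w$ will be a primitive $P$-th root of unity. *)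
Definition zchar (R : realType) P (w : R[i]) (a : 'Z_P) : R[i] := w ^+ a.

Section Characters.
Import mathcomp.boot.finset.
Variables (R : realType) (P : nat) (w : R[i]).
Hypotheses (hP : (1 < P)%N) (pw : P.-primitive_root w).
Local Notation G := 'Z_P.
Local Notation e := (@zchar R P w).
Implicit Types (g : G -> R[i]) (a b x xi : G).

Lemma zcharD a b : e (a + b) = e a * e b.
Proof.
have h n m : m = P -> w ^+ (n %% m) = w ^+ n by move=> ->; rewrite (prim_expr_mod pw).
by rewrite /zchar -exprD; exact: h (Zp_cast hP).
Qed.

Lemma zchar0 : e 0 = 1. Proof. by rewrite /zchar expr0. Qed.

Lemma modc_zchar a : modc (e a) = 1.
Proof.
have h : modc (e a) ^+ P = 1.
  by rewrite -modcX /zchar -exprM mulnC exprM (prim_expr_order pw) expr1n modc1.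
have P0 : (0 < P)%N by apply: ltn_trans hP.
by apply/eqP; rewrite -(@pexpr_eq1 _ _ P) ?modc_ge0 // h.
Qed.

Lemma zcharN a : e (- a) = (e a)^*.
Proof.
have := modc_unit (modc_zchar a); set z := e a => zz.
have h : z * e (- a) = 1 by rewrite -zcharD subrr zchar0.
have z0 : z != 0 by apply/eqP => z0; move: h; rewrite z0 mul0r => /eqP; rewrite eq_sym oner_eq0.
by apply: (mulfI z0); rewrite h zz.
Qed.

Lemma zchar_nat a n : e (a * n%:R) = e a ^+ n.
Proof.
elim: n => [|n IH]; first by rewrite mulr0 zchar0 expr0.
by rewrite -natr1 mulrDr mulr1 zcharD IH exprSr.
Qed.

Lemma zchar_eq1 a : e a = 1 -> a = 0.
Proof.
move=> ea; apply/val_inj => /=.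
have /eqP := ea; rewrite /zchar -(prim_order_dvd pw) => /dvdnP[[|q] //= aq].
have : (a < P)%N by rewrite -[X in (_ < X)%N](Zp_cast hP).
rewrite aq mulSn => h.
by have : (P < P)%N; [apply: leq_ltn_trans h; exact: leq_addr|rewrite ltnn].
Qed.

Lemma sum_zchar a : \sum_x e (a * x) = if a == 0 then P%:R else 0.
Proof.
case: eqVneq => [->|a0].
  under eq_bigr do rewrite mul0r zchar0.
  by rewrite sumr_const card_ZpT.
have : \sum_x e (a * x) = e a * \sum_x e (a * x).
  rewrite -[LHS](sum_shift 1) mulr_sumr; apply: eq_bigr => x _.
  by rewrite mulrDr mulr1 addrC zcharD.
move/eqP; rewrite -subr_eq0 -{1}[\sum_x _]mul1r -mulrBl mulf_eq0 subr_eq0 => /orP[|/eqP //].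
by move=> /eqP/esym/zchar_eq1 /eqP; rewrite (negPf a0).
Qed.

Lemma avg_zchar a : avg [set: G] (fun x => e (a * x)) = (a == 0)%:R.
Proof.
rewrite /avg cardsT card_ZpT //.
have -> : \sum_(x in [set: G]) e (a * x) = \sum_x e (a * x) by apply: eq_bigl => x; rewrite inE.
rewrite sum_zchar; case: ifP => _ /=; rewrite ?mulr0 // mulVf // pnatr_eq0.
by case: (P) hP.
Qed.

Definition fourier g xi : R[i] := avg [set: G] (fun x => g x * e (- (xi * x))).

Lemma avg_delta (K : numFieldType) (F : G -> K) y :
  avg [set: G] (fun x => P%:R * F x * (x == y)%:R) = F y.
Proof.
rewrite /avg cardsT card_ZpT //.
have -> : \sum_(x in [set: G]) P%:R * F x * (x == y)%:R = P%:R * F y.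
  rewrite (bigD1 y) ?inE //= eqxx mulr1 big1 ?addr0 // => x /andP[_ /negPf ->].
  by rewrite mulr0.
by rewrite mulrA mulVf ?mul1r // pnatr_eq0; case: (P) hP.
Qed.

(** The autocorrelation of $g$ is the Fourier transform of $|\hat g|^2$, from
    which both Parseval's identity and the $U^2$ inverse theorem are read off. *)
Lemma fourier_autocorrelation g n :
  avg [set: G] (mder n g) = \sum_xi (modc (fourier g xi) ^+ 2)%:C * e (- (xi * n)).
Proof.
transitivity (\sum_xi avg [set: G] (fun x => avg [set: G] (fun y =>
    g x * (g y)^* * e (xi * (y - x - n))))).
  transitivity (avg [set: G] (fun x => avg [set: G] (fun y =>
    P%:R * (g x * (g y)^*) * (y == x + n)%:R))).
    by apply: eq_avg => x _; rewrite avg_delta.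
  rewrite [in RHS]/avg -mulr_sumr exchange_big /=; congr (_ * _).
  apply: eq_bigr => x _; rewrite -mulr_sumr exchange_big /=; congr (_ * _).
  apply: eq_bigr => y _; rewrite -mulr_sumr [P%:R * _]mulrC -[LHS]mulrA; congr (_ * _).
  under [RHS]eq_bigr do rewrite mulrC.
  rewrite sum_zchar -addrA -opprD subr_eq0; case: (y == x + n); rewrite ?mulr1 ?mulr0 //.
apply: eq_bigr => xi _; rewrite sqr_modc_avgE -avgZr; apply: eq_avg => x _.
rewrite -avgZr; apply: eq_avg => y _.
have -> : e (xi * (y - x - n)) = e (- (xi * x)) * e (xi * y) * e (- (xi * n)).
  by rewrite -!zcharD; congr (zchar w _); ring.
rewrite rmorphM /= -zcharN opprK; ring.
Qed.

Lemma parseval g :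
  \sum_xi modc (fourier g xi) ^+ 2 = avg [set: G] (fun x => modc (g x) ^+ 2).
Proof.
apply: complexI; rewrite rmorph_sum avgC.
have := fourier_autocorrelation g 0.
under [X in _ = X]eq_bigr do rewrite mulr0 oppr0 zchar0 mulr1.
move=> <-; apply: eq_avg => x _; by rewrite /mder addr0 -sqr_modc.
Qed.

(** The $U^2$ inverse theorem: $\|g\|_{U^2}^4=\sum_\xi|\hat g(\xi)|^4$, and one factor
    $|\hat g(\xi)|^2$ can be bounded by its maximum, the rest by Parseval. *)
Lemma gowers1_fourier g : bounded1 g ->
  exists xi, gowers 1 g <= modc (fourier g xi) ^+ 2.
Proof.
move=> g1; pose c xi := modc (fourier g xi) ^+ 2.
have c0 xi : 0 <= c xi by exact: sqr_ge0.
have -> : gowers 1 g = \sum_xi c xi ^+ 2.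
  apply: complexI => /=; rewrite avgC rmorph_sum /=.
  transitivity (avg [set: G] (fun n => \sum_xi \sum_zeta
      ((c xi)%:C * (c zeta)%:C) * e ((zeta - xi) * n))).
    apply: eq_avg => n _; rewrite sqr_modc fourier_autocorrelation rmorph_sum /= mulr_suml.
    apply: eq_bigr => xi _; rewrite mulr_sumr; apply: eq_bigr => zeta _.
    rewrite [(_ * _)^*]rmorphM /= -zcharN opprK mulrACA -zcharD; congr (_ * _).
      congr (_ * _); rewrite conj_Creal //.
      by apply/complex_realP; exists (modc (fourier g zeta) ^+ 2).
    by congr (zchar w _); rewrite mulrBl addrC.
  rewrite /avg exchange_big mulr_sumr; apply: eq_bigr => xi _.
  rewrite exchange_big mulr_sumr (bigD1 xi) //= [X in _ + X]big1 ?addr0; last first.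
    move=> zeta /negPf zx; rewrite -mulr_sumr mulrCA -/(avg _ _) avg_zchar subr_eq0 zx.
    by rewrite mulr0.
  by rewrite -mulr_sumr mulrCA -/(avg _ _) avg_zchar subrr eqxx mulr1 -rmorphM.
have [xi _ xiP] := @Order.TotalTheory.arg_maxP _ _ _ (0 : G) xpredT c isT.
exists xi; apply: (@le_trans _ _ (c xi * \sum_zeta c zeta)).
  rewrite mulr_sumr; apply: ler_sum => zeta _; rewrite expr2 ler_wpM2r //.
  exact: xiP.
rewrite parseval -[leRHS]mulr1 ler_wpM2l //; apply: avg_le => // x _.
by rewrite exprn_ile1 ?modc_ge0.
Qed.

End Characters.

(** * Products and alternating sums over the vertices of a cube *)

Section VertexProducts.
Import mathcomp.boot.finset.
Variables (R : realType) (G : finZmodType).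
Local Notation C := R[i].
Local Notation itconj k := (iter k (@Num.conj C)).

Lemma iter_conjM k (z z' : C) : itconj k (z * z') = itconj k z * itconj k z'.
Proof. by elim: k => //= k ->; rewrite rmorphM. Qed.

Lemma iter_conj_avg k (I : finType) (A : {set I}) (F : I -> C) :
  itconj k (avg A F) = avg A (fun i => itconj k (F i)).
Proof. by elim: k => //= k ->; rewrite avg_conj. Qed.

Lemma modc_iter_conj k (z : C) : modc (itconj k z) = modc z.
Proof. by elim: k => //= k; rewrite modcJ. Qed.

Lemma vertex_prodM k (u v : cube G k -> C) h h' :
  vertex_prod (fun t => u t * v t) h h' = vertex_prod u h h' * vertex_prod v h h'.
Proof.
elim: k u v h h' => //= k IH u v h h'; rewrite -IH; congr (vertex_prod _ _ _).
by apply/funext => t; rewrite rmorphM mulrACA.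
Qed.

Lemma vertex_prod_le1 k (u : cube G k -> C) h h' :
  bounded1 u -> modc (vertex_prod u h h') <= 1.
Proof.
elim: k u h h' => [|k IH] u h h' u1 //=; apply: IH => t.
by rewrite le_modcM ?modcJ.
Qed.

Lemma vertex_prod_const k (c : C) (h h' : cube G k.+1) :
  modc c = 1 -> vertex_prod (fun=> c) h h' = 1.
Proof.
case: h h' => [a t] [a' t'] c1 /=; rewrite (modc_unit c1).
by elim: k t t' => //= k IH s s'; rewrite rmorph1 mulr1; exact: IH.
Qed.

(** Indicators are carried through the box Cauchy--Schwarz inequality as
    booleans, so that the vertex $h$ can be recovered from the cube. *)
Fixpoint all_vertices k : (cube G k -> bool) -> cube G k -> cube G k -> bool :=
  if k is k'.+1 then fun A h h' =>
    all_vertices (fun t => A (h.1, t) && A (h'.1, t)) h.2 h'.2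
  else fun A h _ => A h.

Lemma all_vertices_sub k (A : cube G k -> bool) h h' : all_vertices A h h' -> A h.
Proof. by elim: k A h h' => //= k IH A [a t] [a' t'] /= /IH/andP[]. Qed.

Lemma vertex_prod_indicator k (A : cube G k -> bool) h h' :
  vertex_prod (fun t => (A t)%:R) h h' = (all_vertices A h h')%:R :> C.
Proof.
elim: k A h h' => //= k IH A h h'; rewrite -IH; congr (vertex_prod _ _ _).
by apply/funext => t; rewrite rmorph_nat -natrM mulnb.
Qed.

(** The alternating sum of $\phi$ over the vertices of the cube spanned by
    $h$ and $h'$. *)
Fixpoint alt_sum (H : zmodType) k : (cube G k -> H) -> cube G k -> cube G k -> H :=
  if k is k'.+1 then fun phi h h' =>
    alt_sum (fun t => phi (h.1, t) - phi (h'.1, t)) h.2 h'.2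
  else fun phi h _ => phi h.

Lemma alt_sum_morph (H H' : zmodType) k (phi : cube G k -> H) (m : H -> H') h h' :
  (forall a b, m (a - b) = m a - m b) ->
  alt_sum (fun t => m (phi t)) h h' = m (alt_sum phi h h').
Proof.
move=> mB; elim: k phi h h' => //= k IH phi h h'; rewrite -IH.
by congr (alt_sum _ _ _); apply/funext => t; rewrite mB.
Qed.

Lemma alt_sumB (H : zmodType) k (phi psi : cube G k -> H) h h' :
  alt_sum (fun t => phi t - psi t) h h' = alt_sum phi h h' - alt_sum psi h h'.
Proof.
elim: k phi psi h h' => //= k IH phi psi h h'; rewrite -IH.
by congr (alt_sum _ _ _); apply/funext => t; rewrite !opprD !opprK addrACA.
Qed.

Section Phase.
Variables (H : zmodType) (e : H -> C).
Hypotheses (eD : forall a b, e (a + b) = e a * e b)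
           (eN : forall a, e (- a) = (e a)^*) (e1 : forall a, modc (e a) = 1).

Lemma vertex_prod_phase k (phi : cube G k -> H) h h' :
  vertex_prod (fun t => e (phi t)) h h' = e (alt_sum phi h h').
Proof.
elim: k phi h h' => //= k IH phi h h'; rewrite -IH; congr (vertex_prod _ _ _).
by apply/funext => t; rewrite eD eN.
Qed.

(** With $h'$ fixed, $\phi(h)$ differs from its alternating sum by terms each
    of which has a coordinate of $h$ replaced by one of $h'$. *)
Lemma coord_free_phase k (phi : cube G k -> H) h' :
  coord_free (fun h => e (phi h - alt_sum phi h h')).
Proof.
elim: k phi h' => [|k IH] phi h' /=.
  by move=> h; rewrite subrr; have := eN 0; have := eD 0 0; rewrite oppr0 addr0 => h1 h2;
     rewrite h1 {2}h2 modc_unit.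
exists (fun t => e (alt_sum (fun s => phi (h'.1, s)) t h'.2)).
exists (fun a t => e (phi (a, t) - alt_sum (fun s => phi (a, s)) t h'.2)); split.
- by move=> t; rewrite e1.
- by move=> a; exact: IH.
- by move=> a t; rewrite -eD alt_sumB opprB addrA addrAC addrC.
Qed.

End Phase.

(** Multiplying the translates of $g$ over the vertices of a cube is the same
    as differentiating $g$ along its edges. *)
Lemma vertex_prod_shift k (g : G -> C) x (h h' : cube G k) :
  vertex_prod (fun t => itconj k (g (x + coord_sum t))) h h' =
  cube_der (h - h') g (x + coord_sum h').
Proof.
elim: k g x h h' => //= k IH g x [a t] [a' t'] /=.
rewrite addrA -IH; congr (vertex_prod _ _ _); apply/funext => s /=.
rewrite conjCK -[(itconj k _)^*]/(itconj k.+1 _) iterSr -iter_conjM /mder.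
rewrite mulrC; congr (itconj k (_ * _^*)); first by rewrite addrA.
by congr g; rewrite [RHS]addrAC -[x + a' + _]addrA [a' + _]addrC subrK addrA.
Qed.

End VertexProducts.

(** * The dual function and degree lowering *)

(** The counting operator of the configuration $x,\ x+y,\ x+y^2$. *)
Definition quad_form (R : rcfType) P (B : {set 'Z_P}) (f0 f1 f2 : 'Z_P -> R[i]) : R[i] :=
  avg [set: 'Z_P]%SET (fun x => avg B (fun y => f0 x * f1 (x + y) * f2 (x + y ^+ 2))).

(** Its dual function in the third argument. *)
Definition quad_dual (R : rcfType) P (B : {set 'Z_P}) (f0 f1 : 'Z_P -> R[i]) x : R[i] :=
  avg B (fun y => f0 (x - y ^+ 2) * f1 (x + y - y ^+ 2)).

Section DegreeLowering.
Import mathcomp.boot.finset.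
Variables (R : realType) (P : nat) (w : R[i]).
Hypotheses (hP : (1 < P)%N) (pw : P.-primitive_root w).
Local Notation G := 'Z_P.
Local Notation C := R[i].
Local Notation e := (@zchar R P w).
Local Notation itconj k := (iter k (@Num.conj C)).

Lemma quad_formE (B : {set G}) (f0 f1 f2 : G -> C) :
  quad_form B f0 f1 f2 = avg [set: G] (fun x => f2 x * quad_dual B f0 f1 x).
Proof.
rewrite /quad_form exchange_avg.
under [RHS]eq_avg do rewrite -avgZ.
rewrite [RHS]exchange_avg; apply: eq_avg => y _.
rewrite -[RHS](avg_shift (y ^+ 2)); apply: eq_avg => x _.
by rewrite [x + _ + y]addrAC !addrK mulrC.
Qed.

Lemma bounded1_quad_dual (B : {set G}) (f0 f1 : G -> C) :
  bounded1 f0 -> bounded1 f1 -> bounded1 (quad_dual B f0 f1).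
Proof. by move=> b0 b1 x; apply: modc_avg_le1 => y _; apply: le_modcM. Qed.

Lemma exists_ge_avg (I : finType) (A : {set I}) (F : I -> R) (c : R) i0 :
  i0 \in A -> c <= avg A F -> exists2 i, i \in A & c <= F i.
Proof.
move=> iA cF; apply: contrapT => h; have hF i : i \in A -> F i < c.
  by move=> iA'; rewrite ltNge; apply/negP => ?; apply: h; exists i.
move: cF; rewrite leNgt => /negP; apply.
rewrite -[ltRHS](avg_cst c iA) /avg ltr_pM2l ?invr_gt0 ?ltr0n; last by apply/card_gt0P; exists i0.
by apply: ltr_sum => //; apply/hasP; exists i0; rewrite ?mem_index_enum.
Qed.

Lemma exists_ge_sum (I : finType) (A : {set I}) (F : I -> R) (c m : R) : 0 < c -> 0 < m ->
  #|A|%:R <= m -> c <= \sum_(i in A) F i -> exists2 i, i \in A & c / m <= F i.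
Proof.
move=> c0 m0 Am cF; apply: contrapT => h; have hF i : i \in A -> F i <= c / m.
  by move=> iA'; rewrite leNgt; apply/negP => /ltW ?; apply: h; exists i.
case: (set_0Vmem A) => [A0|[i iA]].
  by move: cF; rewrite A0 big_set0 leNgt c0.
have hi : F i < c / m.
  by rewrite ltNge; apply/negP => ?; apply: h; exists i.
have : \sum_(i in A) F i < \sum_(i in A) c / m.
  rewrite (bigD1 i) //= [ltRHS](bigD1 i) //= ltr_leD //.
  by apply: ler_sum => j /andP[jA _]; exact: hF.
rewrite sumr_const -mulr_natl ltNge => /negP; apply; apply: le_trans cF.
by rewrite mulrA ler_pdivrMr // [leRHS]mulrC ler_wpM2r // ltW.
Qed.

(** Degree lowering. If the dual function has large $U^{k+3}$ norm, many of its
    $k+1$-fold derivatives correlate with a character $\phi(h)$. Expanding only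
    the top vertex of the derivative as an average over $y$ and discarding the
    other vertices by Cauchy--Schwarz, the alternating sums of $\phi$ are
    frequencies at which the operator itself is large. By hypothesis these lie
    in a small set $S$, so $\phi$ is, on a dense set, a constant plus terms that
    miss a coordinate; those are again discarded by Cauchy--Schwarz, which leaves
    the $U^{k+2}$ norm. *)
Lemma degree_lowering (B S : {set G}) (f0 f1 : G -> C) (k : nat) (eta theta m : R) :
  bounded1 f0 -> bounded1 f1 ->
  (forall p0 p1 psi, bounded1 p0 -> bounded1 p1 ->
     theta <= modc (quad_form B p0 p1 (fun x => e (- (psi * x)))) -> psi \in S) ->
  0 < eta -> 0 < theta -> 0 < m -> #|S|%:R <= m ->
  2 * theta <= (eta / 2) ^+ (2 ^ k.+1) ->
  eta <= gowers k.+2 (quad_dual B f0 f1) ->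
  (eta / 2 * (theta / m)) ^+ (2 ^ k.+1) <= gowers k.+1 (quad_dual B f0 f1).
Proof.
move=> b0 b1 HS eta0 theta0 m0 Sm th etaU; pose F := quad_dual B f0 f1.
pose K := k.+1.
have bF : bounded1 F by exact: bounded1_quad_dual.
have bcd h : bounded1 (@cube_der R G K h F) by exact: bounded1_cube_der.
have /choice[phi phiP] : forall h : cube G K, exists xi,
    gowers 1 (cube_der h F) <= modc (fourier w (cube_der h F) xi) ^+ 2.
  by move=> h; exact: gowers1_fourier.
pose ft h := fourier w (cube_der h F) (phi h).
have ft1 h : modc (ft h) <= 1.
  apply: modc_avg_le1 => x _; rewrite modcM modc_zchar // mulr1; exact: bcd.
have ft2 h : modc (ft h) ^+ 2 <= modc (ft h).
  by rewrite expr2 ler_piMl ?modc_ge0.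
have avgc : eta <= avg [set: cube G K] (fun h => modc (ft h) ^+ 2).
  apply: le_trans etaU _; rewrite (gowers_cube 1 K F : gowers k.+2 F = _).
  by apply: ler_avg => h _; exact: phiP.
(* the set of $h$ with a large coefficient, and the phase that makes it positive *)
pose A h := (eta / 2 <= modc (ft h) ^+ 2)%R.
have avgA : eta / 2 <= avg [set: cube G K] (fun h => (A h)%:R * modc (ft h)).
  have : avg [set: cube G K] (fun h => modc (ft h) ^+ 2) <=
      avg [set: cube G K] (fun h => (A h)%:R * modc (ft h) + eta / 2).
    apply: ler_avg => h _; rewrite /A; case: (leP (eta / 2) (modc (ft h) ^+ 2)) => [_|/ltW hh].
      by rewrite /= mulr1n mul1r; apply: le_trans (ft2 h) _; rewrite lerDl divr_ge0 // ltW.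
    by rewrite /= mulr0n mul0r add0r.
  rewrite avgD => /(le_trans avgc).
  have := avg_cst (eta / 2) (in_setT (0 : cube G K)) => ->.
  lra.
pose a h : C := (ft h)^* / (modc (ft h))%:C.
have a1 h : modc (a h) <= 1.
  rewrite /a modcM modcV modcJ modc_real ?modc_ge0 //.
  by have [->|h0] := eqVneq (modc (ft h)) 0; rewrite ?mul0r // divff.
have aE h : a h * ft h = (modc (ft h))%:C.
  rewrite /a mulrAC [_^* * _]mulrC -sqr_modc expr2 rmorphM /=.
  have [->|h0] := eqVneq (modc (ft h)) 0; first by rewrite mul0r mul0r.
  by rewrite mulfK //; apply: contra h0 => /eqP h0; apply/eqP/complexI.
have [b bP] := cube_der_top K bF.
pose F' y x := f0 (x - y ^+ 2) * f1 (x + y - y ^+ 2).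
(* the top vertex, with the average over $y$ in the dual function left open *)
pose u (z : G * G) h := ((A h)%:R * a h) * e (- (phi h * z.1))
    * itconj K (F' z.2 (z.1 + coord_sum h)).
have step1 : (eta / 2) ^+ (2 ^ K) <= avg [set: cube G K] (fun h =>
   avg [set: cube G K] (fun h' => modc (avg (setX [set: G] B)
     (fun z => vertex_prod (u z) h h')))).
  apply: le_trans (box_cauchy_schwarz (setX [set: G] B) u (fun z => (bP z.1).1)).
  have -> : avg (setX [set: G] B) (fun z => avg [set: cube G K] (fun h => u z h * b z.1 h))
     = (avg [set: cube G K] (fun h => (A h)%:R * modc (ft h)))%:C.
    rewrite exchange_avg avgC; apply: eq_avg => h _.
    rewrite rmorphM rmorph_nat /= -aE mulrA /ft /fourier -avgZ avg_setX.
    apply: eq_avg => x _; rewrite (bP x).2 /F /quad_dual iter_conj_avg /u /=.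
    rewrite -avgZr -avgZr -avgZ; apply: eq_avg => y _.
    by rewrite /F'; ring.
  rewrite modc_real; last by apply: avg_ge0 => h _; rewrite mulr_ge0 ?modc_ge0.
  by rewrite lerXn2r ?nnegrE ?divr_ge0 ?(ltW eta0) // (le_trans _ avgA) // divr_ge0 // ltW.
(* the vertices of a cube combine to the operator at one frequency *)
pose p (f : G -> C) (h h' : cube G K) x := vertex_prod (fun t => itconj K (f (x + coord_sum t))) h h'.
have pb f h h' : bounded1 f -> bounded1 (p f h h').
  by move=> bf x; apply: vertex_prod_le1 => t; rewrite modc_iter_conj.
pose Lam h h' := modc (quad_form B (p f0 h h') (p f1 h h') (fun x => e (- (alt_sum phi h h' * x)))).
have Lam1 h h' : Lam h h' <= 1.
  rewrite /Lam quad_formE; apply: modc_avg_le1 => x _; apply: le_modcM; first by rewrite modc_zchar.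
  by apply: bounded1_quad_dual; exact: pb.
have step2 h h' : modc (avg (setX [set: G] B) (fun z => vertex_prod (u z) h h')) <=
    (all_vertices A h h')%:R * Lam h h'.
  have -> : avg (setX [set: G] B) (fun z => vertex_prod (u z) h h') =
     (all_vertices A h h')%:R * vertex_prod a h h' *
     quad_form B (p f0 h h') (p f1 h h') (fun x => e (- (alt_sum phi h h' * x))).
    rewrite quad_formE avg_setX -avgZ; apply: eq_avg => x _.
    rewrite /quad_dual -avgZ -avgZ; apply: eq_avg => y _.
    rewrite /u vertex_prodM vertex_prodM vertex_prodM.
    rewrite vertex_prod_indicator -!mulrA; congr (_ * (_ * _)); congr (_ * _).
      rewrite (@vertex_prod_phase R G G e (zcharD hP pw) (zcharN hP pw)).
      by congr (zchar w _); rewrite (@alt_sum_morph G G G K phi (fun v => - (v * x))) // => v v'; ring.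
    rewrite -vertex_prodM; congr (vertex_prod _ _ _); apply/funext => t.
    by rewrite -iter_conjM /F'; congr (itconj K (f0 _ * f1 _)); rewrite /=; ring.
  rewrite modcM modcM modc_nat ler_wpM2r ?modc_ge0 //.
  by rewrite ler_piMr // vertex_prod_le1.
have step3 : theta <= avg [set: cube G K] (fun h' => avg [set: cube G K] (fun h =>
   (all_vertices A h h' && (alt_sum phi h h' \in S))%:R)).
  have : avg [set: cube G K] (fun h => avg [set: cube G K] (fun h' =>
      modc (avg (setX [set: G] B) (fun z => vertex_prod (u z) h h')))) <=
    avg [set: cube G K] (fun h => avg [set: cube G K] (fun h' =>
    (all_vertices A h h' && (alt_sum phi h h' \in S))%:R + theta)).
    apply: ler_avg => h _; apply: ler_avg => h' _; apply: le_trans (step2 h h') _.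
    case: (all_vertices A h h') => /=; last by rewrite mulr0n mul0r add0r ltW.
    rewrite mulr1n mul1r; case: (boolP (alt_sum phi h h' \in S)) => [_|hS].
      by apply: le_trans (Lam1 h h') _; rewrite mulr1n lerDl ltW.
    rewrite mulr0n add0r leNgt; apply/negP => /ltW hL; move/negP: hS; apply.
    by apply: HS hL; exact: pb.
  move/(le_trans step1)/(le_trans th).
  under eq_avg do rewrite avgD (avg_cst theta (in_setT (0 : cube G K))).
  rewrite avgD (avg_cst theta (in_setT (0 : cube G K))) exchange_avg.
  lra.
(* fix $h'$ and the most popular value $\psi\in S$ of the alternating sum *)
have [h' _ h'P] := exists_ge_avg (in_setT (0 : cube G K)) step3.
have [psi _ psiP] : exists2 psi, psi \in S & theta / m <= avg [set: cube G K] (fun h =>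
   (all_vertices A h h' && (alt_sum phi h h' == psi))%:R).
  apply: exists_ge_sum => //; apply: le_trans h'P _.
  rewrite /avg -mulr_sumr ler_wpM2l ?invr_ge0 // exchange_big.
  apply: ler_sum => h _; case: (all_vertices A h h') => /=; last by rewrite /= ?mulr0n sumr_ge0.
  case: (boolP (_ \in S)) => hS; last by rewrite /= ?mulr0n sumr_ge0.
  by rewrite (bigD1 (alt_sum phi h h')) //= eqxx /= ?mulr1n lerDl sumr_ge0.
pose bb (x : G) (h : cube G K) := e (- (phi h * x) - alt_sum (fun t => - (phi t * x)) h h').
have bbl x : coord_free (bb x).
  exact: (coord_free_phase (zcharD hP pw) (zcharN hP pw) (modc_zchar hP pw)).
(* $\phi(h)$ is now $\psi$ plus terms that miss a coordinate of $h$ *)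
pose g h x := cube_der h F x * e (- (psi * x)) * bb x h.
have step4 : eta / 2 * (theta / m) <= avg [set: cube G K] (fun h => modc (avg [set: G] (g h)) ^+ 2).
  apply: (@le_trans _ _ (avg [set: cube G K] (fun h => eta / 2 *
     (all_vertices A h h' && (alt_sum phi h h' == psi))%:R))).
    by rewrite avgZ ler_wpM2l // divr_ge0 // ltW.
  apply: ler_avg => h _; case: (boolP (_ && _)) => [/andP[hA /eqP hpsi]|_] /=; last first.
    by rewrite mulr0 sqr_ge0.
  rewrite mulr1; move/all_vertices_sub: hA => /le_trans; apply.
  rewrite le_eqVlt; apply/orP; left; apply/eqP; congr (modc _ ^+ 2).
  apply: eq_avg => x _; rewrite /g /bb -mulrA -(zcharD hP pw); congr (_ * zchar w _).
  rewrite (@alt_sum_morph G G G K phi (fun v => - (v * x))) ?hpsi; last by move=> v v'; ring.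
  ring.
have /choice[b2 b2P] : forall n, exists b : G -> cube G K -> C, forall x, coord_free (b x) /\
    forall h, cube_der h (mder n F) x = itconj K (mder n F (x + coord_sum h)) * b x h.
  by move=> n; apply: cube_der_top; exact: bounded1_mder.
pose u2 (z : G * G) (h : cube G K) := e (psi * z.1) * itconj K (mder z.1 F (z.2 + coord_sum h)).
pose c2 (z : G * G) h := b2 z.1 z.2 h * (bb z.2 h * (bb (z.2 + z.1) h)^*).
have c2l z : coord_free (c2 z).
  apply: coord_free_mul; first exact: (b2P z.1 z.2).1.
  by apply: coord_free_mul => //; apply: coord_free_conj.
(* squaring out differentiates once more and leaves $\psi$ in a factor constant in $h$ *)
have step5 : (avg [set: cube G K] (fun h => modc (avg [set: G] (g h)) ^+ 2))%:C =
    avg [set: G * G] (fun z => avg [set: cube G K] (fun h => u2 z h * c2 z h)).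
  rewrite avgC exchange_avg; apply: eq_avg => h _.
  rewrite sqr_modc_avg_mder avg_setT2; apply: eq_avg => n _; apply: eq_avg => x _.
  rewrite /u2 /c2 /=.
  have -> : mder n (g h) x = cube_der h (mder n F) x *
      (e (- (psi * x)) * (e (- (psi * (x + n))))^*) * (bb x h * (bb (x + n) h)^*).
    by rewrite cube_der_mder /mder /g !rmorphM /=; ring.
  rewrite (b2P n x).2 -(zcharN hP pw) -(zcharD hP pw).
  have -> : - (psi * x) - - (psi * (x + n)) = psi * n by ring.
  ring.
have step6 := box_cauchy_schwarz [set: G * G] u2 c2l.
rewrite -step5 modc_real in step6; last by apply: avg_ge0 => h _; exact: sqr_ge0.
apply: (@le_trans _ _ ((avg [set: cube G K] (fun h => modc (avg [set: G] (g h)) ^+ 2)) ^+ (2 ^ K))).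
  rewrite lerXn2r ?nnegrE //; last by apply: avg_ge0 => h _; exact: sqr_ge0.
  by rewrite mulr_ge0 // divr_ge0 // ltW.
apply: le_trans step6 _.
rewrite (gowers_cube 0 K F : gowers k.+1 F = _) exchange_avg.
rewrite le_eqVlt; apply/orP; left; apply/eqP.
transitivity (avg [set: cube G K] (fun t' : cube G K => avg [set: cube G K] (fun h => gowers 0 (cube_der h F)))).
  apply: eq_avg => t' _; rewrite -[RHS](avg_shift (- t')); apply: eq_avg => t _.
  transitivity (modc (avg [set: G] (fun n => avg [set: G] (mder n (cube_der (t - t') F))))).
    congr modc; rewrite avg_setT2; apply: eq_avg => n _.
    rewrite -[RHS](avg_shift (coord_sum t')); apply: eq_avg => x _.
    rewrite /u2 vertex_prodM vertex_prod_const ?modc_zchar //.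
    by rewrite mul1r vertex_prod_shift cube_der_mder.
  by rewrite -sqr_modc_avg_mder modc_real ?sqr_ge0.
by rewrite (avg_cst _ (in_setT (0 : cube G K))).
Qed.

End DegreeLowering.

(** * Powers of a complex number that come close to 1 *)

Section CloseToOne.
Variable R : realType.
Implicit Types (z : R[i]).

Lemma dist1_mul z z' : modc z = 1 -> modc (1 - z * z') <= modc (1 - z) + modc (1 - z').
Proof.
move=> z1; have -> : 1 - z * z' = (1 - z) + z * (1 - z') by ring.
by apply: le_trans (modcD _ _) _; rewrite modcM z1 mul1r.
Qed.

Lemma dist1_exp z n : modc z = 1 -> modc (1 - z ^+ n) <= n%:R * modc (1 - z).
Proof.
move=> z1; elim: n => [|n IH]; first by rewrite expr0 subrr modc0 mul0r.
rewrite exprS -natr1 mulrDl mul1r [leRHS]addrC; apply: le_trans (dist1_mul _ z1) _.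
by rewrite lerD2l.
Qed.

Lemma dist1_diff z m n : modc z = 1 -> (m <= n)%N ->
  modc (1 - z ^+ (n - m)) <= modc (1 - z ^+ m) + modc (1 - z ^+ n).
Proof.
move=> z1 mn; have <- : modc (z ^+ m * (1 - z ^+ (n - m))) = modc (1 - z ^+ (n - m)).
  by rewrite modcM modcX z1 expr1n mul1r.
rewrite mulrBr mulr1 -exprD subnKC //.
have -> : z ^+ m - z ^+ n = - (1 - z ^+ m) + (1 - z ^+ n) by ring.
by apply: le_trans (modcD _ _) _; rewrite modcN.
Qed.

(** Each term is within $1/2$ of 1. *)
Lemma geometric_sum_ge z n : modc z = 1 -> n%:R * modc (1 - z) <= 1 / 2 ->
  n%:R / 2 <= modc (\sum_(i < n) z ^+ i).
Proof.
move=> z1 nz; pose s := \sum_(i < n) z ^+ i.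
have hn : n%:R = (n%:R - s) + s :> R[i] by ring.
have : modc (n%:R - s) <= n%:R / 2.
  have -> : n%:R - s = \sum_(i < n) (1 - z ^+ i).
    by rewrite sumrB sumr_const card_ord.
  apply: le_trans (modc_sum _ _ _) _.
  have -> : n%:R / 2 = \sum_(i < n) (1 / 2 : R).
    by rewrite sumr_const card_ord -[RHS]mulr_natl mul1r.
  apply: ler_sum => i _; apply: le_trans (dist1_exp i z1) _.
  by apply: le_trans nz; rewrite ler_wpM2r ?modc_ge0 // ler_nat ltnW.
have := modcD (n%:R - s) s; rewrite -hn modc_nat -/s; lra.
Qed.

Lemma sub1rX z n : 1 - z ^+ n = (1 - z) * \sum_(i < n) z ^+ i.
Proof. by rewrite -opprB subrX1 -mulNr opprB. Qed.

(** The converse of [dist1_exp] up to a constant, as long as the powers do not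
    wind around the circle. *)
Lemma dist1_exp_ge z n : modc z = 1 -> n%:R * modc (1 - z) <= 1 / 2 ->
  n%:R * modc (1 - z) <= 2 * modc (1 - z ^+ n).
Proof.
move=> z1 nz; rewrite sub1rX modcM.
have := geometric_sum_ge z1 nz; have := modc_ge0 (1 - z); nra.
Qed.

Lemma geometric_sum_le z n : modc z = 1 ->
  modc (1 - z) * modc (\sum_(i < n) z ^+ i) <= 2.
Proof.
move=> z1; rewrite -modcM -sub1rX; apply: le_trans (modcD _ _) _.
by rewrite modcN modc1 modcX z1 expr1n.
Qed.

End CloseToOne.

(** Pigeonhole over the blocks of length $W$: the extreme elements of $H$ in the
    block that contains most of them. *)
Lemma dense_window (M W : nat) (H : {set 'I_M}%SET) :
  (0 < W <= M)%N -> (0 < #|H|)%N ->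
  exists i j : 'I_M, [/\ i \in H, j \in H, (i <= j)%N, (j - i < W)%N &
    (#|H| * W <= 2 * M * (j - i).+1)%N].
Proof.
move=> /andP[W0 WM] H0.
have M0 : (0 < M)%N by exact: leq_trans WM.
pose blk (i : 'I_M) : 'I_(M %/ W).+1 := inord (i %/ W).
have blkE i : blk i = (i %/ W)%N :> nat.
  by rewrite inordK // ltnS leq_div2r // ltnW.
pose Hc c := [set i in H | blk i == c]%SET.
have sumH : #|H| = (\sum_c #|Hc c|)%N.
  rewrite -sum1_card (partition_big blk xpredT) //=; apply: eq_bigr => c _.
  by rewrite -sum1_card; apply: eq_bigl => i; rewrite finset.inE.
have [c cP] : exists c, (#|H| <= (M %/ W).+1 * #|Hc c|)%N.
  apply: contrapT => hc; have hlt c : (#|Hc c| * (M %/ W).+1 < #|H|)%N.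
    by rewrite ltnNge; apply/negP => h; apply: hc; exists c; rewrite mulnC.
  have : (\sum_(c : 'I_(M %/ W).+1) #|Hc c| * (M %/ W).+1 < \sum_(c : 'I_(M %/ W).+1) #|H|)%N.
    rewrite big_ord_recl [X in (_ < X)%N]big_ord_recl -addSn leq_add //.
    by apply: leq_sum => i _; apply: ltnW.
  by rewrite -big_distrl /= -sumH sum_nat_const card_ord mulnC ltnn.
have Hc0 : (0 < #|Hc c|)%N.
  by rewrite lt0n; apply/negP => /eqP h; move: cP; rewrite h muln0 leqNgt H0.
have /card_gt0P[i0 i0c] := Hc0.
have [i ic imin] := @arg_minnP _ i0 (fun i => i \in Hc c) (fun i => i : nat) i0c.
have [j jc jmax] := @arg_maxnP _ i0 (fun i => i \in Hc c) (fun i => i : nat) i0c.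
have ij : (i <= j)%N by exact: imin.
have cardc : (#|Hc c| <= (j - i).+1)%N.
  rewrite cardE -(size_map val) -(size_iota i (j - i).+1).
  apply: uniq_leq_size; first by rewrite map_inj_uniq ?enum_uniq //; exact: val_inj.
  move=> x0 /mapP[n]; rewrite mem_enum => nc ->; rewrite mem_iota.
  by rewrite imin //= addnS ltnS subnKC //; exact: jmax.
have inHc n : n \in Hc c -> n \in H /\ (n %/ W = c)%N.
  by rewrite finset.inE => /andP[nH /eqP <-]; rewrite blkE.
exists i, j; split => //; try exact: (inHc _ _).1.
- have [_ hi] := inHc _ ic; have [_ hj] := inHc _ jc.
  rewrite (divn_eq i W) (divn_eq j W) hi hj.
  rewrite subnDl; apply: leq_ltn_trans (leq_subr _ _) _; exact: ltn_pmod.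
- apply: (@leq_trans ((M %/ W).+1 * (j - i).+1 * W)).
    by rewrite leq_mul2r (leq_trans cP) ?orbT // leq_mul2l cardc orbT.
  rewrite mulnAC leq_mul2r; apply/orP; right.
  by rewrite mulSn mul2n -addnn addnC leq_add // leq_trunc_div.
Qed.

(** If $z^h$ is within $\kappa/M$ of 1 for a proportion $\rho$ of the
    $h<M$, then $z^d$ is within $O(M^{-2})$ of 1 for some bounded $d$. Two such $h$
    at bounded distance provide $d$; two more, at a distance $j$ as large
    as possible subject to $(z^d)^j$ not winding around the circle, give the
    bound, since $(z^d)^j=(z^j)^d$. *)
Lemma many_close_powers (R : realType) (z : R[i]) (M : nat) (rho kappa : R) (H : {set 'I_M}%SET) :
  modc z = 1 -> 0 < rho <= 1 -> 1 <= kappa -> 320 * kappa / rho ^+ 2 < M%:R ->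
  (forall h, h \in H -> modc (1 - z ^+ h) <= kappa / M%:R) ->
  rho * M%:R <= #|H|%:R ->
  exists d, [/\ (0 < d)%N, d%:R <= 5 / rho &
    modc (1 - z ^+ d) * M%:R ^+ 2 <= 80 * kappa / rho ^+ 2].
Proof.
move=> z1 /andP[rho0 rho1] kappa1 Mbig Hz Hbig.
have kappa0 : 0 < kappa by apply: lt_le_trans kappa1.
have Mb : 320 * kappa < M%:R * rho ^+ 2 by rewrite -ltr_pdivrMr // exprn_gt0.
have rr : rho ^+ 2 <= rho by rewrite expr2 ler_piMr // ltW.
have M0 : 0 < M%:R :> R.
  by apply: le_lt_trans Mbig; exact: divr_ge0 (mulr_ge0 (ler0n R 320) (ltW kappa0)) (sqr_ge0 _).
have Mb1 : 320 * kappa < M%:R * rho.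
  by apply: lt_le_trans Mb _; rewrite ler_wpM2l // ltW.
have Mb2 : 320 * kappa < M%:R by apply: lt_le_trans Mb1 _; rewrite ler_piMr // ltW.
have H0 : (0 < #|H|)%N.
  by rewrite -(ltr0n R); apply: lt_le_trans Hbig; rewrite mulr_gt0.
(* this is used with a bounded window to find $d$, and with a long one to bound $1-z^d$ *)
have window W : (0 < W <= M)%N -> exists i j : 'I_M, [/\ i \in H, j \in H, (i <= j)%N,
    (j - i < W)%N & rho * W%:R <= 2 * (j - i).+1%:R].
  move=> WM; have [i [j [iH jH ij jiW big]]] := dense_window WM H0.
  exists i, j; split => //.
  rewrite -(ler_pM2r M0) -mulrA [W%:R * _]mulrC mulrA.
  apply: (@le_trans _ _ (#|H|%:R * W%:R)); first by rewrite ler_wpM2r.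
  by rewrite mulrAC -!natrM ler_nat.
have close i j : i \in H -> j \in H -> (i <= j)%N ->
    modc (1 - z ^+ (j - i)) <= 2 * kappa / M%:R.
  move=> iH jH ij; apply: le_trans (dist1_diff z1 ij) _.
  have := Hz i iH; have := Hz j jH; lra.
have r4 : 0 <= 4 / rho by rewrite divr_ge0 // ltW.
pose W1 := (Num.truncn (4 / rho)).+1.
have W1a : 4 / rho < W1%:R by exact: truncnS_gt.
have W1b : W1%:R <= 4 / rho + 1 by rewrite /W1 -natr1 lerD2r truncn_le.
have r1 : 1 <= 1 / rho by rewrite ler_pdivlMr // mul1r.
have W1c : W1%:R <= 5 / rho by have -> : 5 / rho = 4 / rho + 1 / rho by [ring]; lra.
have W1M : (0 < W1 <= M)%N.
  rewrite /= -(ler_nat R); apply: le_trans W1c _; rewrite ler_pdivrMr //; lra.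
have [i1 [j1 [i1H j1H ij1 d1W d1]]] := window _ W1M.
pose d := (j1 - i1)%N.
have d0 : (0 < d)%N.
  rewrite lt0n; apply/negP => /eqP d0; move: d1; rewrite -/d d0.
  move: W1a; rewrite ltr_pdivrMr //; lra.
have dr : d%:R <= 5 / rho by apply: le_trans W1c; rewrite ler_nat ltnW.
have drho : d%:R * rho <= 5 by rewrite -ler_pdivlMr.
have dge : 1 <= d%:R :> R by rewrite ler1n.
exists d; split => //.
pose y := z ^+ d; pose eps := modc (1 - y).
have y1 : modc y = 1 by rewrite modcX z1 expr1n.
have eps0 : 0 <= eps by exact: modc_ge0.
have epsM : eps <= 2 * kappa / M%:R by exact: close.
have epsM' : eps * M%:R <= 2 * kappa by rewrite -ler_pdivlMr.
(* the powers of $y$ up to a $W$ with $W|1-y|\le 1/2$ do not wind around the circle *)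
have second W : (0 < W <= M)%N -> W%:R * eps <= 1 / 2 -> 4 <= rho * W%:R ->
    rho * W%:R * eps * M%:R <= 16 * d%:R * kappa.
  move=> WM Weps rW; have [i [j [iH jH ij jiW big]]] := window _ WM.
  pose n := (j - i)%N.
  have nW : n%:R <= W%:R :> R by rewrite ler_nat ltnW.
  have neps : n%:R * eps <= 1 / 2 by apply: le_trans Weps; rewrite ler_wpM2r.
  have h1 := dist1_exp_ge y1 neps.
  have h2 : modc (1 - y ^+ n) <= d%:R * (2 * kappa / M%:R).
    rewrite /y -exprM mulnC exprM; apply: le_trans (dist1_exp _ _) _.
      by rewrite modcX z1 expr1n.
    by rewrite ler_wpM2l //; exact: close.
  have h3 : rho * W%:R <= 4 * n%:R.
    by move: big; rewrite -/n -natr1; lra.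
  have h4 : modc (1 - y ^+ n) * M%:R <= 2 * d%:R * kappa.
    rewrite -ler_pdivlMr //; apply: le_trans h2 _.
    by rewrite mulrA [d%:R * _]mulrCA mulrA.
  have h5 : rho * W%:R * eps <= 4 * (n%:R * eps) by rewrite mulrA ler_wpM2r.
  have : rho * W%:R * eps * M%:R <= 4 * (2 * modc (1 - y ^+ n)) * M%:R.
    by rewrite ler_wpM2r ?(ltW M0) //; apply: le_trans h5 _; rewrite ler_wpM2l.
  lra.
have [epsS|epsL] := leP (M%:R * eps) (1 / 2).
  have Mn : (0 < M)%N by rewrite -(ltr0n R).
  have Mge : 4 <= rho * M%:R by lra.
  have := second M; rewrite Mn leqnn => /(_ isT epsS Mge) h.
  rewrite -/y -/eps ler_pdivlMr ?exprn_gt0 //.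
  apply: (@le_trans _ _ (16 * d%:R * kappa * rho)); last by nra.
  by rewrite expr2 mulrCA [leLHS]mulrC; nra.
(* otherwise a window with $W|1-y|$ of order 1 fits, and it bounds $M$ by $320\kappa/\rho^2$ *)
exfalso.
have eps1 : 0 < eps.
  rewrite lt0r eps0 andbT; apply/eqP => e0; move: epsL; rewrite e0 mulr0; lra.
pose W := Num.truncn (1 / (2 * eps)).
have ie : 1 <= 1 / (2 * eps).
  rewrite ler_pdivlMr ?mulr_gt0 // mul1r; move: epsM'; nra.
have Wa : W%:R <= 1 / (2 * eps) by rewrite truncn_le; apply: le_trans ie.
have Wb : 1 / (2 * eps) < W%:R + 1 by rewrite natr1; exact: truncnS_gt.
have Wa' : W%:R * eps <= 1 / 2 by move: Wa; rewrite ler_pdivlMr ?mulr_gt0 //; lra.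
have Wb' : 1 < 2 * (W%:R + 1) * eps by move: Wb; rewrite ltr_pdivrMr ?mulr_gt0 //; lra.
have W0 : (0 < W)%N.
  by rewrite lt0n; apply/negP => /eqP W0; move: Wb; rewrite W0 add0r ltNge ie.
have W1r : 1 <= W%:R :> R by rewrite ler1n.
have WM : (0 < W <= M)%N.
  rewrite W0 -(ler_nat R) -(ler_pM2r eps1); lra.
have We : 1 <= 4 * (W%:R * eps) by nra.
have rW : 4 <= rho * W%:R.
  have : M%:R <= 8 * kappa * W%:R by nra.
  nra.
have := second W WM Wa' rW; nra.
Qed.

(** * Short intervals in a cyclic group *)

Lemma leMP P M c : (0 < M)%N -> (100 * M ^ 2 <= P)%N -> (c <= 100 * M)%N -> (c <= P)%N.
Proof.
move=> M0 MP cM; apply: leq_trans MP; apply: leq_trans cM _.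
by rewrite leq_mul2l leq_pmulr.
Qed.

Lemma ltMP P M : (0 < M)%N -> (100 * M ^ 2 <= P)%N -> (M < P)%N.
Proof.
by move=> M0 MP; apply: (@leq_trans (2 * M)); [lia | apply: (leMP M0 MP); lia].
Qed.

Definition zinterval P M : {set 'Z_P} := [set (i.+1)%:R | i : 'I_M]%SET.
Definition zball P m : {set 'Z_P} :=
  ([set (i : nat)%:R | i : 'I_m.+1] :|: [set - (i : nat)%:R | i : 'I_m.+1])%SET.

Section Intervals.
Import mathcomp.boot.finset.
Variables (P : nat).
Hypothesis (hP : (1 < P)%N).
Local Notation G := 'Z_P.

Lemma natz_inj m n : (m < P)%N -> (n < P)%N -> m%:R = n%:R :> G -> m = n.
Proof.
move=> mP nP /(congr1 val); rewrite /= !val_Zp_nat //.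
by rewrite !modn_small.
Qed.

Lemma zballP m (x : G) :
  reflect (exists2 n, (n <= m)%N & x = n%:R \/ x = - n%:R) (x \in zball P m).
Proof.
apply: (iffP idP).
  rewrite inE => /orP[/imsetP[i _ ->]|/imsetP[i _ ->]]; exists i.
  - by rewrite -ltnS.
  - by left.
  - by rewrite -ltnS.
  - by right.
case=> n nm xE; have nm' : (n < m.+1)%N by [].
rewrite inE; case: xE => ->; apply/orP; [left|right]; apply/imsetP.
  by exists (Ordinal nm').
by exists (Ordinal nm').
Qed.

Lemma zballN m (x : G) : x \in zball P m -> - x \in zball P m.
Proof.
move/zballP => [n nm [->|->]]; apply/zballP; exists n => //; first by right.
by left; rewrite opprK.
Qed.

Lemma zball0 m : 0 \in zball P m.
Proof. by apply/zballP; exists 0%N => //; left. Qed.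

Lemma zballS m m' (x : G) : (m <= m')%N -> x \in zball P m -> x \in zball P m'.
Proof.
by move=> mm' /zballP[n nm xE]; apply/zballP; exists n => //; apply: leq_trans mm'.
Qed.

Lemma zballD m m' (x y : G) :
  x \in zball P m -> y \in zball P m' -> x + y \in zball P (m + m').
Proof.
move=> /zballP[a am xE] /zballP[b bm yE]; apply/zballP.
have natB u v : (v <= u)%N -> (u - v)%:R = u%:R - v%:R :> G by move=> ?; rewrite natrB.
case: xE => ->; case: yE => ->.
- by exists (a + b)%N; [exact: leq_add|left; rewrite natrD].
- case: (leqP b a) => ab.
    by exists (a - b)%N; [lia|left; rewrite natB].
  by exists (b - a)%N; [lia|right; rewrite natB ?(ltnW ab) // opprB].
- case: (leqP b a) => ab.
    by exists (a - b)%N; [lia|right; rewrite natB // opprB addrC].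
  by exists (b - a)%N; [lia|left; rewrite natB ?(ltnW ab) // addrC].
- by exists (a + b)%N; [exact: leq_add|right; rewrite natrD opprD].
Qed.

Lemma zballB m m' (x y : G) :
  x \in zball P m -> y \in zball P m' -> x - y \in zball P (m + m').
Proof. by move=> xm /zballN; exact: zballD. Qed.

Lemma card_zball_le m : (#|zball P m| <= 2 * m.+1)%N.
Proof.
apply: leq_trans (leq_card_setU _ _) _; rewrite mul2n -addnn leq_add //.
  by apply: leq_trans (leq_imset_card _ _) _; rewrite card_ord.
by apply: leq_trans (leq_imset_card _ _) _; rewrite card_ord.
Qed.

Lemma card_zball_ge m : (m < P)%N -> (m < #|zball P m|)%N.
Proof.
move=> mP; apply: (@leq_trans #|[set (i : nat)%:R | i : 'I_m.+1] : {set G}|); last first.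
  by apply/subset_leq_card/subsetUl.
rewrite card_in_imset ?card_ord // => i j _ _ ij; apply/val_inj/natz_inj => //.
  by apply: leq_trans (ltn_ord i) _.
by apply: leq_trans (ltn_ord j) _.
Qed.

Lemma zintervalP M (x : G) :
  reflect (exists2 n, (0 < n <= M)%N & x = n%:R) (x \in zinterval P M).
Proof.
apply: (iffP imsetP) => [[i _ ->]|[[//|n] /andP[_ nM] ->]].
  by exists i.+1 => //; exact: ltn_ord i.
by exists (Ordinal nM).
Qed.

Lemma mem_zinterval M n : (M < P)%N -> (n < P)%N ->
  (n%:R \in zinterval P M) = (0 < n <= M)%N.
Proof.
move=> MP nP; apply/zintervalP/idP => [[k kM nk]|nM]; last by exists n.
have kP : (k < P)%N by move/andP: kM => [_ kM]; exact: leq_ltn_trans MP.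
by rewrite (natz_inj nP kP nk).
Qed.

Lemma zinterval_diff M (x y : G) :
  x \in zinterval P M -> y \in zinterval P M -> y - x \in zball P M.
Proof.
move=> /zintervalP[a /andP[a0 aM] ->] /zintervalP[b /andP[b0 bM] ->].
apply/zballP; case: (leqP a b) => ab.
  by exists (b - a)%N; [lia|left; rewrite natrB].
by exists (a - b)%N; [lia|right; rewrite natrB ?(ltnW ab) // opprB].
Qed.

Lemma sum_zinterval (K : nmodType) M (F : G -> K) : (M < P)%N ->
  \sum_(x in zinterval P M) F x = \sum_(i < M) F (i.+1)%:R.
Proof.
move=> MP; rewrite big_imset //= => i j _ _ ij.
apply/val_inj; suff: i.+1 = j.+1 by case.
by apply: natz_inj => //; apply: leq_ltn_trans MP.
Qed.

Lemma card_zinterval M : (M < P)%N -> #|zinterval P M| = M.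
Proof. by move=> MP; rewrite -sum1_card sum_zinterval // sum1_card card_ord. Qed.

End Intervals.

(** * Weyl differencing and the major arcs *)

Section MajorArcs.
Import mathcomp.boot.finset.
Variables (R : realType) (P M : nat) (w : R[i]).
Hypotheses (hP : (1 < P)%N) (pw : P.-primitive_root w).
Hypotheses (M0 : (0 < M)%N) (MP : (100 * M ^ 2 <= P)%N) (PM : (P <= 400 * M ^ 2)%N).
Local Notation G := 'Z_P.
Local Notation C := R[i].
Local Notation e := (@zchar R P w).
Local Notation B := (zinterval P M).
Local Notation T := (zball P M).

(** The inner sum after one differencing step: the increment of $\psi y^2$ is
    $2\psi ty+\psi t^2$. *)
Definition shifted_sum psi t : C :=
  \sum_(y in [set v in B | v + t \in B]) e (psi * (2 * t * y)).

Lemma modc_shifted_sum psi t : modc (shifted_sum psi t) <= M%:R.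
Proof.
apply: le_trans (modc_sum _ _ _) _.
under eq_bigr do rewrite modc_zchar //.
rewrite sumr_const ler_nat -[X in (_ <= X)%N](card_zinterval hP (ltMP M0 MP)).
by apply/subset_leq_card/fintype.subsetP => y; rewrite inE => /andP[].
Qed.

Lemma shifted_sumN psi t : modc (shifted_sum psi (- t)) = modc (shifted_sum psi t).
Proof.
have -> : shifted_sum psi (- t) = e (- (psi * (2 * t * t))) * (shifted_sum psi t)^*; last first.
  by rewrite modcM modcJ modc_zchar // mul1r.
rewrite /shifted_sum rmorph_sum mulr_sumr (reindex (fun y => y + t)) /=; last first.
  by exists (fun y => y - t) => y _; rewrite ?addrK ?subrK.
apply: eq_big => [y|y _]; first by rewrite !inE addrK andbC.
rewrite -(zcharN hP pw) -(zcharD hP pw); congr (zchar w _); ring.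
Qed.

(** A geometric progression of ratio $e(2\psi n)$. *)
Lemma shifted_sum_geometric psi n : (n <= M)%N ->
  modc (1 - e (psi * 2) ^+ n) * modc (shifted_sum psi n%:R) <= 2.
Proof.
move=> nM; set z := e _ ^+ n.
have zE : e (psi * (2 * n%:R)) = z by rewrite mulrA zchar_nat.
have z1 : modc z = 1 by rewrite modcX modc_zchar // expr1n.
suff -> : shifted_sum psi n%:R = z * \sum_(i < M - n) z ^+ i.
  by rewrite modcM z1 mul1r; exact: geometric_sum_le.
rewrite /shifted_sum.
transitivity (\sum_(y in B) if y + n%:R \in B then e (psi * (2 * n%:R * y)) else 0).
  by rewrite -big_mkcondr; apply: eq_bigl => y; rewrite inE.
rewrite sum_zinterval ?(ltMP M0 MP) // mulr_sumr.
rewrite (big_ord_widen M (fun i => z * z ^+ i) (leq_subr n M)) [RHS]big_mkcond /=.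
apply: eq_bigr => i _; rewrite -natrD mem_zinterval ?(ltMP M0 MP) //; last first.
  by apply: (@leq_trans (3 * M)); [have := ltn_ord i; lia | apply: (leMP M0 MP); lia].
have -> : (0 < i.+1 + n <= M)%N = (i < M - n)%N by have := ltn_ord i; lia.
case: ifP => // _; rewrite -exprS -zE -(zchar_nat hP pw); congr (zchar w _); ring.
Qed.

Lemma sum_zball_le (f : G -> R) : (forall t, 0 <= f t) ->
  \sum_(t in T) f t <= \sum_(i < M.+1) (f i%:R + f (- i%:R)).
Proof.
move=> f0; have im (h : 'I_M.+1 -> G) : \sum_(t in [set h i | i : 'I_M.+1]) f t <= \sum_i f (h i).
  rewrite (partition_big_imset h) /= ; apply: ler_sum => t /imsetP[i _ ->].
  by rewrite (bigD1 i) //= lerDl sumr_ge0.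
rewrite big_split /=; apply: le_trans (lerD (im _) (im _)).
rewrite /zball; set X := [set (i : nat)%:R | i : 'I_M.+1]; set Y := [set - (i : nat)%:R | i : 'I_M.+1].
rewrite [leLHS](big_setID X) /=.
apply: lerD.
  by rewrite (_ : _ :&: X = X) //; apply/setP => t; rewrite !inE; case: (t \in X); rewrite ?andbT ?andbF ?orbT.
apply: (@le_trans _ _ (\sum_(t in Y :\: X) f t)).
  rewrite le_eqVlt; apply/orP; left; apply/eqP; apply: eq_bigl => t; rewrite !inE.
  by case: (t \in X) => //=; rewrite ?orbF.
rewrite [leRHS](big_setID X) /= lerDr; apply: sumr_ge0 => t _; exact: f0.
Qed.

(** Weyl differencing: after one application of van der Corput's inequality the
    phase is linear in $y$. *)
Lemma quad_form_weyl (theta : R) p0 p1 psi : 0 <= theta -> bounded1 p0 -> bounded1 p1 ->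
  theta <= modc (quad_form B p0 p1 (fun x => e (- (psi * x)))) ->
  theta ^+ 2 * M%:R ^+ 2 <= \sum_(t in T) modc (shifted_sum psi t).
Proof.
move=> th0 b0 b1 th.
have Mr : 0 < M%:R :> R by rewrite ltr0n.
have G0 : 0 < #|G|%:R :> R by rewrite ltr0n; apply/card_gt0P; exists 0.
have T0 : 0 < #|T|%:R :> R by rewrite ltr0n; apply/card_gt0P; exists 0; exact: zball0.
pose b x := p0 x * e (- (psi * x)).
pose g y x := p1 (x + y) * e (- (psi * y ^+ 2)).
have bb : bounded1 b by move=> x; rewrite le_modcM // modc_zchar.
have := @van_der_corput R G G T B b g (@zinterval_diff P hP M) bb.
have -> : \sum_x b x * \sum_(v in B) g v x =
    #|G|%:R * M%:R * quad_form B p0 p1 (fun x => e (- (psi * x))).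
  rewrite /quad_form /avg cardsT card_zinterval ?(ltMP M0 MP) // -mulr_sumr.
  have -> : forall S : C, #|G|%:R * M%:R * (#|G|%:R^-1 * (M%:R^-1 * S)) = S.
    have GC : #|G|%:R != 0 :> C by rewrite pnatr_eq0 -lt0n; apply/card_gt0P; exists 0.
    have MC : M%:R != 0 :> C by rewrite pnatr_eq0 -lt0n.
    by move=> S; field; rewrite GC MC.
  apply: eq_big => [x|x _]; first by rewrite inE.
  rewrite mulr_sumr; apply: eq_bigr => y _; rewrite /b /g.
  have -> : e (- (psi * (x + y ^+ 2))) = e (- (psi * x)) * e (- (psi * y ^+ 2)).
    by rewrite -(zcharD hP pw); congr (zchar w _); ring.
  ring.
have inner t : modc (\sum_(v in [set v in B | v + t \in B]) \sum_x g v x * (g (v + t) x)^*)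
    <= #|G|%:R * modc (shifted_sum psi t).
  have -> : \sum_(v in [set v in B | v + t \in B]) \sum_x g v x * (g (v + t) x)^* =
      (\sum_x mder t p1 x) * (e (psi * t ^+ 2) * shifted_sum psi t).
    rewrite /shifted_sum !mulr_sumr; apply: eq_bigr => v _.
    rewrite mulr_suml -[RHS](sum_shift v); apply: eq_bigr => x _.
    rewrite /g /mder rmorphM /= -(zcharN hP pw) opprK -(zcharD hP pw) addrA.
    have -> : e (psi * t ^+ 2 + psi * (2 * t * v)) = e (- (psi * v ^+ 2)) * e (psi * (v + t) ^+ 2).
      by rewrite -(zcharD hP pw); congr (zchar w _); ring.
    ring.
  rewrite modcM modcM modc_zchar // mul1r ler_wpM2r ?modc_ge0 //.
  apply: le_trans (modc_sum _ _ _) _; rewrite -sum1_card natr_sum; apply: ler_sum => x _.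
  exact: bounded1_mder.
rewrite modcM modcM !modc_nat.
set q := modc (quad_form _ _ _ _) => vdc.
have h1 : (M%:R * q / #|T|%:R) ^+ 2 <= #|T|%:R^-1 * ((\sum_(t in T) modc (shifted_sum psi t)) / #|T|%:R).
  have -> : M%:R * q / #|T|%:R = #|G|%:R * M%:R * q / (#|T|%:R * #|G|%:R) by field; rewrite !gt_eqF.
  apply: le_trans vdc _; rewrite /avg ler_wpM2l ?invr_ge0 ?(ltW T0) // mulr_suml.
  apply: ler_sum => t _; have -> : modc (shifted_sum psi t) / #|T|%:R =
      #|G|%:R * modc (shifted_sum psi t) / (#|T|%:R * #|G|%:R) by field; rewrite !gt_eqF.
  by rewrite ler_wpM2r // invr_ge0 mulr_ge0 // ltW.
have h2 : (M%:R * q) ^+ 2 <= \sum_(t in T) modc (shifted_sum psi t).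
  move: h1; rewrite expr_div_n ler_pdivrMr ?exprn_gt0 //.
  by rewrite [X in _ <= X](_ : _ = \sum_(t in T) modc (shifted_sum psi t)) //; field; rewrite gt_eqF.
apply: le_trans h2; rewrite mulrC exprMn ler_wpM2l ?sqr_ge0 //.
by rewrite lerXn2r ?nnegrE // (le_trans th0).
Qed.

(** The Weyl sums are large for many differences $t$, hence $e(2\psi)^t$ is within
    $O(1/M)$ of 1 for many $t\le M$; by [many_close_powers] this improves to
    $O(1/M^2)$ for one bounded exponent. *)
Lemma major_arc (theta : R) p0 p1 psi : 0 < theta <= 1 ->
  320 * (32 / theta ^+ 2) / (theta ^+ 2 / 8) ^+ 2 <= M%:R -> bounded1 p0 -> bounded1 p1 ->
  theta <= modc (quad_form B p0 p1 (fun x => e (- (psi * x)))) ->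
  exists q, [/\ (0 < q)%N, q%:R <= 80 / theta ^+ 2 &
    modc (1 - e psi ^+ q) * M%:R ^+ 2 <= 80 * (32 / theta ^+ 2) / (theta ^+ 2 / 8) ^+ 2].
Proof.
move=> /andP[th0 th1] Mbig b0 b1 /(quad_form_weyl (ltW th0) b0 b1) hE.
have Mr : 0 < M%:R :> R by rewrite ltr0n.
have M1 : 1 <= M%:R :> R by rewrite ler1n.
have t20 : 0 < theta ^+ 2 by rewrite exprn_gt0.
pose z := e (psi * 2); pose kappa := 16 / theta ^+ 2.
have k0 : 0 < kappa by rewrite divr_gt0.
have z1 : modc z = 1 by rewrite modc_zchar.
pose H := [set h : 'I_M.+1 | (modc (1 - z ^+ h) <= kappa / M%:R)%R].
have Ebound (n : 'I_M.+1) : modc (shifted_sum psi n%:R) + modc (shifted_sum psi (- n%:R)) <=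
    2 * ((n \in H)%:R * M%:R + 2 * M%:R / kappa).
  rewrite shifted_sumN -mulr2n -[_ *+ 2]mulr_natl ler_wpM2l // inE.
  have k2 : 0 <= 2 * M%:R / kappa by apply: divr_ge0; [exact: mulr_ge0 | exact: ltW].
  case: (leP (modc (1 - z ^+ n)) (kappa / M%:R)) => hz /=.
    by apply: le_trans (modc_shifted_sum _ _) _; rewrite ?mulr1n mul1r lerDl.
  rewrite ?mulr0n mul0r add0r ler_pdivlMr // mulrC.
  have nM : (n <= M)%N by rewrite -ltnS.
  have := shifted_sum_geometric psi nM; rewrite -/z.
  have := modc_ge0 (shifted_sum psi n%:R); set E := modc (shifted_sum _ _) => E0 hg.
  have : kappa / M%:R * E <= 2 by apply: le_trans hg; rewrite ler_wpM2r // ltW.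
  by rewrite mulrAC ler_pdivrMr.
have hH : theta ^+ 2 * M%:R ^+ 2 <= 2 * (#|H|%:R * M%:R + M.+1%:R * (2 * M%:R / kappa)).
  apply: le_trans hE _; apply: le_trans (sum_zball_le _) _ => [t|]; first exact: modc_ge0.
  apply: le_trans (ler_sum _ (fun n _ => Ebound n)) _.
  rewrite -mulr_sumr ler_wpM2l // big_split /= -mulr_suml sumr_const card_ord.
  rewrite -[_ *+ M.+1]mulr_natl lerD2r ler_wpM2r // -sum1_card natr_sum.
  rewrite le_eqVlt; apply/orP; left; apply/eqP; rewrite [RHS]big_mkcond /=.
  by apply: eq_bigr => n _; case: (n \in H).
have hH2 : theta ^+ 2 / 8 * M.+1%:R <= #|H|%:R.
  have : theta ^+ 2 * M%:R <= 2 * #|H|%:R + M.+1%:R * theta ^+ 2 / 4.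
    rewrite -(ler_pM2r Mr); move: hH; rewrite /kappa invfM invrK.
    rewrite -natr1; lra.
  rewrite -natr1; nra.
have t21 : theta ^+ 2 <= 1 by rewrite expr_le1 // ltW.
have [||||| d [d0 dr dz]] := @many_close_powers R z M.+1 (theta ^+ 2 / 8) (2 * kappa) H z1.
- by rewrite divr_gt0 //=; lra.
- by rewrite /kappa mulrA ler_pdivlMr //; lra.
- have -> : 2 * kappa = 32 / theta ^+ 2 by rewrite /kappa; field; rewrite gt_eqF.
  by apply: le_lt_trans Mbig _; rewrite ltr_nat.
- move=> h; rewrite inE => /le_trans; apply.
  rewrite ler_pdivlMr // mulrAC ler_pdivrMr // -natr1.
  have M1' : 0 <= M%:R - 1 :> R by rewrite subr_ge0.
  have := mulr_ge0 (ltW k0) M1'; lra.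
- by [].
exists (2 * d)%N; split; first by rewrite muln_gt0.
  rewrite natrM; apply: le_trans (_ : 2 * (5 / (theta ^+ 2 / 8)) <= _).
    by rewrite ler_wpM2l.
  by rewrite le_eqVlt; apply/orP; left; apply/eqP; field; rewrite gt_eqF.
have -> : e psi ^+ (2 * d) = z ^+ d by rewrite exprM /z zchar_nat.
apply: (@le_trans _ _ (modc (1 - z ^+ d) * M.+1%:R ^+ 2)).
  by rewrite ler_wpM2l ?modc_ge0 // lerXn2r ?nnegrE // ler_nat.
have -> : 32 / theta ^+ 2 = 2 * kappa by rewrite /kappa; field; rewrite gt_eqF.
exact: dz.
Qed.

(** The frequencies within $O(K/(qM^2))$ of a fraction with denominator $q$, for
    some $q\le Q$. Measuring this by the distance from $e(\psi)^q$ to 1 avoids the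
    choice of an argument. *)
Definition major_arcs (Q : nat) (K : R) : {set G} :=
  [set psi | [exists q : 'I_Q.+1, (0 < q)%N && (modc (1 - e psi ^+ q) * M%:R ^+ 2 <= K)%R]].

(** Orthogonality: for $\psi$ near $a/q$ the sum $\sum_{j<L}e(\psi qj)$ hardly
    cancels, but its mean square over $\psi$ is only $L$. *)
Lemma card_near_fraction q L (A : {set G}) : (0 < q)%N -> (0 < L)%N -> (q * L <= P)%N ->
  (forall psi, psi \in A -> L%:R * modc (1 - e psi ^+ q) <= 1 / 2) ->
  #|A|%:R * L%:R <= 4 * P%:R :> R.
Proof.
move=> q0 L0 qL hA; pose F psi := \sum_(j < L) (e psi ^+ q) ^+ j.
have Lr : 0 < L%:R :> R by rewrite ltr0n.
have orth : \sum_psi modc (F psi) ^+ 2 = P%:R * L%:R.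
  apply: complexI; rewrite rmorph_sum rmorphM !rmorph_nat /=.
  transitivity (\sum_(j < L) \sum_(k < L) \sum_psi e ((q * j)%:R * psi - (q * k)%:R * psi)).
    transitivity (\sum_psi \sum_(j < L) \sum_(k < L) e ((q * j)%:R * psi - (q * k)%:R * psi)).
      apply: eq_bigr => psi _; rewrite sqr_modc /F rmorph_sum /= mulr_suml.
      apply: eq_bigr => j _; rewrite mulr_sumr; apply: eq_bigr => k _ /=.
      rewrite (zcharD hP pw) (zcharN hP pw) ![_%:R * psi]mulrC !(zchar_nat hP pw).
      by rewrite !exprM.
    by rewrite exchange_big; apply: eq_bigr => j _; rewrite exchange_big.
  transitivity (\sum_(j < L) (P%:R : C)); last first.
    by rewrite sumr_const card_ord -[_ *+ L]mulr_natr.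
  apply: eq_bigr => j _; rewrite (bigD1 j) //= [X in _ + X]big1 ?addr0.
    under eq_bigr do rewrite subrr zchar0.
    by rewrite sumr_const card_ZpT.
  move=> k kj; under eq_bigr do rewrite -mulrBl.
  rewrite (sum_zchar hP pw) subr_eq0; case: eqP => // /(natz_inj hP).
  have lt (i : 'I_L) : (q * i < P)%N.
    by apply: leq_trans qL; rewrite ltn_mul2l q0 /=.
  move=> /(_ (lt j) (lt k)) /eqP; rewrite eqn_mul2l gtn_eqF //= => /eqP jk.
  by move: kj; rewrite -(inj_eq val_inj) /= jk eqxx.
rewrite -(ler_pM2r Lr).
have : \sum_(psi in A) (L%:R / 2) ^+ 2 <= P%:R * L%:R :> R.
  rewrite -orth; apply: (@le_trans _ _ (\sum_(psi in A) modc (F psi) ^+ 2)).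
    apply: ler_sum => psi pA; rewrite lerXn2r ?nnegrE ?modc_ge0 ?divr_ge0 //.
    by apply: geometric_sum_ge; [rewrite modcX modc_zchar // expr1n | exact: hA].
  rewrite [leRHS](bigID (mem A)) /= lerDl; apply: sumr_ge0 => psi _; exact: sqr_ge0.
rewrite sumr_const -[_ *+ _]mulr_natl; lra.
Qed.

(** Each denominator contributes $O(K)$ frequencies, because $P$ is at most a
    multiple of $M^2$. *)
Lemma card_major_arcs (Q : nat) (K : R) : 1 <= K -> 2 * K <= M%:R ^+ 2 -> Q%:R <= K ->
  #|major_arcs Q K|%:R <= Q.+1%:R * (64 * 100 * K).
Proof.
move=> K1 KM QK.
have K0 : 0 < K by apply: lt_le_trans K1.
have Mr : 0 < M%:R :> R by rewrite ltr0n.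
pose A (q : nat) : {set G} := [set psi | (0 < q)%N && (modc (1 - e psi ^+ q) * M%:R ^+ 2 <= K)%R].
have sub : #|major_arcs Q K|%:R <= \sum_(q < Q.+1) #|A q|%:R :> R.
  rewrite -natr_sum ler_nat -sum1_card.
  have -> : (\sum_(q < Q.+1) #|A q| = \sum_psi \sum_(q < Q.+1) (psi \in A q))%N.
    rewrite exchange_big; apply: eq_bigr => q _; rewrite -sum1_card big_mkcond.
    by apply: eq_bigr => psi _; case: (psi \in A q).
  rewrite big_mkcond; apply: leq_sum => psi _; rewrite inE.
  case: ifP => // /existsP[q hq]; rewrite (bigD1 q) //=.
  by rewrite {1}inE hq.
apply: le_trans sub _.
apply: (@le_trans _ _ (\sum_(q < Q.+1) 64 * 100 * K)); last first.
  by rewrite sumr_const card_ord -[_ *+ _]mulr_natl.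
apply: ler_sum => q _; have [q0|q0] := posnP q.
  rewrite (_ : A q = set0) ?cards0 ?mulr_ge0 ?(ltW K0) //.
  by apply/setP => psi; rewrite !inE q0.
(* the longest sum that does not cancel at frequencies of the arc *)
pose x := M%:R ^+ 2 / (2 * K).
have x1 : 1 <= x by rewrite ler_pdivlMr ?mulr_gt0 // mul1r.
pose L := Num.truncn x.
have La : L%:R <= x by rewrite truncn_le; apply: le_trans x1.
have Lb : x < L%:R + 1 by rewrite natr1; exact: truncnS_gt.
have L0 : (0 < L)%N by rewrite lt0n; apply/negP => /eqP L0; move: Lb; rewrite L0 add0r ltNge x1.
have L1 : 1 <= L%:R :> R by rewrite ler1n.
have xK : x * (2 * K) = M%:R ^+ 2 by rewrite /x divfK // mulf_neq0 ?gt_eqF.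
have LK : L%:R * (2 * K) <= M%:R ^+ 2 by rewrite -xK ler_wpM2r ?mulr_ge0 // ltW.
have qK : q%:R <= K by apply: le_trans QK; rewrite ler_nat -ltnS.
have PMr : 100 * M%:R ^+ 2 <= P%:R :> R by rewrite -natrX -natrM ler_nat.
have PMr' : P%:R <= 400 * M%:R ^+ 2 :> R by rewrite -natrX -natrM ler_nat.
have := @card_near_fraction q L (A q) q0 L0.
have -> : (q * L <= P)%N.
  rewrite -(ler_nat R) natrM; apply: le_trans PMr.
  apply: (@le_trans _ _ (K * L%:R)); first by rewrite ler_wpM2r.
  by have := sqr_ge0 (M%:R : R); nra.
move=> /(_ isT) h.
have {h} : #|A q|%:R * L%:R <= 4 * P%:R :> R.
  apply: h => psi; rewrite inE q0 /= => hpsi.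
  rewrite -(ler_pM2r K0); have d0 := modc_ge0 (1 - e psi ^+ q).
  have : L%:R * (2 * K) * modc (1 - e psi ^+ q) <= M%:R ^+ 2 * modc (1 - e psi ^+ q).
    by rewrite ler_wpM2r.
  lra.
move=> h; have L2 : x <= 2 * L%:R by lra.
have hA : #|A q|%:R * x <= 8 * P%:R.
  by have := ler_wpM2l (ler0n R #|A q|) L2; lra.
have : #|A q|%:R * M%:R ^+ 2 <= 16 * K * (400 * M%:R ^+ 2).
  have -> : #|A q|%:R * M%:R ^+ 2 = #|A q|%:R * x * (2 * K) by rewrite -mulrA xK.
  have K20 : 0 <= 2 * K by rewrite mulr_ge0 // ltW.
  have := ler_wpM2r K20 hA; have := ler_wpM2l (ltW K0) PMr'; lra.
rewrite mulrA ler_pM2r ?exprn_gt0 //; lra.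
Qed.

End MajorArcs.

(** * Degree lowering down to the U^2 norm *)

Section SmallPowers.
Variables (R : realType) (theta : R).
Hypothesis th : 0 < theta <= 1 / 2.

Let th0 : 0 < theta. Proof. by case/andP: th. Qed.
Let th12 : theta <= 1 / 2. Proof. by case/andP: th. Qed.
Let th1 : theta <= 1. Proof. by have := th12; lra. Qed.

Lemma le_expr_anti m n : (m <= n)%N -> theta ^+ n <= theta ^+ m.
Proof. by move=> mn; rewrite ler_wiXn2l // ltW. Qed.

(** All bounds are kept in the form of a power of $\theta\le 1/2$; absolute
    constants are absorbed at the price of raising the exponent. *)
Lemma expr_absorb (c : R) n : c <= 2 ^+ n -> c * theta ^+ n <= 1.
Proof.
move=> cn; apply: (@le_trans _ _ (2 ^+ n * theta ^+ n)).
  by rewrite ler_wpM2r // exprn_ge0 // ltW.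
rewrite -exprMn exprn_ile1 ?mulr_ge0 ?(ltW th0) //; have := th12; lra.
Qed.

Lemma expr_absorb2 (c d : nat) m n : (c <= 2 ^ m)%N -> (d <= 2 ^ n)%N ->
  (c%:R * theta ^+ m) * (d%:R * theta ^+ n) <= 1.
Proof.
move=> cm dn; have h k : 0 <= theta ^+ k by rewrite exprn_ge0 // ltW.
rewrite mulr_ile1 ?(mulr_ge0 (ler0n _ _)) //; apply: expr_absorb.
  by rewrite -natrX ler_nat.
by rewrite -natrX ler_nat.
Qed.

Lemma inv_absorb (c : R) n : c <= 2 ^+ n -> c <= (theta ^+ n)^-1.
Proof.
by move=> cn; rewrite -[leRHS]mul1r ler_pdivlMr ?exprn_gt0 // expr_absorb.
Qed.

Lemma small_expr n : (0 < n)%N -> 0 < theta ^+ n <= 1 / 2.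
Proof.
move=> n0; rewrite exprn_gt0 //=; apply: le_trans th12.
by rewrite -[leRHS]expr1; exact: le_expr_anti.
Qed.

End SmallPowers.

Section Lowering.
Import mathcomp.boot.finset.
Variable R : realType.
Local Notation C := R[i].

Section OneScale.
Variables (P M : nat) (w : C).
Hypotheses (hP : (1 < P)%N) (pw : P.-primitive_root w).
Hypotheses (M0 : (0 < M)%N) (MP : (100 * M ^ 2 <= P)%N) (PM : (P <= 400 * M ^ 2)%N).
Local Notation G := 'Z_P.
Local Notation e := (@zchar R P w).
Local Notation B := (zinterval P M).

Lemma major_arc_power (theta : R) p0 p1 psi : 0 < theta <= 1 / 2 ->
  1 <= theta ^+ 26 * M%:R -> bounded1 p0 -> bounded1 p1 ->
  theta <= modc (quad_form B p0 p1 (fun x => e (- (psi * x)))) ->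
  exists q, [/\ (0 < q)%N, q%:R <= (theta ^+ 9)^-1 &
    modc (1 - e psi ^+ q) * M%:R ^+ 2 <= (theta ^+ 24)^-1].
Proof.
move=> th Mbig b0 b1 hL; have /andP[th0 th12] := th.
have hn n : theta ^+ n != 0 by rewrite expf_neq0 // gt_eqF.
have KE : 32 / theta ^+ 2 / (theta ^+ 2 / 8) ^+ 2 = (32 * 64) * (theta ^+ 6)^-1.
  by field; rewrite gt_eqF.
have [|| q [q0 qr qz]] := @major_arc R P M w hP pw M0 MP PM theta p0 p1 psi _ _ b0 b1 hL.
- by rewrite th0 /=; lra.
- rewrite -mulrA KE -(@ler_pM2l _ (theta ^+ 26)) ?exprn_gt0 //.
  apply: le_trans Mbig.
  have -> : theta ^+ 26 * (320 * (32 * 64 * (theta ^+ 6)^-1)) = (320 * theta ^+ 9) * (32 * 64 * theta ^+ 11).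
    by field; rewrite gt_eqF.
  by rewrite -[32 * 64]natrM expr_absorb2.
exists q; split => //.
- apply: le_trans qr _; rewrite -[leRHS]mul1r ler_pdivlMr ?exprn_gt0 // mulrAC ler_pdivrMr ?exprn_gt0 //.
  rewrite mul1r -[in leRHS](mul1r (theta ^+ 2)) (exprD theta 7 2) mulrA ler_wpM2r ?exprn_ge0 ?(ltW th0) //.
  by apply: expr_absorb => //; rewrite -natrX ler_nat.
- apply: le_trans qz _; rewrite -mulrA KE -[leRHS]mul1r ler_pdivlMr ?exprn_gt0 //.
  have -> : 80 * (32 * 64 * (theta ^+ 6)^-1) * theta ^+ 24 = (80 * theta ^+ 7) * (32 * 64 * theta ^+ 11).
    by field; rewrite gt_eqF.
  by rewrite -[32 * 64]natrM expr_absorb2.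
Qed.

(** The major arcs at which the operator can be as large as $\theta$. *)
Definition arcs (theta : R) : {set G} :=
  major_arcs P M w (Num.truncn (theta ^+ 9)^-1) (theta ^+ 24)^-1.

Lemma mem_arcs (theta : R) p0 p1 psi : 0 < theta <= 1 / 2 ->
  1 <= theta ^+ 26 * M%:R -> bounded1 p0 -> bounded1 p1 ->
  theta <= modc (quad_form B p0 p1 (fun x => e (- (psi * x)))) -> psi \in arcs theta.
Proof.
move=> th Mbig b0 b1 hL; have /andP[th0 _] := th.
have [q [q0 qr qz]] := major_arc_power th Mbig b0 b1 hL.
have qlt : (q < (Num.truncn (theta ^+ 9)^-1).+1)%N.
  by rewrite ltnS truncn_ge_nat // invr_ge0 exprn_ge0 // ltW.
by rewrite inE; apply/existsP; exists (Ordinal qlt); rewrite /= q0 qz.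
Qed.

Lemma card_arcs (theta : R) : 0 < theta <= 1 / 2 -> 1 <= theta ^+ 26 * M%:R ->
  #|arcs theta|%:R <= (theta ^+ 47)^-1.
Proof.
move=> th Mbig; have /andP[th0 th12] := th.
have tp n : 0 < theta ^+ n by rewrite exprn_gt0.
have ti n : 1 <= (theta ^+ n)^-1 by apply: inv_absorb => //; rewrite exprn_ege1 // ler1n.
have Q1 : (Num.truncn (theta ^+ 9)^-1)%:R <= (theta ^+ 9)^-1.
  by rewrite truncn_le invr_ge0 ltW.
have t12 : 0 <= theta^-1 by rewrite invr_ge0 ltW.
apply: le_trans (card_major_arcs hP pw M0 MP PM _ _ _) _.
- exact: ti.
- have M1 : 1 <= M%:R :> R by rewrite ler1n.
  have h : (theta ^+ 26)^-1 <= M%:R by rewrite -[leLHS]mul1r ler_pdivrMr // mulrC.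
  apply: (@le_trans _ _ M%:R); last by rewrite expr2 ler_peMr.
  apply: le_trans h; rewrite -[leRHS]mul1r ler_pdivlMr //.
  have -> : 2 * (theta ^+ 24)^-1 * theta ^+ 26 = 2 * theta ^+ 2 by field; rewrite gt_eqF.
  by apply: expr_absorb => //; rewrite -natrX ler_nat.
- apply: le_trans Q1 _; rewrite lef_pV2 ?posrE //; exact: le_expr_anti.
have Q2 : (Num.truncn (theta ^+ 9)^-1).+1%:R <= 2 * (theta ^+ 9)^-1.
  by rewrite -natr1; have := ti 9%N; lra.
have K0 : 0 <= 64 * 100 * (theta ^+ 24)^-1 by rewrite mulr_ge0 // invr_ge0 ltW.
apply: le_trans (ler_wpM2r K0 Q2) _.
rewrite -[leRHS]mul1r ler_pdivlMr //.
have -> : 2 * (theta ^+ 9)^-1 * (64 * 100 * (theta ^+ 24)^-1) * theta ^+ 47 =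
   (64 * theta ^+ 6) * (2 * 100 * theta ^+ 8) by field; rewrite gt_eqF.
by rewrite -[2 * 100]natrM expr_absorb2.
Qed.

End OneScale.

(** By induction on $k$. The exponent $a$ makes $\theta=\eta^a$ small enough for
    [degree_lowering]; $b$ is the resulting loss in one step. *)
Lemma gowers_lowering k : exists K : nat,
  forall (P M : nat) (w : C) (eta : R) (f0 f1 : 'Z_P -> C),
  (1 < P)%N -> P.-primitive_root w -> (0 < M)%N ->
  (100 * M ^ 2 <= P)%N -> (P <= 400 * M ^ 2)%N ->
  0 < eta <= 1 / 2 -> 1 <= eta ^+ K * M%:R -> bounded1 f0 -> bounded1 f1 ->
  eta <= gowers k.+1 (quad_dual (zinterval P M) f0 f1) ->
  eta ^+ K <= gowers 1 (quad_dual (zinterval P M) f0 f1).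
Proof.
elim: k => [|k [K' IH]].
  exists 1%N => P M w eta f0 f1 hP pw M0 MP PM eta0 _ b0 b1; by rewrite expr1.
pose a := (2 * 2 ^ k.+1 + 1)%N; pose b := ((2 + 48 * a) * 2 ^ k.+1)%N.
have b_gt0 : (0 < b)%N by rewrite muln_gt0 expn_gt0.
have a_gt0 : (0 < a)%N by rewrite /a addn1.
exists (26 * a + b * K')%N => P M w eta f0 f1 hP pw M0 MP PM eta0 Mbig b0 b1 hU.
have /andP[ep0 ep12] := eta0.
have Mr : 0 < M%:R :> R by rewrite ltr0n.
pose theta := eta ^+ a.
have th : 0 < theta <= 1 / 2 := small_expr eta0 a_gt0.
have /andP[th0 th12] := th.
have big n : (n <= 26 * a + b * K')%N -> 1 <= eta ^+ n * M%:R.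
  by move=> nK; apply: le_trans Mbig _; rewrite ler_wpM2r // le_expr_anti.
have Mth : 1 <= theta ^+ 26 * M%:R by rewrite /theta -exprM mulnC big // leq_addr.
have ehalf : eta ^+ 2 <= eta / 2 by rewrite expr2; nra.
have low := @degree_lowering R P w hP pw (zinterval P M) (arcs P M w theta) f0 f1 k eta theta
  (theta ^+ 47)^-1 b0 b1.
have hb : eta ^+ b <= gowers k.+1 (quad_dual (zinterval P M) f0 f1).
  apply: le_trans (low _ _ _ _ _ _ _) => //.
  - have -> : eta ^+ b = (eta ^+ 2 * (theta * theta ^+ 47)) ^+ (2 ^ k.+1).
      by rewrite /b exprM exprD -exprS /theta -[in RHS]exprM [(a * _)%N]mulnC.
    rewrite invrK lerXn2r ?nnegrE ?mulr_ge0 ?exprn_ge0 ?divr_ge0 ?(ltW ep0) ?(ltW th0) //.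
    by rewrite ler_wpM2r // mulr_ge0 ?exprn_ge0 // ltW.
  - by move=> p0 p1 psi bp0 bp1; exact: mem_arcs.
  - by rewrite invr_gt0 exprn_gt0.
  - exact: card_arcs.
  - apply: (@le_trans _ _ ((eta ^+ 2) ^+ (2 ^ k.+1))); last first.
      by rewrite lerXn2r ?nnegrE ?exprn_ge0 ?divr_ge0 ?(ltW ep0).
    rewrite /theta /a -exprM addn1 exprS mulrA.
    by rewrite ler_piMl ?exprn_ge0 ?(ltW ep0) //; lra.
apply: (@le_trans _ _ ((eta ^+ b) ^+ K')).
  by rewrite -exprM; apply: (le_expr_anti eta0); exact: leq_addl.
apply: (IH P M w (eta ^+ b) f0 f1 hP pw M0 MP PM (small_expr eta0 b_gt0) _ b0 b1 hb).
by rewrite -exprM big // leq_addl.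
Qed.

End Lowering.

(** * The operator at a major arc frequency *)

Section MajorArcStructure.
Import mathcomp.boot.finset.
Variables (R : realType) (P M : nat) (w : R[i]).
Hypotheses (hP : (1 < P)%N) (pw : P.-primitive_root w).
Hypotheses (M0 : (0 < M)%N) (MP : (100 * M ^ 2 <= P)%N) (PM : (P <= 400 * M ^ 2)%N).
Local Notation G := 'Z_P.
Local Notation C := R[i].
Local Notation e := (@zchar R P w).
Local Notation B := (zinterval P M).

Lemma modc_sum_shift (g : nat -> C) a m : (forall n, modc (g n) <= 1) ->
  modc (\sum_(i < m) g i - \sum_(i < m) g (i + a)%N) <= 2 * a%:R.
Proof.
move=> g1; elim: a => [|a IH].
  under [X in _ - X]eq_bigr do rewrite addn0.
  by rewrite subrr modc0 mulr0.
have -> : \sum_(i < m) g (i + a.+1)%N = \sum_(i < m) g (i + a)%N - g a + g (m + a)%N.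
  apply: (addrI (g a)).
  rewrite (_ : g a + (_ - g a + _) = \sum_(i < m) g (i + a)%N + g (m + a)%N); last by ring.
  rewrite -[RHS](big_ord_recr m (fun i => g (i + a)%N)) big_ord_recl /= add0n; congr (_ + _).
  by apply: eq_bigr => i _; rewrite /bump /= add1n addSn addnS.
set S := \sum_(i < m) g i in IH *; set S' := \sum_(i < m) _ in IH *.
have -> : S - (S' - g a + g (m + a)%N) = (S - S') + (g a - g (m + a)%N) by ring.
apply: le_trans (modcD _ _) _; rewrite -[a.+1%:R]natr1 mulrDr mulr1 lerD //.
by apply: le_trans (modcD _ _) _; rewrite modcN -[2]/(1 + 1) lerD.
Qed.

(** On a progression of difference $q$ and length much less than $M$, the phase
    $e(-\psi y^2)$ is nearly constant, since $e(\psi q)$ is within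
    $\theta^{-O(1)}M^{-2}$ of 1. *)
Lemma major_arc_structure (theta : R) f0 f1 psi : 0 < theta <= 1 / 2 ->
  1 <= theta ^+ 30 * M%:R -> bounded1 f0 -> bounded1 f1 ->
  theta <= modc (quad_form B f0 f1 (fun x => e (- (psi * x)))) ->
  exists q L, [/\ (0 < q)%N, (0 < L)%N & [/\ q%:R <= (theta ^+ 9)^-1, theta ^+ 31 * M%:R <= L%:R,
    (q * L <= M)%N & theta / 2 * L%:R <=
      avg [set: G] (fun x => modc (\sum_(j < L) f1 (x + (q * j.+1)%:R)))]].
Proof.
move=> th Mbig b0 b1 hL; have /andP[th0 th12] := th.
have Mr : 0 < M%:R :> R by rewrite ltr0n.
have tp n : 0 < theta ^+ n by rewrite exprn_gt0.
have Mbig' : 1 <= theta ^+ 26 * M%:R.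
  by apply: le_trans Mbig _; rewrite ler_wpM2r ?(ltW Mr) //; exact: (le_expr_anti th).
have [q [q0 qr qz]] := major_arc_power hP pw M0 MP PM th Mbig' b0 b1 hL.
pose L := Num.truncn (theta ^+ 30 * M%:R).
have x0 : 0 <= theta ^+ 30 * M%:R by rewrite mulr_ge0 ?ltW.
have La : L%:R <= theta ^+ 30 * M%:R by rewrite truncn_le.
have L0 : (0 < L)%N by rewrite /L truncn_gt0.
have Lr : 0 < L%:R :> R by rewrite ltr0n.
have Lb : theta ^+ 31 * M%:R <= L%:R.
  have : theta ^+ 30 * M%:R < L%:R + 1 by rewrite natr1; exact: truncnS_gt.
  have : 1 <= L%:R :> R by rewrite ler1n.
  rewrite exprS; have := ler_wpM2r x0 th12; rewrite mulrA; lra.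
have qL' : q%:R * L%:R <= theta ^+ 21 * M%:R :> R.
  have -> : theta ^+ 21 * M%:R = (theta ^+ 9)^-1 * (theta ^+ 30 * M%:R) by field; rewrite gt_eqF.
  by apply: ler_pM.
have qL : (q * L <= M)%N.
  rewrite -(ler_nat R) natrM; apply: le_trans qL' _; rewrite ler_piMl ?(ltW Mr) //.
  by rewrite exprn_ile1 ?(ltW th0) //; lra.
exists q, L; split => //; split => //.
set A := avg _ _.
pose D := modc (1 - e psi ^+ q).
have D0 : 0 <= D by exact: modc_ge0.
pose c x n := f1 (x + n%:R) * e (- (psi * n%:R ^+ 2)).
have c1 x n : modc (c x n) <= 1 by rewrite le_modcM // modc_zchar.
have s1 : theta * M%:R <= avg [set: G] (fun x => modc (\sum_(i < M) c x i.+1)).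
  rewrite -ler_pdivlMr // mulrC -avgZ; apply: le_trans hL _.
  apply: le_trans (modc_avg _ _) _; apply: ler_avg => x _.
  have -> : avg B (fun y => f0 x * f1 (x + y) * e (- (psi * (x + y ^+ 2)))) =
     (f0 x * e (- (psi * x))) * (M%:R^-1 * \sum_(i < M) c x i.+1).
    rewrite /avg (card_zinterval hP (ltMP M0 MP)) [RHS]mulrCA; congr (_ * _).
    rewrite (sum_zinterval hP _ (ltMP M0 MP)) mulr_sumr; apply: eq_bigr => i _.
    have -> : e (- (psi * (x + i.+1%:R ^+ 2))) = e (- (psi * x)) * e (- (psi * i.+1%:R ^+ 2)).
      by rewrite -(zcharD hP pw); congr (zchar w _); ring.
    by rewrite /c; ring.
  rewrite modcM [modc (_^-1 * _)]modcM modcV modc_nat.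
  by rewrite ler_piMl ?mulr_ge0 ?modc_ge0 ?invr_ge0 // le_modcM // modc_zchar.
(* shifting the sum by the steps of the progression changes little *)
have s2 x : L%:R * modc (\sum_(i < M) c x i.+1) <=
    \sum_(i < M) modc (\sum_(j < L) c x (i.+1 + q * j.+1)%N) + 2 * (q%:R * L%:R) * L%:R.
  pose S := \sum_(i < M) c x i.+1.
  pose S' := \sum_(i < M) \sum_(j < L) c x (i.+1 + q * j.+1)%N.
  have -> : L%:R * modc S = modc ((L%:R * S - S') + S') by rewrite subrK modcM modc_nat.
  apply: le_trans (modcD _ _) _; rewrite addrC lerD ?modc_sum //.
  have -> : L%:R * S - S' = \sum_(j < L) (S - \sum_(i < M) c x (i + q * j.+1).+1).
    rewrite sumrB sumr_const card_ord; congr (_ - _); first by rewrite mulr_natl.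
    by rewrite /S' exchange_big.
  apply: le_trans (modc_sum _ _ _) _.
  have -> : 2 * (q%:R * L%:R) * L%:R = \sum_(j < L) 2 * (q%:R * L%:R) :> R.
    by rewrite sumr_const card_ord -[RHS]mulr_natr.
  apply: ler_sum => j _.
  apply: le_trans (modc_sum_shift (q * j.+1) M (fun n => c1 x n.+1)) _.
  by rewrite ler_wpM2l // -natrM ler_nat leq_mul.
(* freezing the phase along the progression changes little *)
have s3 x i : (i < M)%N -> modc (\sum_(j < L) c x (i.+1 + q * j.+1)%N) <=
    modc (\sum_(j < L) f1 (x + i.+1%:R + (q * j.+1)%:R)) + L%:R * (3 * M%:R * L%:R * D).
  move=> iM.
  have cE j : c x (i.+1 + q * j.+1)%N = e (- (psi * i.+1%:R ^+ 2)) *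
     (f1 (x + i.+1%:R + (q * j.+1)%:R) - f1 (x + i.+1%:R + (q * j.+1)%:R) *
       (1 - (e psi ^+ q ^+ (2 * i.+1 * j.+1 + q * j.+1 ^ 2))^*)).
    have -> : e psi ^+ q ^+ (2 * i.+1 * j.+1 + q * j.+1 ^ 2) =
       e (psi * (q * (2 * i.+1 * j.+1 + q * j.+1 ^ 2))%:R) by rewrite -exprM zchar_nat.
    rewrite -(zcharN hP pw).
    transitivity (e (- (psi * i.+1%:R ^+ 2)) * (f1 (x + i.+1%:R + (q * j.+1)%:R) *
      e (- (psi * (q * (2 * i.+1 * j.+1 + q * j.+1 ^ 2))%:R)))); last by congr (_ * _); ring.
    rewrite /c.
    rewrite [RHS]mulrCA -(zcharD hP pw) natrD addrA; congr (_ * zchar w _).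
    rewrite !natrM !natrD !natrM; ring.
  under eq_bigr do rewrite cE.
  rewrite -mulr_sumr modcM modc_zchar // mul1r sumrB.
  apply: le_trans (modcD _ _) _; rewrite modcN lerD2l.
  apply: le_trans (modc_sum _ _ _) _.
  have -> : L%:R * (3 * M%:R * L%:R * D) = \sum_(j < L) (3 * M%:R * L%:R * D).
    by rewrite sumr_const card_ord -[RHS]mulr_natl.
  apply: ler_sum => j _; rewrite modcM; apply: (@le_trans _ _ (1 * ((2 * i.+1 * j.+1 + q * j.+1 ^ 2)%:R * D))).
    rewrite ler_pM ?modc_ge0 //.
    have -> : 1 - (e psi ^+ q ^+ (2 * i.+1 * j.+1 + q * j.+1 ^ 2))^* =
      (1 - (e psi ^+ q ^+ (2 * i.+1 * j.+1 + q * j.+1 ^ 2)))^* by rewrite rmorphB rmorph1.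
    by rewrite modcJ; apply: dist1_exp; rewrite modcX modc_zchar // expr1n.
  rewrite mul1r ler_wpM2r // -!natrM ler_nat.
  have h1 : (2 * i.+1 * j.+1 <= 2 * M * L)%N by rewrite leq_mul // leq_mul.
  have h2 : (q * j.+1 ^ 2 <= M * L)%N.
    by rewrite -mulnn mulnA leq_mul // (leq_trans _ qL) // leq_mul.
  have -> : (3 * M * L = 2 * M * L + M * L)%N by rewrite -!mulnA -mulSnr.
  exact: leq_add.
have s4 : L%:R * (theta * M%:R) <=
    M%:R * (A + L%:R * (3 * M%:R * L%:R * D)) + 2 * (q%:R * L%:R) * L%:R.
  apply: le_trans (ler_wpM2l (ler0n _ L) s1) _; rewrite -avgZ.
  apply: le_trans (ler_avg (fun x _ => s2 x)) _.
  rewrite avgD (avg_cst _ (in_setT (0 : G))) lerD2r.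
  apply: (@le_trans _ _ (avg [set: G] (fun x => \sum_(i < M)
    (modc (\sum_(j < L) f1 (x + i.+1%:R + (q * j.+1)%:R)) + L%:R * (3 * M%:R * L%:R * D))))).
    by apply: ler_avg => x _; apply: ler_sum => i _; apply: s3.
  have -> : M%:R * (A + L%:R * (3 * M%:R * L%:R * D)) =
     \sum_(i < M) (A + L%:R * (3 * M%:R * L%:R * D)) by rewrite sumr_const card_ord -[RHS]mulr_natl.
  rewrite /avg exchange_big mulr_sumr; apply: ler_sum => i _.
  rewrite -/(avg _ _) avgD (avg_cst _ (in_setT (0 : G))) lerD2r.
  by rewrite (avg_shift i.+1%:R (fun x => modc (\sum_(j < L) f1 (x + (q * j.+1)%:R)))).
have DM : L%:R * D * M%:R <= theta ^+ 6.
  have h : L%:R * D * M%:R <= theta ^+ 30 * (D * M%:R ^+ 2).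
    have -> : theta ^+ 30 * (D * M%:R ^+ 2) = theta ^+ 30 * M%:R * (D * M%:R) by ring.
    by rewrite -mulrA ler_wpM2r // mulr_ge0 // ltW.
  apply: le_trans h _; have -> : theta ^+ 6 = theta ^+ 30 * (theta ^+ 24)^-1 by field; rewrite gt_eqF.
  by rewrite ler_wpM2l // ltW.
have e1 : 3 * theta ^+ 6 <= theta / 8.
  have : 24 * theta ^+ 5 <= 1 by apply: expr_absorb => //; rewrite -natrX ler_nat.
  have := exprS theta 5; nra.
have e2 : 2 * theta ^+ 21 <= theta / 8.
  have : 16 * theta ^+ 20 <= 1.
    apply: expr_absorb => //; apply: (@le_trans _ _ (2 ^+ 4)); first by rewrite -natrX ler_nat.
    by rewrite ler_eXn2l // ltr1n.
  have := exprS theta 20; nra.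
have m1 : 3 * M%:R * L%:R * D <= theta / 8 by apply: le_trans e1; lra.
have m2 : 2 * (q%:R * L%:R) <= theta / 8 * M%:R.
  by have := ler_wpM2r (ltW Mr) e2; lra.
rewrite -(ler_pM2r Mr).
have := ler_wpM2l (ltW Mr) (ler_wpM2l (ltW Lr) m1); have := ler_wpM2r (ltW Lr) m2.
have : 0 <= theta * (L%:R * M%:R) by rewrite !mulr_ge0 // ltW.
lra.
Qed.

End MajorArcStructure.

(** * Solutions of a linear equation in short intervals *)

Section LinearEquation.
Import mathcomp.boot.finset.
Variables (P M : nat).
Hypotheses (hP : (1 < P)%N) (M0 : (0 < M)%N) (MP : (100 * M ^ 2 <= P)%N).
Local Notation G := 'Z_P.

(** The range $8M$ accommodates the differences of two points of the range $4M$
    in which directions are averaged. *)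
Definition zero_pairs (al be : G) : {set G * G} :=
  [set z | [&& z.1 \in zball P (8 * M), z.2 \in zball P (8 * M)
            & 2 * (al * z.1 + be * z.2) == 0]].

(** Since $P\ge 100M^2$, the equation in $\mathbb Z/P$ is an equation in integers. *)
Let nowrap a m b n : (a <= 2 * M)%N -> (m <= 16 * M)%N -> (b <= 2 * M)%N -> (n <= 8 * M)%N ->
  (2 * a * m + 2 * b * n < P)%N.
Proof.
move=> aM mM bM nM; apply: leq_trans MP.
apply: (@leq_ltn_trans (2 * (2 * M) * (16 * M) + 2 * (2 * M) * (8 * M))).
  by apply: leq_add; apply: leq_mul => //; rewrite leq_mul2l.
by rewrite -mulnn; nia.
Qed.

Let pm (s : bool) (n : nat) : G := if s then n%:R else - n%:R.

Let zball_pm m x : x \in zball P m -> exists s n, (n <= m)%N /\ x = pm s n.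
Proof.
by move/zballP => [n nm [->|->]]; [exists true, n | exists false, n].
Qed.

Let pmM s s' a b : pm s a * pm s' b = pm (s (+) ~~ s') (a * b).
Proof.
by case: s s' => [] [] /=; rewrite natrM ?mulrNN ?mulNr ?mulrN.
Qed.

Let pm_eq s s' x y : (x + y < P)%N -> pm s x = pm s' y -> x = y.
Proof.
move=> xyP; have xP : (x < P)%N by apply: leq_ltn_trans xyP; exact: leq_addr.
have yP : (y < P)%N by apply: leq_ltn_trans xyP; exact: leq_addl.
have opp u v : (u + v < P)%N -> u%:R = - v%:R :> G -> u = v.
  move=> uvP /eqP; rewrite -subr_eq0 opprK -natrD => /eqP e.
  have /eqP := @natz_inj P hP (u + v) 0 uvP (ltnW hP) e.
  by rewrite addn_eq0 => /andP[/eqP -> /eqP ->].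
case: s s' => [] [] /=.
- exact: natz_inj.
- exact: opp.
- by move/esym/opp => h; apply/esym/h; rewrite addnC.
- by move/oppr_inj; exact: natz_inj.
Qed.

(** A solution is determined by its second coordinate, which is divisible by
    $a/\gcd(a,b)$. *)
Lemma card_zero_pairs (D a b : nat) s s' : (0 < D)%N -> (a <= 2 * M)%N -> (b <= 2 * M)%N ->
  (M <= D * a)%N -> (gcdn a b <= D)%N ->
  (#|zero_pairs (pm s a) (pm s' b)| <= 18 * D ^ 2)%N.
Proof.
move=> D0 aM bM Ma gD; set al := pm s a; set be := pm s' b.
have a0 : (0 < a)%N by rewrite lt0n; apply/eqP => a0; move: Ma; rewrite a0 muln0 leqNgt M0.
have g0 : (0 < gcdn a b)%N by rewrite gcdn_gt0 a0.
pose a' := (a %/ gcdn a b)%N.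
have aE : a = (a' * gcdn a b)%N by rewrite divnK ?dvdn_gcdl.
have a'0 : (0 < a')%N by rewrite divn_gt0 // dvdn_leq ?dvdn_gcdl.
have Ma' : (M <= D ^ 2 * a')%N.
  apply: leq_trans Ma _; rewrite -mulnn -mulnA leq_mul2l {1}aE mulnC leq_mul2r gD.
  by rewrite !orbT.
pose N := (8 * M %/ a').+1.
pose h (z : bool * 'I_N) : G := pm z.1 (a' * z.2).
have inj2 : {in zero_pairs al be &, injective (fun z => z.2 : G)}.
  move=> [u v] [u' v']; rewrite inE => /and3P[/= uJ vJ /eqP z].
  rewrite inE => /and3P[/= uJ' vJ' /eqP z'] vv'.
  rewrite -vv' in z' *; congr (_, _); apply/eqP; rewrite -subr_eq0; apply/eqP.
  have uu : 2 * al * (u - u') = 0.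
    have -> : 2 * al * (u - u') = 2 * (al * u + be * v) - 2 * (al * u' + be * v) by ring.
    by rewrite z z' subrr.
  have /zball_pm[r [m [mM mE]]] := zballB hP uJ uJ'.
  rewrite mE in uu *; have : pm (true (+) ~~ s) (2 * a) * pm r m = pm true 0 by rewrite -pmM /= uu.
  rewrite pmM => /pm_eq; rewrite addn0 => h0.
  have am0 : (2 * a * m = 0)%N.
    apply: h0; have := @nowrap a m 0%N 0%N aM _ (leq0n _) (leq0n _); rewrite !muln0 addn0; apply.
    by move: mM; lia.
  have m0 : m = 0%N by move/eqP: am0; rewrite !muln_eq0 gtn_eqF //= gtn_eqF //= => /eqP.
  by rewrite m0 /pm; case: (r); rewrite /= ?oppr0.
rewrite -(card_in_imset inj2).
apply: (@leq_trans #|[set h z | z : bool * 'I_N]|).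
  apply/subset_leq_card/fintype.subsetP => _ /imsetP[[u v] + ->] /=.
  rewrite inE => /and3P[/= uJ vJ /eqP z].
  have /zball_pm[r [m [mM mE]]] := uJ; have /zball_pm[t [n [nM nE]]] := vJ.
  have amn : (a * m = b * n)%N.
    have e : pm (true (+) ~~ s) (2 * a) * pm r m = pm (false (+) ~~ s') (2 * b) * pm t n.
      apply/eqP; rewrite -subr_eq0 -mE -nE.
      rewrite -[pm (false (+) _) _](pmM false s' 2 b) -(pmM true s 2 a).
      rewrite [pm true 2]/= [pm false 2]/= -/al -/be -[X in _ == X]z; apply/eqP; ring.
    move: e; rewrite !pmM => /pm_eq => e.
    have : (2 * a * m = 2 * b * n)%N by apply: e; apply: nowrap => //; move: mM; lia.
    by rewrite -!mulnA => /eqP; rewrite eqn_mul2l /= => /eqP.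
  have : (a' %| n)%N.
    have co : coprime a' (b %/ gcdn a b).
      rewrite /coprime -(eqn_pmul2r g0) mul1n muln_gcdl -aE divnK ?dvdn_gcdr //.
    rewrite -(Gauss_dvdr n co) -(dvdn_pmul2r g0) -aE mulnAC divnK ?dvdn_gcdr //.
    by rewrite -amn dvdn_mulr.
  move=> /dvdnP[k kE].
  have kN : (k < N)%N.
    by rewrite ltnS leq_divRL // -kE.
  apply/imsetP; exists (t, Ordinal kN) => //.
  by rewrite nE /h /= mulnC -kE.
apply: leq_trans (leq_imset_card _ _) _; rewrite card_prod card_bool card_ord /N.
have : (8 * M %/ a' <= 8 * D ^ 2)%N.
  rewrite -ltnS ltn_divLR //; apply: (@leq_ltn_trans (8 * (D ^ 2 * a'))); first by rewrite leq_mul2l Ma'.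
  by rewrite mulnA ltn_pmul2r.
have : (0 < D ^ 2)%N by rewrite expn_gt0 D0.
lia.
Qed.

End LinearEquation.

(** * Most pairs of coefficients are equidistributing *)

Section BadPairs.
Import mathcomp.boot.finset.
Variable R : realType.

(** By comparison with the telescoping sum of $1/(d(d-1))$. *)
Lemma sum_inv_sqr_tail D n : (0 < D <= n)%N ->
  \sum_(D.+1 <= d < n.+1) (d%:R ^+ 2)^-1 <= D%:R^-1 - n%:R^-1 :> R.
Proof.
move=> /andP[D0]; elim: n => [|n IH]; first by rewrite leqn0 => /eqP D1; rewrite D1 in D0.
rewrite leq_eqVlt => /orP[/eqP <-|]; first by rewrite big_geq // subrr.
rewrite ltnS => Dn; rewrite big_nat_recr //=.
apply: (@le_trans _ _ (D%:R^-1 - n%:R^-1 + (n%:R^-1 - n.+1%:R^-1))); last by rewrite addrA subrK.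
rewrite lerD ?IH //.
have n0 : 0 < n%:R :> R by rewrite ltr0n (leq_trans D0).
have n1 : 0 < n.+1%:R :> R by rewrite ltr0n.
have -> : n%:R^-1 - n.+1%:R^-1 = (n%:R * n.+1%:R)^-1 :> R.
  by rewrite -[n.+1%:R]natr1; field; rewrite natr1 !gt_eqF.
rewrite lef_pV2 ?posrE ?mulr_gt0 ?exprn_gt0 // expr2 ler_wpM2r // ler_nat; exact: leqnSn.
Qed.

Lemma card_multiples n d : (0 < d)%N -> (#|[set a : 'I_n.+1 | (d %| a)%N]| <= (n %/ d).+1)%N.
Proof.
move=> d0; pose h (a : 'I_n.+1) : 'I_(n %/ d).+1 := inord (a %/ d).
have hE a : h a = (a %/ d)%N :> nat by rewrite inordK // ltnS leq_div2r // -ltnS.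
rewrite -[X in (_ <= X)%N](card_ord (n %/ d).+1) -(@card_in_imset _ _ h); first exact: max_card.
move=> a b; rewrite !inE => da db /(congr1 val) /=; rewrite !hE => ab.
by apply/val_inj; rewrite /= -(divnK da) -(divnK db) ab.
Qed.

(** At most $O(M^2/D)$ pairs have $a<M/D$, and the proportion of pairs with a
    common divisor $d$ is $O(1/d^2)$, whose tail beyond $D$ is $O(1/D)$. *)
Lemma card_bad_nat (M D : nat) : (0 < D <= M)%N ->
  #|[set z : 'I_(2 * M).+1 * 'I_(2 * M).+1 | ~~ ((M <= D * z.1) && (gcdn z.1 z.2 <= D))%N]|%:R
    * D%:R <= 22 * M%:R ^+ 2 :> R.
Proof.
move=> /andP[D0 DM]; set S := [set z | _].
have M0 : (0 < M)%N by exact: leq_trans DM.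
pose S1 := [set z : 'I_(2 * M).+1 * 'I_(2 * M).+1 | (D * z.1 < M)%N].
pose A d := [set a : 'I_(2 * M).+1 | (d %| a)%N].
have Dr : 0 < D%:R :> R by rewrite ltr0n.
have c1 : (#|S1| * D <= 6 * M ^ 2)%N.
  have : (#|S1| <= (M %/ D).+1 * (2 * M).+1)%N.
    pose h (z : 'I_(2 * M).+1 * 'I_(2 * M).+1) : 'I_(M %/ D).+1 * 'I_(2 * M).+1 := (inord z.1, z.2).
    have hE z : z \in S1 -> (h z).1 = z.1 :> nat.
      rewrite inE => zM; rewrite inordK // ltnS leq_divRL // mulnC; exact: ltnW.
    have -> : ((M %/ D).+1 * (2 * M).+1 = #|{: 'I_(M %/ D).+1 * 'I_(2 * M).+1}|)%N.
      by rewrite card_prod !card_ord.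
    rewrite -(@card_in_imset _ _ h); first exact: max_card.
    move=> z z' zS zS' zz; have e1 : z.1 = z'.1 by apply/val_inj; rewrite /= -(hE _ zS) -(hE _ zS') zz.
    by case: z z' e1 zz {zS zS'} => [a b] [a' b'] /= -> /(congr1 snd) /= ->.
  have h1 : (D * (M %/ D).+1 <= 2 * M)%N.
    by rewrite mulnS mulnC addnC mul2n -addnn leq_add // leq_trunc_div.
  have h2 : ((2 * M).+1 <= 3 * M)%N by rewrite [X in (_ <= X)%N]mulSnr -[(2 * M).+1]addn1 leq_add2l.
  move=> h; apply: (@leq_trans ((D * (M %/ D).+1) * (2 * M).+1)).
    by rewrite mulnC -mulnA leq_mul2l h orbT.
  by apply: leq_trans (leq_mul h1 h2) _; rewrite mulnACA mulnn.
have sub : (#|S| <= #|S1| + \sum_(D.+1 <= d < (2 * M).+1) #|A d| * #|A d|)%N.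
  apply: (@leq_trans (\sum_(z : 'I_(2 * M).+1 * 'I_(2 * M).+1)
    ((z \in S1) + \sum_(D.+1 <= d < (2 * M).+1) (z \in setX (A d) (A d))))).
    rewrite -sum1_card big_mkcond; apply: leq_sum => -[a b] _; rewrite inE negb_and -!ltnNge /=.
    case: ifP => //; case: (boolP (D * a < M)%N) => [aS _|aS /= gD].
      by rewrite [(a, b) \in S1]inE aS.
    have a0 : (0 < a)%N.
      by rewrite lt0n; apply/negP => /eqP a0; move: aS; rewrite a0 muln0 M0.
    have g2 : (gcdn a b < (2 * M).+1)%N.
      by apply: leq_ltn_trans (ltn_ord a); apply: dvdn_leq => //; exact: dvdn_gcdl.
    have gi : gcdn a b \in index_iota D.+1 (2 * M).+1 by rewrite mem_index_iota gD.
    rewrite (big_rem _ gi) /= in_setX !inE dvdn_gcdl dvdn_gcdr /=.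
    by rewrite addnCA addnA.
  rewrite big_split /= leq_add //.
    rewrite -sum1_card [X in (_ <= X)%N]big_mkcond; apply: leq_sum => z _.
    by case: (z \in S1).
  rewrite exchange_big; apply: leq_sum => d _; rewrite -cardsX -sum1_card [X in (_ <= X)%N]big_mkcond.
  by apply: leq_sum => z _; case: (z \in _).
have tail : (\sum_(D.+1 <= d < (2 * M).+1) #|A d| * #|A d|)%N%:R <= 16 * M%:R ^+ 2 * D%:R^-1 :> R.
  rewrite natr_sum; apply: (@le_trans _ _ (\sum_(D.+1 <= d < (2 * M).+1) 16 * M%:R ^+ 2 * (d%:R ^+ 2)^-1)).
    rewrite !big_nat; apply: ler_sum => d /andP[Dd dM].
    have d0 : (0 < d)%N by apply: leq_ltn_trans Dd.
    have dr : 0 < d%:R :> R by rewrite ltr0n.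
    have cA : #|A d|%:R * d%:R <= 4 * M%:R :> R.
      rewrite -!natrM ler_nat; apply: (@leq_trans ((2 * M %/ d).+1 * d)).
        by rewrite leq_mul2r card_multiples ?orbT.
      have dM' : (d <= 2 * M)%N by rewrite -ltnS.
      by rewrite mulSn -[4%N]/(2 + 2)%N [X in (_ <= X)%N]mulnDl leq_add // leq_trunc_div.
    rewrite ler_pdivlMr ?exprn_gt0 // natrM.
    have -> : #|A d|%:R * #|A d|%:R * d%:R ^+ 2 = (#|A d|%:R * d%:R) ^+ 2 :> R by ring.
    have -> : 16 * M%:R ^+ 2 = (4 * M%:R) ^+ 2 :> R by ring.
    by rewrite lerXn2r ?nnegrE ?mulr_ge0.
  rewrite -mulr_sumr ler_wpM2l ?mulr_ge0 ?sqr_ge0 //.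
  apply: le_trans (sum_inv_sqr_tail _) _; last by rewrite lerBlDr lerDl invr_ge0.
  by rewrite D0 (leq_trans DM) // leq_pmull.
have : #|S|%:R * D%:R <= (#|S1|%:R + 16 * M%:R ^+ 2 * D%:R^-1) * D%:R :> R.
  rewrite ler_wpM2r ?(ltW Dr) //; apply: le_trans (_ : (#|S1| + \sum_(D.+1 <= d < (2 * M).+1) #|A d| * #|A d|)%N%:R <= _).
    by rewrite ler_nat.
  by rewrite natrD lerD2l.
move/le_trans; apply; rewrite mulrDl mulfVK ?gt_eqF //.
have : #|S1|%:R * D%:R <= 6 * M%:R ^+ 2 :> R by rewrite -natrX -!natrM ler_nat.
lra.
Qed.

Section Modular.
Variables (P M : nat).
Hypotheses (hP : (1 < P)%N) (M0 : (0 < M)%N) (MP : (100 * M ^ 2 <= P)%N)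
  (PM : (P <= 400 * M ^ 2)%N).
Local Notation G := 'Z_P.

(** The threshold is the bound of [card_zero_pairs] for coefficients that are not
    too small and have no large common divisor. *)
Definition bad_pairs D : {set G * G} :=
  [set z | [&& z.1 \in zball P (2 * M), z.2 \in zball P (2 * M) &
     (18 * D ^ 2 < #|zero_pairs M z.1 z.2|)%N]].

Lemma card_bad_pairs D : (0 < D <= M)%N -> #|bad_pairs D|%:R * D%:R <= 88 * M%:R ^+ 2 :> R.
Proof.
move=> DM; have /andP[D0 _] := DM.
set S := [set z : 'I_(2 * M).+1 * 'I_(2 * M).+1 | ~~ ((M <= D * z.1) && (gcdn z.1 z.2 <= D))%N].
pose pm (s : bool) (n : nat) : G := if s then n%:R else - n%:R.
pose h (t : (bool * bool) * ('I_(2 * M).+1 * 'I_(2 * M).+1)) : G * G := (pm t.1.1 t.2.1, pm t.1.2 t.2.2).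
have : (#|bad_pairs D| <= 4 * #|S|)%N.
  have -> : (4 * #|S| = #|setX [set: bool * bool] S|)%N by rewrite cardsX cardsT card_prod card_bool.
  apply: leq_trans (leq_imset_card h _); apply/subset_leq_card/fintype.subsetP => -[al be].
  rewrite inE => /and3P[/= alJ beJ big].
  have pmP x : x \in zball P (2 * M) -> exists s (n : 'I_(2 * M).+1), x = pm s n.
    by move=> /zballP[n nM [->|->]]; [exists true|exists false]; exists (Ordinal (nM : (n < (2 * M).+1)%N)).
  have [s [a aE]] := pmP _ alJ; have [s' [b bE]] := pmP _ beJ.
  apply/imsetP; exists ((s, s'), (a, b)); last by rewrite aE bE.
  rewrite in_setX in_setT /= inE /=; apply/negP => /andP[Ma gD].
  move: big; rewrite aE bE ltnNge => /negP; apply.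
  by apply: card_zero_pairs => //; rewrite -ltnS.
rewrite -(ler_nat R) natrM => h4; have := card_bad_nat DM; rewrite -/S.
have := ler_wpM2r (ler0n R D) h4; lra.
Qed.

(** The number $r(x)$ of representations $x=2(\alpha u+\beta v)$ has second moment at
    most $K$ times the number of pairs $(u,v)$: fixing one of two representations
    of the same $x$, their difference is a solution of the homogeneous equation.
    As $P=O(M^2)$, this bounds the density of the form in $L^2$. *)
Lemma rich_average m al be (K : nat) (Phi : G -> R) : (M <= m <= 4 * M)%N ->
  (#|zero_pairs M al be| <= K)%N ->
  (avg (setX (zball P m) (zball P m)) (fun z => Phi (2 * (al * z.1 + be * z.2)))) ^+ 2
    <= 400 * K%:R * avg [set: G] (fun x => Phi x ^+ 2).
Proof.
move=> /andP[Mm m4] zK; set J := zball P m; set S := setX J J.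
pose La (z : G * G) := 2 * (al * z.1 + be * z.2).
pose r x := #|[set z in S | La z == x]|.
have rE x (c : R) : \sum_(z in S | La z == x) c = (r x)%:R * c.
  rewrite mulr_natl -sumr_const; apply: eq_bigl => z.
  by rewrite inE.
have mP : (m < P)%N.
  by apply: leq_ltn_trans m4 _; apply: leq_trans (leMP M0 MP (_ : 5 * M <= _)%N); lia.
have J0 : (M <= #|J|)%N by apply: leq_trans Mm _; apply: ltnW; exact: card_zball_ge.
have Mr : 0 < M%:R :> R by rewrite ltr0n.
have Jr : 0 < #|J|%:R :> R by rewrite ltr0n (leq_trans M0).
have S0 : 0 < #|S|%:R :> R by rewrite cardsX natrM mulr_gt0.
have P0 : 0 < P%:R :> R by rewrite ltr0n ltnW.
have sE : \sum_(z in S) Phi (La z) = \sum_(x in [set: G]) (r x)%:R * Phi x.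
  rewrite (partition_big La predT) //=; apply: eq_big => x; first by rewrite inE.
  move=> _; rewrite (eq_bigr (fun=> Phi x)); last by move=> z /andP[_ /eqP ->].
  exact: rE.
have rK : \sum_(x in [set: G]) (r x)%:R ^+ 2 <= #|S|%:R * K%:R :> R.
  have -> : \sum_(x in [set: G]) (r x)%:R ^+ 2 = \sum_(z in S) (r (La z))%:R :> R.
    rewrite (partition_big La predT) //=; apply: eq_big => x; first by rewrite inE.
    move=> _; rewrite (eq_bigr (fun=> (r x)%:R)); last by move=> z /andP[_ /eqP ->].
    by rewrite rE expr2.
  rewrite mulr_natl -sumr_const; apply: ler_sum => -[zu zv]; rewrite in_setX => /andP[/= z1 z2].
  set z := (zu, zv).
  rewrite ler_nat /r; apply: leq_trans zK.
  rewrite -(card_imset [set y in S | La y == La z] (addIr (- z))).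
  apply/subset_leq_card/fintype.subsetP => _ /imsetP[[yu yv] + ->].
  set y := (yu, yv); rewrite inE in_setX => /andP[/andP[/= y1 y2] /eqP yz].
  have m2 : (m + m <= 8 * M)%N by rewrite addnn -mul2n -[8%N]/(2 * 4)%N -mulnA leq_mul2l m4 orbT.
  rewrite inE /= (zballS m2 (zballB hP y1 z1)) (zballS m2 (zballB hP y2 z2)) /=.
  have -> : 2 * (al * (y.1 - z.1) + be * (y.2 - z.2)) = La y - La z by rewrite /La; ring.
  by rewrite yz subrr.
have cs := sum_cauchy_schwarz [set: G] (fun x => (r x)%:R) Phi.
have F0 : 0 <= \sum_(x in [set: G]) Phi x ^+ 2 by apply: sumr_ge0 => x _; exact: sqr_ge0.
rewrite /avg -/(La _) sE cardsT card_ZpT // exprMn.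
apply: (@le_trans _ _ ((#|S|%:R^-1) ^+ 2 * (#|S|%:R * K%:R * \sum_(x in [set: G]) Phi x ^+ 2))).
  by rewrite ler_wpM2l ?sqr_ge0 // (le_trans cs) // ler_wpM2r.
have -> : #|S|%:R^-1 ^+ 2 * (#|S|%:R * K%:R * \sum_(x in [set: G]) Phi x ^+ 2) =
   #|S|%:R^-1 * (K%:R * \sum_(x in [set: G]) Phi x ^+ 2) by field; rewrite gt_eqF.
rewrite [leRHS](_ : _ = (400 / P%:R) * (K%:R * \sum_(x in [set: G]) Phi x ^+ 2)); last by ring.
rewrite ler_wpM2r ?mulr_ge0 // ler_pdivlMr // mulrC ler_pdivrMr // -natrM ler_nat.
apply: leq_trans PM _; rewrite leq_mul2l -mulnn cardsX leq_mul ?orbT //.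
Qed.

End Modular.
End BadPairs.

(** * Linearisation of the quadratic configuration *)

(** The forms that occur as differences; the factor 2 comes from
    $(y+h)^2-y^2=2hy+h^2$. *)
Definition lin2 P (al be : 'Z_P) (v : 'Z_P * 'Z_P) : 'Z_P := 2 * (al * v.1 + be * v.2).

(** The seven nonzero subset sums of $2t_1h$, $2t_2k$, $2t_3(h+k)$ as forms in
    $(h,k)$. *)
Definition seven_forms P (t1 t2 t3 : 'Z_P) : seq ('Z_P * 'Z_P -> 'Z_P) :=
  [:: lin2 t1 0; lin2 0 t2; lin2 t3 t3; lin2 t1 t2; lin2 (t1 + t3) t3;
      lin2 t3 (t2 + t3); lin2 (t1 + t3) (t2 + t3)].

Section Linearisation.
Import mathcomp.boot.finset.
Variables (R : realType) (P M : nat).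
Hypotheses (hP : (1 < P)%N) (M0 : (0 < M)%N) (MP : (100 * M ^ 2 <= P)%N).
Local Notation G := 'Z_P.
Local Notation C := R[i].
Local Notation B := (zinterval P M).
Local Notation T := (zball P M).
Local Notation T2 := (setX (zball P (2 * M)) (zball P (2 * M))).

Lemma card_zball_bounds m : (0 < m)%N -> (m <= 50 * M)%N ->
  m%:R <= #|zball P m|%:R :> R /\ #|zball P m|%:R <= 4 * m%:R :> R.
Proof.
move=> m0 mM; split.
  rewrite ler_nat; apply: ltnW; apply: card_zball_ge => //.
  apply: (@leq_trans (2 * m)); first by rewrite mul2n -addnn -{1}(add1n m) leq_add2r.
  apply: (leMP M0 MP); apply: leq_trans (leq_mul (leqnn 2) mM) _.
  by rewrite mulnA.
rewrite -natrM ler_nat; apply: leq_trans (card_zball_le P m) _.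
by rewrite -[4%N]/(2 * 2)%N -mulnA leq_mul2l mul2n -addnn -{1}(add1n m) leq_add2r.
Qed.

Lemma card_T_gt0 : 0 < #|T|%:R :> R.
Proof. by rewrite ltr0n; apply/card_gt0P; exists 0; exact: zball0. Qed.

Lemma card_G_gt0 : 0 < #|G|%:R :> R.
Proof. by rewrite ltr0n; apply/card_gt0P; exists 0. Qed.

(** Two applications of van der Corput's inequality remove $f_0$ and $f_1$ and
    leave, for each pair of differences $h,k$, a system of linear forms in $y$. *)
Lemma quad_form_box (f0 f1 f2 : G -> C) : bounded1 f0 -> bounded1 f1 -> bounded1 f2 ->
  (modc (quad_form B f0 f1 f2) / 4) ^+ (2 ^ 5) <=
  avg T (fun h => avg T (fun k =>
    box_avg T [:: (fun t => 0 - 2 * h * t); (fun t => 0 - 2 * k * t);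
                  (fun t => 0 - 2 * (h + k) * t)] f2)).
Proof.
move=> b0 b1 b2.
have T0 := card_T_gt0; have G0 := card_G_gt0.
pose N : R := #|T|%:R * #|G|%:R.
have N0 : 0 < N by rewrite mulr_gt0.
pose g y x := f1 (x + y) * f2 (x + y ^+ 2).
pose S := \sum_x f0 x * \sum_(y in B) g y x.
pose Bh h := [set y in B | y + h \in B].
pose s1 h := modc (\sum_(y in Bh h) \sum_x g y x * (g (y + h) x)^*) / N.
have BT u v : u \in B -> v \in B -> v - u \in T by exact: zinterval_diff.
have BhT h u v : u \in Bh h -> v \in Bh h -> v - u \in T.
  by rewrite [u \in _]inE [v \in _]inE => /andP[uB _] /andP[vB _]; exact: BT.
have sq (a : C) : 0 <= modc a / N by rewrite divr_ge0 ?modc_ge0 ?(ltW N0).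
have step1 : (modc S / N) ^+ 2 <= avg T s1 by apply: van_der_corput.
pose g2 h y x := f2 (x + y ^+ 2 - y) * (f2 (x + (y + h) ^+ 2 - y))^*.
pose s2 h k := modc (\sum_(y in [set y in Bh h | y + k \in Bh h])
    \sum_x g2 h y x * (g2 h (y + k) x)^*) / N.
have step2 h : s1 h ^+ 2 <= avg T (s2 h).
  have -> : s1 h = modc (\sum_x mder h f1 x * \sum_(y in Bh h) g2 h y x) / N.
    congr (modc _ / N).
    transitivity (\sum_x \sum_(y in Bh h) mder h f1 x * g2 h y x); last first.
      by apply: eq_bigr => x _; rewrite mulr_sumr.
    rewrite [RHS]exchange_big; apply: eq_bigr => y _.
    rewrite -[RHS](sum_shift y); apply: eq_bigr => x _.
    rewrite /g /g2 /mder rmorphM /= addrA.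
    have -> : x + y + y ^+ 2 - y = x + y ^+ 2 by ring.
    have -> : x + y + (y + h) ^+ 2 - y = x + (y + h) ^+ 2 by ring.
    by ring.
  apply: van_der_corput; [exact: BhT | exact: bounded1_mder].
pose box h k := box_avg T [:: (fun t => 0 - 2 * h * t); (fun t => 0 - 2 * k * t);
                  (fun t => 0 - 2 * (h + k) * t)] f2.
have step3 h k : s2 h k ^+ (2 ^ 3) <= box h k.
  pose l : seq ((G -> G) * (G -> C)) :=
    [:: (fun y => 2 * h * y, fun x => (f2 (x + h ^+ 2))^*);
        (fun y => 2 * k * y, fun x => (f2 (x + k ^+ 2 - k))^*);
        (fun y => 2 * (h + k) * y, fun x => f2 (x + (h + k) ^+ 2 - k))].
  have := @linear_forms_box R G G T [set y in Bh h | y + k \in Bh h] l (fun _ => 0) f2.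
  have -> : \sum_(v in [set y in Bh h | y + k \in Bh h]) \sum_x f2 (x + 0) * \prod_(p <- l) p.2 (x + p.1 v)
     = \sum_(y in [set y in Bh h | y + k \in Bh h]) \sum_x g2 h y x * (g2 h (y + k) x)^*.
    apply: eq_bigr => y _; rewrite -[LHS](sum_shift (y ^+ 2 - y)); apply: eq_bigr => x _.
    rewrite /l !big_cons big_nil /= mulr1 /g2 rmorphM /= conjCK addr0 -!mulrA.
    congr (f2 _ * ((f2 _)^* * ((f2 _)^* * f2 _))); ring.
  apply.
  - by move=> u v; rewrite [u \in _]inE [v \in _]inE => /andP[uB _] /andP[vB _]; exact: (BhT h).
  - by rewrite -(ltr0n R).
  - by move=> u v; rewrite addr0.
  - by rewrite /l /=; do 3?split => //;
      [move=> u v; rewrite mulrDr|move=> x; rewrite modcJ|move=> u v; rewrite mulrDr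
      |move=> x; rewrite modcJ|move=> u v; rewrite mulrDr].
have s0 : modc (quad_form B f0 f1 f2) / 4 <= modc S / N.
  have SE : modc S = #|G|%:R * M%:R * modc (quad_form B f0 f1 f2).
    suff -> : S = #|G|%:R * M%:R * quad_form B f0 f1 f2 by rewrite !modcM !modc_nat.
    rewrite /quad_form /avg cardsT (card_zinterval hP (ltMP M0 MP)) -mulr_sumr.
    have GC : #|G|%:R != 0 :> C by rewrite pnatr_eq0 -lt0n -(ltr0n R).
    have MC : M%:R != 0 :> C by rewrite pnatr_eq0 -lt0n.
    have -> : forall Z : C, #|G|%:R * M%:R * (#|G|%:R^-1 * (M%:R^-1 * Z)) = Z.
      by move=> Z; field; rewrite GC MC.
    apply: eq_big => [x|x _]; first by rewrite inE.
    by rewrite mulr_sumr; apply: eq_bigr => y _; rewrite /g mulrA.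
  have [_ TM] := card_zball_bounds M0 (leq_pmull M (isT : (0 < 50)%N)).
  rewrite SE /N; set q := modc _.
  have -> : #|G|%:R * M%:R * q / (#|T|%:R * #|G|%:R) = q * (M%:R / #|T|%:R).
    by field; rewrite !gt_eqF.
  rewrite ler_wpM2l ?modc_ge0 // ler_pdivlMr // mulrC ler_pdivrMr // mulrC.
  exact: TM.
apply: (@le_trans _ _ ((modc S / N) ^+ (2 ^ 5))).
  by rewrite lerXn2r ?nnegrE ?(sq S) // divr_ge0 ?modc_ge0.
rewrite expnS exprM; apply: (@le_trans _ _ ((avg T s1) ^+ (2 ^ 4))).
  by rewrite lerXn2r ?nnegrE ?sqr_ge0 // avg_ge0 // => h _; exact: sq.
rewrite expnS exprM; apply: (@le_trans _ _ ((avg T (fun h => avg T (s2 h))) ^+ (2 ^ 3))).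
  have a0 : 0 <= avg T (fun h => avg T (s2 h)).
    by apply: avg_ge0 => h _; apply: avg_ge0 => k _; exact: sq.
  rewrite lerXn2r ?nnegrE ?sqr_ge0 //; apply: le_trans (avg_jensen2 _ _) _.
  by apply: ler_avg => h _; exact: step2.
apply: le_trans (avg_jensen _ _) _; first by move=> h _; apply: avg_ge0 => k _; exact: sq.
apply: ler_avg => h _; apply: le_trans (avg_jensen _ _) _; first by move=> k _; exact: sq.
apply: ler_avg => k _; exact: step3.
Qed.

(** The directions $2ht_1$, $2kt_2$, $2(h+k)t_3$ are not independent. Fixing
    $t_1,t_2,t_3$ instead of $h,k$, the cube they span is a system of linear
    forms in $(h,k)$; controlling it at the vertex 0 yields three directions
    with independent coefficients $t_1$, $t_2$, $t_3$ and four directions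
    that combine two coefficients. *)
Lemma box_seven_forms (f : G -> C) : bounded1 f ->
  (avg T (fun h => avg T (fun k =>
    box_avg T [:: (fun t => 0 - 2 * h * t); (fun t => 0 - 2 * k * t);
                  (fun t => 0 - 2 * (h + k) * t)] f)) ^+ 2 / 64) ^+ (2 ^ 7) <=
  avg [set: G] (fun n => avg T (fun t1 => avg T (fun t2 => avg T (fun t3 =>
    box_avg T2 (seven_forms t1 t2 t3) (mder n f))))).
Proof.
move=> bf.
have T0 := card_T_gt0; have G0 := card_G_gt0.
have T20 : 0 < #|T2|%:R :> R.
  by rewrite cardsX natrM mulr_gt0 // ltr0n; apply/card_gt0P; exists 0; exact: zball0.
pose D3 h k t1 t2 t3 := mder (0 - 2 * (h + k) * t3) \o mder (0 - 2 * k * t2) \o mder (0 - 2 * h * t1)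
   : (G -> C) -> (G -> C).
pose X n t1 t2 t3 := modc (avg T (fun h => avg T (fun k => avg [set: G] (D3 h k t1 t2 t3 (mder n f))))).
have step1 : avg T (fun h => avg T (fun k =>
    box_avg T [:: (fun t => 0 - 2 * h * t); (fun t => 0 - 2 * k * t);
                  (fun t => 0 - 2 * (h + k) * t)] f)) ^+ 2 <=
  avg [set: G] (fun n => avg T (fun t1 => avg T (fun t2 => avg T (fun t3 => X n t1 t2 t3)))).
  pose Q := avg T (fun h => avg T (fun k => avg T (fun t1 => avg T (fun t2 => avg T (fun t3 =>
     modc (avg [set: G] (D3 h k t1 t2 t3 f)) ^+ 2))))).
  apply: (@le_trans _ _ Q).
    apply: le_trans (avg_jensen2 _ _) _; apply: ler_avg => h _.
    apply: le_trans (avg_jensen2 _ _) _; apply: ler_avg => k _.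
    apply: le_trans (avg_jensen2 _ _) _; apply: ler_avg => t1 _.
    apply: le_trans (avg_jensen2 _ _) _; apply: ler_avg => t2 _.
    exact: avg_jensen2.
  have Q0 : 0 <= Q.
    apply: avg_ge0 => h _; apply: avg_ge0 => k _; apply: avg_ge0 => t1 _.
    by apply: avg_ge0 => t2 _; apply: avg_ge0 => t3 _; exact: sqr_ge0.
  rewrite -[leLHS](modc_real Q0).
  have -> : Q%:C = avg [set: G] (fun n => avg T (fun t1 => avg T (fun t2 => avg T (fun t3 =>
      avg T (fun h => avg T (fun k => avg [set: G] (D3 h k t1 t2 t3 (mder n f)))))))).
    transitivity (avg T (fun h => avg T (fun k => avg T (fun t1 => avg T (fun t2 => avg T (fun t3 =>
       avg [set: G] (fun n => avg [set: G] (D3 h k t1 t2 t3 (mder n f))))))))).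
      rewrite avgC; apply: eq_avg => h _; rewrite avgC; apply: eq_avg => k _.
      rewrite avgC; apply: eq_avg => t1 _; rewrite avgC; apply: eq_avg => t2 _.
      rewrite avgC; apply: eq_avg => t3 _; rewrite sqr_modc_avg_mder.
      apply: eq_avg => n _; congr avg; rewrite /D3 /=.
      by rewrite 3!(mderC _ n).
    pose W h k t1 t2 t3 n := avg [set: G] (D3 h k t1 t2 t3 (mder n f)).
    rewrite -/(W _ _ _ _ _ _).
    transitivity (avg T (fun t1 => avg T (fun t2 => avg T (fun t3 => avg T (fun h => avg T (fun k =>
       avg [set: G] (W h k t1 t2 t3))))))).
      under eq_avg do rewrite exchange_avg.
      rewrite exchange_avg; apply: eq_avg => t1 _.
      under eq_avg do rewrite exchange_avg.
      rewrite exchange_avg; apply: eq_avg => t2 _.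
      under eq_avg do rewrite exchange_avg.
      by rewrite exchange_avg.
    rewrite [RHS]exchange_avg; apply: eq_avg => t1 _.
    rewrite [RHS]exchange_avg; apply: eq_avg => t2 _.
    rewrite [RHS]exchange_avg; apply: eq_avg => t3 _.
    rewrite [RHS]exchange_avg; apply: eq_avg => h _.
    by rewrite [RHS]exchange_avg.
  apply: le_trans (modc_avg _ _) _; apply: ler_avg => n _.
  apply: le_trans (modc_avg _ _) _; apply: ler_avg => t1 _.
  apply: le_trans (modc_avg _ _) _; apply: ler_avg => t2 _.
  exact: modc_avg.
have step2 n t1 t2 t3 : (X n t1 t2 t3 / 64) ^+ (2 ^ 7) <= box_avg T2 (seven_forms t1 t2 t3) (mder n f).
  have [g gE] : exists g, g = mder n f by exists (mder n f).
  rewrite -gE.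
  have bg : bounded1 g by rewrite gE; exact: bounded1_mder.
  have bgJ : bounded1 (fun x => (g x)^*) by move=> x; rewrite modcJ.
  pose L al be v : G := - lin2 al be v.
  have addL al be u v : L al be (u + v) = L al be u + L al be v.
    by rewrite /L /lin2 /=; ring.
  pose l : seq ((G * G -> G) * (G -> C)) :=
    [:: (L t1 0, fun x => (g x)^*); (L 0 t2, fun x => (g x)^*); (L t3 t3, fun x => (g x)^*);
        (L t1 t2, g); (L (t1 + t3) t3, g); (L t3 (t2 + t3), g);
        (L (t1 + t3) (t2 + t3), fun x => (g x)^*)].
  have := @linear_forms_box R (G * G)%type G T2 (setX T T) l (fun _ => 0) g.
  have -> : [seq (fun v => 0 - p.1 v) | p <- l] = seven_forms t1 t2 t3.
    by rewrite /l /L /seven_forms /=; do 7?[congr (_ :: _)]; apply/funext => v; rewrite sub0r opprK.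
  move=> H; have {}H := H _ _ _ _; apply: le_trans (H _ _ _ _); last first.
  - rewrite /l /=; do 7?[split => //]; exact: addL.
  - by move=> u v; rewrite addr0.
  - by rewrite -(ltr0n R).
  - move=> [u u'] [v v']; rewrite !in_setX => /andP[uT uT'] /andP[vT vT'].
    have mm : (M + M <= 2 * M)%N by rewrite mul2n addnn.
    by rewrite (zballS mm (zballB hP vT uT)) (zballS mm (zballB hP vT' uT')).
  rewrite lerXn2r ?nnegrE ?divr_ge0 ?modc_ge0 ?mulr_ge0 //.
  have -> : \sum_(v in setX T T) \sum_x g (x + 0) * \prod_(p <- l) p.2 (x + p.1 v) =
      #|T|%:R * #|T|%:R * #|G|%:R * avg T (fun h => avg T (fun k => avg [set: G] (D3 h k t1 t2 t3 g))).
    have -> : avg T (fun h => avg T (fun k => avg [set: G] (D3 h k t1 t2 t3 g))) =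
      avg (setX T T) (fun v => avg [set: G] (D3 v.1 v.2 t1 t2 t3 g)) by rewrite avg_setX.
    rewrite /avg -mulr_sumr cardsX cardsT natrM.
    have GC : #|G|%:R != 0 :> C by rewrite pnatr_eq0 -lt0n -(ltr0n R).
    have TC : #|T|%:R != 0 :> C by rewrite pnatr_eq0 -lt0n -(ltr0n R).
    have -> : forall Z : C, #|T|%:R * #|T|%:R * #|G|%:R * ((#|T|%:R * #|T|%:R)^-1 * (#|G|%:R^-1 * Z)) = Z.
      by move=> Z; field; rewrite GC TC.
    apply: eq_bigr => -[h k] _; apply: eq_big => [x|x _]; first by rewrite inE.
    rewrite /l !big_cons big_nil /= mulr1 /D3 /= /mder !rmorphM /= !conjCK addr0 /L /lin2 /=.
    have -> : x + (0 - 2 * (h + k) * t3) + (0 - 2 * k * t2) + (0 - 2 * h * t1) =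
      x - 2 * ((t1 + t3) * h + (t2 + t3) * k) by ring.
    have -> : x + (0 - 2 * (h + k) * t3) + (0 - 2 * k * t2) = x - 2 * (t3 * h + (t2 + t3) * k) by ring.
    have -> : x + (0 - 2 * (h + k) * t3) + (0 - 2 * h * t1) = x - 2 * ((t1 + t3) * h + t3 * k) by ring.
    have -> : x + (0 - 2 * k * t2) + (0 - 2 * h * t1) = x - 2 * (t1 * h + t2 * k) by ring.
    have -> : x + (0 - 2 * (h + k) * t3) = x - 2 * (t3 * h + t3 * k) by ring.
    have -> : x + (0 - 2 * k * t2) = x - 2 * (0 * h + t2 * k) by ring.
    have -> : x + (0 - 2 * h * t1) = x - 2 * (t1 * h + 0 * k) by ring.
    ring.
  have mE (Z : C) : modc (#|T|%:R * #|T|%:R * #|G|%:R * Z) = #|T|%:R * #|T|%:R * #|G|%:R * modc Z.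
    by rewrite !modcM !modc_nat.
  rewrite mE gE -/(X n t1 t2 t3) ler_pdivlMr ?mulr_gt0 //.
  have [TM _] := card_zball_bounds M0 (leq_pmull M (isT : (0 < 50)%N)).
  have M20 : (0 < 2 * M)%N by rewrite muln_gt0.
  have [_ J2] := @card_zball_bounds (2 * M) M20 (leq_mul (isT : (2 <= 50)%N) (leqnn M)).
  have J20 : 0 <= #|zball P (2 * M)|%:R :> R by [].
  have J2T : #|zball P (2 * M)|%:R <= 8 * #|T|%:R :> R.
    by apply: le_trans J2 _; rewrite natrM; lra.
  rewrite cardsX natrM.
  have JJ : #|zball P (2 * M)|%:R * #|zball P (2 * M)|%:R <= 64 * (#|T|%:R * #|T|%:R) :> R.
    by have := ler_pM J20 J20 J2T J2T; lra.
  have X0 : 0 <= X n t1 t2 t3 by exact: modc_ge0.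
  have := ler_wpM2r (mulr_ge0 X0 (ltW G0)) JJ; lra.
have X0 n t1 t2 t3 : 0 <= X n t1 t2 t3 / 64 by rewrite divr_ge0 // modc_ge0.
apply: (@le_trans _ _ ((avg [set: G] (fun n => avg T (fun t1 => avg T (fun t2 => avg T (fun t3 =>
    X n t1 t2 t3 / 64))))) ^+ (2 ^ 7))).
  rewrite lerXn2r ?nnegrE ?divr_ge0 ?sqr_ge0 //.
    apply: avg_ge0 => n _; apply: avg_ge0 => t1 _; apply: avg_ge0 => t2 _.
    by apply: avg_ge0 => t3 _.
  have -> : avg [set: G] (fun n => avg T (fun t1 => avg T (fun t2 => avg T (fun t3 =>
      X n t1 t2 t3 / 64)))) = avg [set: G] (fun n => avg T (fun t1 => avg T (fun t2 =>
      avg T (X n t1 t2)))) / 64.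
    rewrite -avgZr; apply: eq_avg => n _; rewrite -avgZr; apply: eq_avg => t1 _.
    by rewrite -avgZr; apply: eq_avg => t2 _; rewrite -avgZr.
  by rewrite ler_wpM2r // invr_ge0.
do 4?[apply: le_trans (avg_jensen _ _) _; [by move=> ? _; do ?[apply: avg_ge0 => ? _] | apply: ler_avg => ? _]].
exact: step2.
Qed.

End Linearisation.

(** * Replacing structured differences with uniform ones *)

Section Concatenation.
Import mathcomp.boot.finset.
Variables (R : realType) (P M : nat).
Hypotheses (hP : (1 < P)%N) (M0 : (0 < M)%N) (MP : (100 * M ^ 2 <= P)%N)
  (PM : (P <= 400 * M ^ 2)%N).
Local Notation G := 'Z_P.
Local Notation C := R[i].
Local Notation T := (zball P M).
Local Notation J2 := (zball P (2 * M)).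
Local Notation J4 := (zball P (4 * M)).
Local Notation T2 := (setX J2 J2).
Implicit Types (g : G -> C).

(** One direction with good coefficients costs one degree: conditionally on the
    other directions, the difference is spread over $\mathbb Z/P$ with bounded
    $L^2$ density and may be replaced with a uniform one. *)
Lemma rich_step m k al be (K : nat) g : (M <= m <= 4 * M)%N ->
  (#|zero_pairs M al be| <= K)%N -> bounded1 g ->
  (avg (setX (zball P m) (zball P m)) (fun v => gowers k (mder (lin2 al be v) g))) ^+ 2
    <= 400 * K%:R * gowers k.+1 g.
Proof.
move=> mM zK bg; set S := setX _ _.
pose Phi (h : cube G k) x := modc (avg [set: G] (mder x (cube_der h g))) ^+ 2.
have Phi0 h x : 0 <= Phi h x by exact: sqr_ge0.
have Phi1 h x : Phi h x <= 1.
  rewrite exprn_ile1 ?modc_ge0 // modc_avg_le1 // => y _.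
  by apply: bounded1_mder; exact: bounded1_cube_der.
have gk x : gowers k (mder x g) = avg [set: cube G k] (fun h => Phi h x).
  rewrite (gowers_cube 0 k (mder x g) : gowers k (mder x g) = _).
  by apply: eq_avg => h _; rewrite cube_der_mder.
have -> : avg S (fun v => gowers k (mder (lin2 al be v) g)) =
    avg [set: cube G k] (fun h => avg S (fun v => Phi h (lin2 al be v))).
  by rewrite exchange_avg; apply: eq_avg => v _; rewrite gk.
apply: le_trans (avg_jensen2 _ _) _.
apply: (@le_trans _ _ (avg [set: cube G k] (fun h =>
    400 * K%:R * avg [set: G] (fun x => Phi h x ^+ 2)))).
  by apply: ler_avg => h _; exact: (rich_average hP M0 MP PM (Phi h) mM zK).
rewrite avgZ ler_wpM2l ?(mulr_ge0 (ler0n R 400) (ler0n R K)) //= exchange_avg; apply: ler_avg => x _.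
by rewrite gk; apply: ler_avg => h _; rewrite expr2 ler_piMl.
Qed.

(** Repeated use of [rich_step], one degree for each direction of the list. *)
Lemma rich_list (K : nat) (l : seq (G * G)) g : bounded1 g ->
  (forall p, p \in l -> (#|zero_pairs M p.1 p.2| <= K)%N) ->
  (box_avg T2 [seq lin2 p.1 p.2 | p <- l] g) ^+ (2 ^ (size l).+1) <=
    (400 * K%:R) ^+ (2 ^ size l).-1 * gowers (size l) g.
Proof.
elim: l g => [|p l IH] g bg good; first by rewrite /= expr0 mul1r expn1.
rewrite [box_avg _ _ _]/= expnSr exprM.
have c0 : 0 <= 400 * K%:R :> R := mulr_ge0 (ler0n R 400) (ler0n R K).
set a := avg _ _.
have a0 : 0 <= a by apply: avg_ge0 => v _; exact: box_avg_ge0.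
set Q := avg T2 (fun v => gowers (size l) (mder (lin2 p.1 p.2 v) g)).
have Q0 : 0 <= Q by apply: avg_ge0 => v _; exact: gowers_ge0.
have h1 : a ^+ (2 ^ (size l).+1) <= (400 * K%:R) ^+ (2 ^ size l).-1 * Q.
  apply: le_trans (avg_jensen _ _) _; first by move=> v _; exact: box_avg_ge0.
  rewrite -avgZ; apply: ler_avg => v _; apply: IH; first exact: bounded1_mder.
  by move=> q ql; apply: good; rewrite inE ql orbT.
apply: (@le_trans _ _ (((400 * K%:R) ^+ (2 ^ size l).-1 * Q) ^+ 2)).
  have r0 : 0 <= (400 * K%:R) ^+ (2 ^ size l).-1 * Q by exact: mulr_ge0 (exprn_ge0 _ c0) Q0.
  by rewrite lerXn2r ?nnegrE ?(exprn_ge0 _ a0).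
have h2 : Q ^+ 2 <= 400 * K%:R * gowers (size l).+1 g.
  have mM : (M <= 2 * M <= 4 * M)%N by apply/andP; split; [rewrite leq_pmull | rewrite leq_mul2r orbT].
  apply: rich_step => //.
  by apply: good; rewrite inE eqxx.
rewrite exprMn; apply: le_trans (ler_wpM2l (exprn_ge0 2 (exprn_ge0 _ c0)) h2) _.
rewrite mulrA -exprM -exprSr /=.
have -> : ((2 ^ size l).-1 * 2).+1 = (2 ^ (size l).+1).-1.
  have : (0 < 2 ^ size l)%N by rewrite expn_gt0.
  by rewrite expnS; case: (2 ^ size l)%N => // n _; rewrite mul2n muln2 doubleS.
by [].
Qed.

(** Every combined pair of coefficients is an injective function of two of the
    $t_i$, so that the count of bad pairs bounds how often it is bad. *)
Lemma avg_bad_pairs D (phi : G -> G -> G * G) : (0 < D <= M)%N ->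
  (forall s s' t t', phi s t = phi s' t' -> s = s' /\ t = t') ->
  avg T (fun s => avg T (fun t => (phi s t \in bad_pairs P M D)%:R)) <= 88 / D%:R :> R.
Proof.
move=> DM inj; have /andP[D0 _] := DM.
have Dr : 0 < D%:R :> R by rewrite ltr0n.
have Mr : 0 < M%:R :> R by rewrite ltr0n.
have [TM _] := @card_zball_bounds R P M hP M0 MP M M0 (leq_pmull M (isT : (0 < 50)%N)).
have T0 : 0 < #|T|%:R :> R by apply: lt_le_trans TM.
have -> : avg T (fun s => avg T (fun t => (phi s t \in bad_pairs P M D)%:R)) =
    avg (setX T T) (fun z => (phi z.1 z.2 \in bad_pairs P M D)%:R : R) by rewrite avg_setX.
rewrite /avg cardsX natrM mulrC ler_pdivrMr ?mulr_gt0 //.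
have cnt : \sum_(z in setX T T) (phi z.1 z.2 \in bad_pairs P M D)%:R <= #|bad_pairs P M D|%:R :> R.
  rewrite -natr_sum ler_nat.
  have -> : (\sum_(z in setX T T) (phi z.1 z.2 \in bad_pairs P M D) =
     #|[set z in setX T T | phi z.1 z.2 \in bad_pairs P M D]|)%N.
    rewrite -sum1_card [RHS]big_mkcond [LHS]big_mkcond; apply: eq_bigr => z _.
    by rewrite inE; case: (z \in _) => //=; case: (_ \in _).
  have injp : injective (fun z : G * G => phi z.1 z.2).
    by move=> [s t] [s' t'] /= /inj[-> ->].
  rewrite -(card_imset _ injp); apply/subset_leq_card/fintype.subsetP => _ /imsetP[z + ->].
  by rewrite inE => /andP[].
apply: le_trans cnt _; rewrite mulrAC ler_pdivlMr //.
apply: le_trans (card_bad_pairs R hP M0 MP DM) _.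
by rewrite ler_wpM2l // expr2 ler_pM.
Qed.

(** Cauchy--Schwarz over the base point $x$ replaces the direction $2tu$ with
    $2(tu-t'u')$, which has two independent coefficients. *)
Lemma single_direction D g : (0 < D <= M)%N -> bounded1 g ->
  modc (avg T (fun t => avg J4 (fun u => avg [set: G] (mder (2 * t * u) g)))) ^+ 4 <=
  88 / D%:R + 400 * (18 * D ^ 2)%:R * gowers 1 g.
Proof.
move=> DM bg; pose Psi x := modc (avg [set: G] (mder x g)).
have Psi1 x : Psi x <= 1 by apply: modc_avg_le1 => y _; exact: bounded1_mder.
have Psi0 x : 0 <= Psi x by exact: modc_ge0.
pose S := setX T J4.
pose F (z : G * G) x := (g (x + 2 * z.1 * z.2))^*.
pose W t t' := avg (setX J4 J4) (fun v => Psi (2 * (t * v.1 + (- t') * v.2))).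
have W0 t t' : 0 <= W t t' by apply: avg_ge0.
have W1 t t' : W t t' <= 1 by apply: avg_le.
have h1 : modc (avg T (fun t => avg J4 (fun u => avg [set: G] (mder (2 * t * u) g)))) ^+ 2 <=
    avg T (fun t => avg T (W t)).
  have -> : avg T (fun t => avg J4 (fun u => avg [set: G] (mder (2 * t * u) g))) =
     avg [set: G] (fun x => g x * avg S (fun z => F z x)).
    rewrite -(avg_setX T J4 (fun z => avg [set: G] (mder (2 * z.1 * z.2) g))) exchange_avg.
    by apply: eq_avg => x _; rewrite -avgZ.
  apply: le_trans (sqr_modc_avgM _ (fun x _ => bg x)) _.
  have Q0 : 0 <= avg [set: G] (fun x => modc (avg S (fun z => F z x)) ^+ 2).
    by apply: avg_ge0 => x _; exact: sqr_ge0.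
  rewrite -[leLHS](modc_real Q0) avgC.
  have -> : avg [set: G] (fun x => (modc (avg S (fun z => F z x)) ^+ 2)%:C) =
     avg T (fun t => avg T (fun t' => avg (setX J4 J4) (fun v =>
       avg [set: G] (mder (2 * (t * v.1 + (- t') * v.2)) g)))).
    transitivity (avg S (fun z => avg S (fun z' => avg [set: G] (mder (2 * z.1 * z.2 - 2 * z'.1 * z'.2) g)))).
      transitivity (avg [set: G] (fun x => avg S (fun z => avg S (fun z' => F z x * (F z' x)^*)))).
        by apply: eq_avg => x _; exact: sqr_modc_avgE.
      rewrite exchange_avg; apply: eq_avg => z _.
      rewrite exchange_avg; apply: eq_avg => z' _.
      rewrite -[RHS](avg_shift (2 * z'.1 * z'.2)); apply: eq_avg => x _.
      rewrite /F /mder conjCK mulrC; congr (_ * (g _)^*); ring.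
    rewrite avg_setX; apply: eq_avg => t _.
    transitivity (avg J4 (fun u => avg T (fun t' => avg J4 (fun u' =>
       avg [set: G] (mder (2 * t * u - 2 * t' * u') g))))).
      by apply: eq_avg => u _; rewrite avg_setX.
    rewrite exchange_avg; apply: eq_avg => t' _; rewrite avg_setX.
    apply: eq_avg => u _; apply: eq_avg => u' _; congr (avg _ (mder _ g)) => /=; ring.
  apply: le_trans (modc_avg _ _) _; apply: ler_avg => t _.
  apply: le_trans (modc_avg _ _) _; apply: ler_avg => t' _.
  exact: modc_avg.
rewrite -[4%N]/(2 * 2)%N exprM.
apply: (@le_trans _ _ (avg T (fun t => avg T (fun t' => W t t' ^+ 2)))).
  apply: (@le_trans _ _ ((avg T (fun t => avg T (W t))) ^+ 2)).
    by rewrite lerXn2r ?nnegrE ?sqr_ge0 //; do 2!(apply: avg_ge0 => ? _).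
  apply: le_trans (avg_jensen2 _ _) _; apply: ler_avg => t _; exact: avg_jensen2.
have k0 : 0 <= 400 * (18 * D ^ 2)%:R * gowers 1 g.
  exact: mulr_ge0 (mulr_ge0 (ler0n R 400) (ler0n R _)) (gowers_ge0 _ _).
apply: (@le_trans _ _ (avg T (fun t => avg T (fun t' =>
    ((t, - t') \in bad_pairs P M D)%:R + 400 * (18 * D ^ 2)%:R * gowers 1 g)))).
  apply: ler_avg => t tT; apply: ler_avg => t' tT'.
  case: (boolP ((t, - t') \in bad_pairs P M D)) => [_|] /=.
    by apply: (@le_trans _ _ 1); [rewrite exprn_ile1 | rewrite lerDl].
  have M2 : (M <= 2 * M)%N by rewrite leq_pmull.
  rewrite inE /= (zballS M2 tT) (zballS M2 (zballN tT')) /= -leqNgt add0r => zK.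
  have mM : (M <= 4 * M <= 4 * M)%N by rewrite leqnn andbT leq_pmull.
  exact: (rich_average hP M0 MP PM Psi mM zK).
have T0 : 0 \in T by exact: zball0.
have -> : avg T (fun t => avg T (fun t' => ((t, - t') \in bad_pairs P M D)%:R +
     400 * (18 * D ^ 2)%:R * gowers 1 g)) =
  avg T (fun t => avg T (fun t' => ((t, - t') \in bad_pairs P M D)%:R)) + 400 * (18 * D ^ 2)%:R * gowers 1 g.
  rewrite -[X in _ + X](avg_cst _ T0) -avgD; apply: eq_avg => t _.
  by rewrite avgD (avg_cst _ T0).
rewrite lerD2r; apply: (avg_bad_pairs (phi := fun t t' => (t, - t'))) => // s s' t t'.
by move=> /pair_equal_spec[-> /oppr_inj ->].
Qed.

(** A direction $2tu$ whose coefficient $t$ occurs nowhere else costs two degrees: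
    one to make the sum over the base point nonnegative, one because after
    Cauchy--Schwarz the difference is $2tu-2t'u'$. *)
Lemma single_step D k (I : finType) (S : {set I}) (g : I -> G -> C) : (0 < D <= M)%N ->
  (forall i, bounded1 (g i)) ->
  (avg S (fun i => avg T (fun t => avg J4 (fun u => gowers k (mder (2 * t * u) (g i)))))) ^+ 4 <=
  88 / D%:R + 400 * (18 * D ^ 2)%:R * avg S (fun i => gowers k.+2 (g i)).
Proof.
move=> DM bg; pose H i (n : cube G k) m := mder m (cube_der n (g i)).
have bH i n m : bounded1 (H i n m) by apply: bounded1_mder; exact: bounded1_cube_der.
pose A i n m := modc (avg T (fun t => avg J4 (fun u => avg [set: G] (mder (2 * t * u) (H i n m))))).
pose c : R := 88 / D%:R; pose kap : R := 400 * (18 * D ^ 2)%:R.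
have k0 : 0 <= kap := mulr_ge0 (ler0n R 400) (ler0n R _).
have c0 : 0 <= c by rewrite divr_ge0.
case: (set_0Vmem S) => [->|[i0 i0S]].
  by rewrite !avg_set0 expr0n /= mulr0 addr0.
set X := avg S _.
have X0 : 0 <= X by do 3!(apply: avg_ge0 => ? _); exact: gowers_ge0.
have hX : X <= avg S (fun i => avg [set: cube G k] (fun n => avg [set: G] (A i n))).
  rewrite -[leLHS](modc_real X0).
  have -> : X%:C = avg S (fun i => avg [set: cube G k] (fun n => avg [set: G] (fun m =>
      avg T (fun t => avg J4 (fun u => avg [set: G] (mder (2 * t * u) (H i n m))))))).
    rewrite avgC; apply: eq_avg => i _.
    transitivity (avg T (fun t => avg J4 (fun u => avg [set: cube G k] (fun n => avg [set: G] (fun m =>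
        avg [set: G] (mder (2 * t * u) (H i n m))))))).
      rewrite avgC; apply: eq_avg => t _; rewrite avgC; apply: eq_avg => u _.
      rewrite (gowers_cube 0 k (mder (2 * t * u) (g i)) : gowers k _ = _) avgC.
      apply: eq_avg => n _; rewrite sqr_modc_avg_mder; apply: eq_avg => m _.
      by congr (avg _ _); rewrite /H cube_der_mder mderC.
    rewrite [RHS]exchange_avg.
    transitivity (avg T (fun t => avg [set: cube G k] (fun n => avg [set: G] (fun m =>
        avg J4 (fun u => avg [set: G] (mder (2 * t * u) (H i n m))))))).
      apply: eq_avg => t _; rewrite exchange_avg; apply: eq_avg => n _.
      by rewrite exchange_avg.
    rewrite exchange_avg [RHS]exchange_avg; apply: eq_avg => n _.
    by rewrite exchange_avg.
  apply: le_trans (modc_avg _ _) _; apply: ler_avg => i _.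
  apply: le_trans (modc_avg _ _) _; apply: ler_avg => n _.
  exact: modc_avg.
apply: (@le_trans _ _ ((avg S (fun i => avg [set: cube G k] (fun n => avg [set: G] (A i n)))) ^+ (2 ^ 2))).
  by rewrite lerXn2r ?nnegrE // (le_trans X0).
apply: (@le_trans _ _ (avg S (fun i => avg [set: cube G k] (fun n => avg [set: G] (fun m => A i n m ^+ (2 ^ 2)))))).
  have A0 i n m : 0 <= A i n m by exact: modc_ge0.
  apply: le_trans (avg_jensen _ _) _; first by move=> i _; do 2!(apply: avg_ge0 => ? _).
  apply: ler_avg => i _; apply: le_trans (avg_jensen _ _) _; first by move=> n _; apply: avg_ge0.
  apply: ler_avg => n _; exact: avg_jensen.
apply: (@le_trans _ _ (avg S (fun i => c + kap * gowers k.+2 (g i)))); last first.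
  by rewrite avgD (avg_cst c i0S) avgZ.
apply: ler_avg => i _.
have -> : gowers k.+2 (g i) = avg [set: cube G k] (fun n => avg [set: G] (fun m => gowers 1 (H i n m))).
  rewrite (gowers_cube 1 k.+1 (g i) : gowers k.+2 (g i) = _).
  rewrite (avg_setT2 (fun h : G * cube G k => gowers 1 (@cube_der R G k.+1 h (g i)))).
  rewrite exchange_avg; apply: eq_avg => n _; apply: eq_avg => m _.
  by rewrite /H -(cube_der_mder n m (g i)).
have -> : c + kap * avg [set: cube G k] (fun n => avg [set: G] (fun m => gowers 1 (H i n m))) =
    avg [set: cube G k] (fun n => avg [set: G] (fun m => c + kap * gowers 1 (H i n m))).
  rewrite -avgZ -[X in X + _](avg_cst _ (in_setT (0 : cube G k))) -avgD.
  apply: eq_avg => n _; rewrite [RHS]avgD (avg_cst c (in_setT (0 : G))); congr (_ + _).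
  by rewrite [RHS]avgZ.
by apply: ler_avg => n _; apply: ler_avg => m _; exact: single_direction.
Qed.

End Concatenation.

(** * Control by a Gowers norm *)

Section GowersControl.
Import mathcomp.boot.finset.
Variables (R : realType) (P M : nat).
Hypotheses (hP : (1 < P)%N) (M0 : (0 < M)%N) (MP : (100 * M ^ 2 <= P)%N)
  (PM : (P <= 400 * M ^ 2)%N).
Local Notation G := 'Z_P.
Local Notation C := R[i].
Local Notation B := (zinterval P M).
Local Notation T := (zball P M).
Local Notation J2 := (zball P (2 * M)).
Local Notation J4 := (zball P (4 * M)).
Local Notation T2 := (setX J2 J2).
Implicit Types (g f : G -> C).

(** Bad pairs have proportion $O(1/D)$ and good ones cost a factor $D^2$; taking
    $D$ to be a power of $1/\eta$ makes the first negligible and the second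
    affordable. *)
Lemma choose_scale (eta : R) n : 0 < eta <= 1 / 2 -> 1 <= eta ^+ n * M%:R ->
  exists D, [/\ (0 < D <= M)%N, D%:R * eta ^+ n <= 1 & D%:R^-1 <= 2 * eta ^+ n].
Proof.
move=> /andP[e0 e12] Mbig; have en : 0 < eta ^+ n by rewrite exprn_gt0.
have x1 : 1 <= (eta ^+ n)^-1.
  by rewrite invf_ge1 // exprn_ile1 ?(ltW e0) //; lra.
have x0 : 0 <= (eta ^+ n)^-1 by apply: le_trans x1.
pose D := Num.truncn (eta ^+ n)^-1.
have Da : D%:R <= (eta ^+ n)^-1 by rewrite truncn_le.
have Db : (eta ^+ n)^-1 < D%:R + 1 by rewrite natr1; exact: truncnS_gt.
have D0 : (0 < D)%N by rewrite truncn_gt0.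
have D1 : 1 <= D%:R :> R by rewrite ler1n.
have Dr : 0 < D%:R :> R by rewrite ltr0n.
have De : D%:R * eta ^+ n <= 1 by rewrite -ler_pdivlMr // mul1r.
exists D; split => //.
  rewrite D0 -(ler_nat R); apply: le_trans Da _.
  by rewrite -[leLHS]mul1r ler_pdivrMr // mulrC.
have h : (eta ^+ n)^-1 <= 2 * D%:R by lra.
rewrite -[leLHS]mul1r ler_pdivrMr //.
by have := ler_wpM2r (ltW en) h; rewrite mulVf ?gt_eqF //; lra.
Qed.

(** [single_step] with the losses expressed as a power of $\eta$, for any
    direction $\mathrm{dir}(t,v)$ that is dominated in distribution by $2tu$. *)
Lemma concat_power k (I : finType) (S : {set I}) (g : I -> G -> C)
    (dir : G -> G * G -> G) (eta : R) :
  (forall t (Phi : G -> R), (forall x, 0 <= Phi x) ->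
    avg T2 (fun v => Phi (dir t v)) <= 8 * avg J4 (fun u => Phi (2 * t * u))) ->
  (forall i, bounded1 (g i)) -> 0 < eta <= 1 / 2 -> 1 <= eta ^+ 26 * M%:R ->
  eta <= avg S (fun i => avg T (fun t => avg T2 (fun v => gowers k (mder (dir t v) (g i))))) ->
  eta ^+ 83 <= avg S (fun i => gowers k.+2 (g i)).
Proof.
move=> hdir bg eta12 Mbig hZ; have /andP[e0 e12] := eta12.
have [D [DM De Di]] := choose_scale eta12 Mbig; have /andP[D0 _] := DM.
have st := @single_step R P M hP M0 MP PM D k I S g DM bg.
set A := avg S _ in st; set X := avg S (fun i => gowers k.+2 (g i)) in st *.
have en n : 0 <= eta ^+ n by rewrite exprn_ge0 // ltW.
have X0 : 0 <= X by apply: avg_ge0 => i _; exact: gowers_ge0.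
have hA : eta ^+ 4 <= A.
  have h8 : eta <= 8 * A.
    apply: le_trans hZ _; rewrite /A -avgZ; apply: ler_avg => i _.
    rewrite -avgZ; apply: ler_avg => t _.
    exact: (hdir t (fun x => gowers k (mder x (g i))) (fun x => gowers_ge0 _ _)).
  have h3 : 8 * eta ^+ 3 <= 1 by apply: (expr_absorb eta12); rewrite -natrX ler_nat.
  have := exprS eta 3; nra.
have h16 : eta ^+ 16 <= 88 / D%:R + 400 * (18 * D ^ 2)%:R * X.
  apply: le_trans st; rewrite -[16%N]/(4 * 4)%N exprM lerXn2r ?nnegrE ?en //.
  exact: le_trans (en 4%N) hA.
have b1 : 88 / D%:R <= eta ^+ 16 / 2.
  have : 352 * eta ^+ 10 <= 1 by apply: (expr_absorb eta12); rewrite -natrX ler_nat.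
  move: Di; rewrite (exprD eta 16 10); have := en 16%N; nra.
have h2 : eta ^+ 16 / 2 <= 400 * 18 * (D%:R ^+ 2 * X).
  by move: h16 b1; rewrite natrM natrX; lra.
have h3 : eta ^+ 68 <= 400 * 36 * X.
  have De2 : D%:R ^+ 2 * eta ^+ 52 <= 1.
    by rewrite -[52%N]/(26 * 2)%N exprM -exprMn exprn_ile1 // mulr_ge0.
  have := ler_wpM2r (en 52%N) h2; have := ler_wpM2r X0 De2.
  rewrite (exprD eta 16 52); lra.
have h4 := @expr_absorb2 R eta eta12 400 36 9 6 isT isT.
have c0 : 0 < 400 * 36 :> R by rewrite -natrM ltr0n.
rewrite -(ler_pM2l c0); apply: le_trans h3.
rewrite (_ : eta ^+ 83 = eta ^+ 9 * eta ^+ 6 * eta ^+ 68); last by rewrite -!exprD.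
have -> : 400 * 36 * (eta ^+ 9 * eta ^+ 6 * eta ^+ 68) = 400 * eta ^+ 9 * (36 * eta ^+ 6) * eta ^+ 68 by ring.
by rewrite ler_piMl.
Qed.

Lemma zball_ratio : #|J4|%:R <= 8 * #|J2|%:R :> R.
Proof.
have M20 : (0 < 2 * M)%N by rewrite muln_gt0.
have M40 : (0 < 4 * M)%N by rewrite muln_gt0.
have [a _] := @card_zball_bounds R P M hP M0 MP (2 * M) M20 (leq_mul (isT : (2 <= 50)%N) (leqnn M)).
have [_ b] := @card_zball_bounds R P M hP M0 MP (4 * M) M40 (leq_mul (isT : (4 <= 50)%N) (leqnn M)).
apply: le_trans b _; rewrite natrM in a *; lra.
Qed.

(** Enlarging the range of a nonnegative average costs the ratio of sizes. *)
Lemma avg_J2_le (Phi : G -> R) : (forall x, 0 <= Phi x) -> avg J2 Phi <= 8 * avg J4 Phi.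
Proof.
move=> Phi0.
have J20 : 0 < #|J2|%:R :> R by rewrite ltr0n; apply/card_gt0P; exists 0; exact: zball0.
have J40 : 0 < #|J4|%:R :> R by rewrite ltr0n; apply/card_gt0P; exists 0; exact: zball0.
have sub : \sum_(x in J2) Phi x <= \sum_(x in J4) Phi x.
  rewrite [leRHS](big_setID J2) /=; apply: ler_wpDr; first exact: sumr_ge0.
  rewrite le_eqVlt; apply/orP; left; apply/eqP; apply: eq_bigl => x; rewrite [in RHS]inE andbC.
  case: (boolP (x \in J2)) => // xJ; apply/esym/(zballS _ xJ); by rewrite leq_mul2r orbT.
have S0 : 0 <= \sum_(x in J4) Phi x by exact: sumr_ge0.
rewrite /avg; apply: (@le_trans _ _ (#|J2|%:R^-1 * \sum_(x in J4) Phi x)).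
  by rewrite ler_wpM2l // invr_ge0 ltW.
rewrite mulrA ler_wpM2r // ler_pdivlMr // mulrC ler_pdivrMr //; exact: zball_ratio.
Qed.

Lemma dir_fst t (Phi : G -> R) : (forall x, 0 <= Phi x) ->
  avg T2 (fun v => Phi (lin2 t 0 v)) <= 8 * avg J4 (fun u => Phi (2 * t * u)).
Proof.
move=> Phi0; rewrite avg_setX.
apply: le_trans (avg_J2_le (fun u => Phi0 (2 * t * u))).
apply: ler_avg => u _; apply: avg_le => // v _.
by rewrite /lin2 /= mul0r addr0 mulrA.
Qed.

Lemma dir_snd t (Phi : G -> R) : (forall x, 0 <= Phi x) ->
  avg T2 (fun v => Phi (lin2 0 t v)) <= 8 * avg J4 (fun u => Phi (2 * t * u)).
Proof.
move=> Phi0; rewrite avg_setX exchange_avg.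
apply: le_trans (avg_J2_le (fun u => Phi0 (2 * t * u))).
apply: ler_avg => u _; apply: avg_le => // v _.
by rewrite /lin2 /= mul0r add0r mulrA.
Qed.

Lemma dir_add t (Phi : G -> R) : (forall x, 0 <= Phi x) ->
  avg T2 (fun v => Phi (lin2 t t v)) <= 8 * avg J4 (fun u => Phi (2 * t * u)).
Proof.
move=> Phi0; rewrite avg_setX.
have J20 : 0 < #|J2|%:R :> R by rewrite ltr0n; apply/card_gt0P; exists 0; exact: zball0.
have J40 : 0 < #|J4|%:R :> R by rewrite ltr0n; apply/card_gt0P; exists 0; exact: zball0.
have S0 : 0 <= \sum_(x in J4) Phi (2 * t * x) by exact: sumr_ge0.
have A0 : 0 <= 8 * avg J4 (fun u => Phi (2 * t * u)) by rewrite mulr_ge0 ?avg_ge0.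
apply: avg_le => // u uJ; rewrite /avg.
apply: (@le_trans _ _ (#|J2|%:R^-1 * \sum_(x in J4) Phi (2 * t * x))).
  rewrite ler_wpM2l ?invr_ge0 ?(ltW J20) //.
  have -> : \sum_(v in J2) Phi (lin2 t t (u, v)) = \sum_(x in [set u + v | v in J2]) Phi (2 * t * x).
    rewrite big_imset /=; last by move=> a b _ _ /addrI.
    by apply: eq_bigr => v _; rewrite /lin2 /= -mulrDr mulrA.
  rewrite [leRHS](big_setID [set u + v | v in J2]) /=; apply: ler_wpDr; first exact: sumr_ge0.
  rewrite le_eqVlt; apply/orP; left; apply/eqP; apply: eq_bigl => x; rewrite [in RHS]inE andbC.
  case: (boolP (x \in [set u + v | v in J2])) => // /imsetP[v vJ ->]; apply/esym.
  have m4 : (2 * M + 2 * M <= 4 * M)%N by rewrite -mulnDl.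
  by rewrite andTb (zballS m4 (zballD hP uJ vJ)).
rewrite mulrA ler_wpM2r // ler_pdivlMr // mulrC ler_pdivrMr //; exact: zball_ratio.
Qed.

(** What is left of the seven directions once the four combined ones have been
    absorbed in a Gowers norm. *)
Definition three_ders (n t1 t2 t3 : G) (v1 v2 v3 : G * G) f : G -> C :=
  mder (lin2 t3 t3 v3) (mder (lin2 0 t2 v2) (mder (lin2 t1 0 v1) (mder n f))).

(** The four combined directions become four degrees. When one of the four
    pairs of coefficients is bad, the trivial bound 1 is used. *)
Lemma rich_block (eta : R) f : bounded1 f -> 0 < eta <= 1 / 2 -> 1 <= eta ^+ 43 * M%:R ->
  eta <= avg [set: G] (fun n => avg T (fun t1 => avg T (fun t2 => avg T (fun t3 =>
    box_avg T2 (seven_forms t1 t2 t3) (mder n f))))) ->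
  (eta ^+ 100) ^+ 15 * eta ^+ 33 <=
  avg [set: G] (fun n => avg T (fun t1 => avg T (fun t2 => avg T (fun t3 =>
    avg T2 (fun v1 => avg T2 (fun v2 => avg T2 (fun v3 =>
      gowers 4 (three_ders n t1 t2 t3 v1 v2 v3 f)))))))).
Proof.
move=> bf eta12 Mbig hY; have /andP[e0 e12] := eta12.
have [D [DM De Di]] := choose_scale eta12 Mbig; have /andP[D0 _] := DM.
have en n : 0 <= eta ^+ n by rewrite exprn_ge0 // ltW.
pose K := (18 * D ^ 2)%N; pose kap : R := 400 * K%:R.
have k0 : 0 <= kap := mulr_ge0 (ler0n R 400) (ler0n R _).
pose bad p : R := (p \in bad_pairs P M D)%:R.
pose badt t1 t2 t3 := bad (t1, t2) + bad (t1 + t3, t3) + bad (t3, t2 + t3) + bad (t1 + t3, t2 + t3).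
pose W n t1 t2 t3 := avg T2 (fun v1 => avg T2 (fun v2 => avg T2 (fun v3 =>
      gowers 4 (three_ders n t1 t2 t3 v1 v2 v3 f)))).
have W0 n t1 t2 t3 : 0 <= W n t1 t2 t3 by do 3!(apply: avg_ge0 => ? _); exact: gowers_ge0.
have bad0 p : 0 <= bad p by [].
have M2 : (M <= 2 * M)%N by rewrite leq_pmull.
have mm : (M + M <= 2 * M)%N by rewrite mul2n addnn.
have point n t1 t2 t3 : t1 \in T -> t2 \in T -> t3 \in T ->
    box_avg T2 (seven_forms t1 t2 t3) (mder n f) ^+ (2 ^ 5) <=
      badt t1 t2 t3 + kap ^+ 15 * W n t1 t2 t3.
  move=> t1T t2T t3T; have bg : bounded1 (mder n f) by exact: bounded1_mder.
  have kW : 0 <= kap ^+ 15 * W n t1 t2 t3 by rewrite mulr_ge0 ?exprn_ge0.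
  have triv : 1 <= badt t1 t2 t3 -> box_avg T2 (seven_forms t1 t2 t3) (mder n f) ^+ (2 ^ 5) <=
      badt t1 t2 t3 + kap ^+ 15 * W n t1 t2 t3.
    move=> b1; apply: (@le_trans _ _ 1); last by apply: le_trans b1 _; rewrite lerDl.
    by rewrite exprn_ile1 ?box_avg_ge0 ?box_avg_le1.
  have split1 p : bad p = 0 \/ bad p = 1 by rewrite /bad; case: (_ \in _); [right|left].
  have := bad0 (t1, t2); have := bad0 (t1 + t3, t3); have := bad0 (t3, t2 + t3).
  have := bad0 (t1 + t3, t2 + t3) => p4 p3 p2 p1.
  have [g1|g1] := split1 (t1, t2); last by apply: triv; rewrite /badt; lra.
  have [g2|g2] := split1 (t1 + t3, t3); last by apply: triv; rewrite /badt; lra.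
  have [g3|g3] := split1 (t3, t2 + t3); last by apply: triv; rewrite /badt; lra.
  have [g4|g4] := split1 (t1 + t3, t2 + t3); last by apply: triv; rewrite /badt; lra.
  have zK al be : al \in J2 -> be \in J2 -> bad (al, be) = 0 -> (#|zero_pairs M al be| <= K)%N.
    move=> alJ beJ; rewrite /bad inE /= alJ beJ -/K /=.
    by case: (leqP #|zero_pairs M al be| K) => // _ /eqP; rewrite pnatr_eq0.
  have t1J := zballS M2 t1T; have t2J := zballS M2 t2T; have t3J := zballS M2 t3T.
  have t13J := zballS mm (zballD hP t1T t3T); have t23J := zballS mm (zballD hP t2T t3T).
  pose l := [:: (t1, t2); (t1 + t3, t3); (t3, t2 + t3); (t1 + t3, t2 + t3)].
  have lK p : p \in l -> (#|zero_pairs M p.1 p.2| <= K)%N.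
    rewrite !inE => /or4P[] /eqP -> /=; exact: zK.
  have rl v1 v2 v3 := rich_list hP M0 MP PM (bounded1_mder (lin2 t3 t3 v3)
    (bounded1_mder (lin2 0 t2 v2) (bounded1_mder (lin2 t1 0 v1) bg))) lK.
  rewrite /badt g1 g2 g3 g4 !add0r /W.
  have -> : box_avg T2 (seven_forms t1 t2 t3) (mder n f) = avg T2 (fun v1 => avg T2 (fun v2 =>
    avg T2 (fun v3 => box_avg T2 [seq lin2 p.1 p.2 | p <- l] (three_ders n t1 t2 t3 v1 v2 v3 f)))) by [].
  apply: le_trans (avg_jensen _ _) _; first by move=> v _; do 2!(apply: avg_ge0 => ? _); exact: box_avg_ge0.
  rewrite -avgZ; apply: ler_avg => v1 _.
  apply: le_trans (avg_jensen _ _) _; first by move=> v _; apply: avg_ge0 => ? _; exact: box_avg_ge0.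
  rewrite -avgZ; apply: ler_avg => v2 _.
  apply: le_trans (avg_jensen _ _) _; first by move=> v _; exact: box_avg_ge0.
  rewrite -avgZ; apply: ler_avg => v3 _; exact: rl.
set Y := avg [set: G] _ in hY; set Z := avg [set: G] _.
have Z0 : 0 <= Z by do 7!(apply: avg_ge0 => ? _); exact: gowers_ge0.
have T0 : 0 \in T by exact: zball0.
have hYZ : Y ^+ (2 ^ 5) <= 352 / D%:R + kap ^+ 15 * Z.
  apply: (@le_trans _ _ (avg [set: G] (fun n => avg T (fun t1 => avg T (fun t2 => avg T (fun t3 =>
     badt t1 t2 t3 + kap ^+ 15 * W n t1 t2 t3)))))).
    apply: le_trans (avg_jensen _ _) _; first by move=> ? _; do 3!(apply: avg_ge0 => ? _); exact: box_avg_ge0.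
    apply: ler_avg => n _.
    apply: le_trans (avg_jensen _ _) _; first by move=> ? _; do 2!(apply: avg_ge0 => ? _); exact: box_avg_ge0.
    apply: ler_avg => t1 t1T.
    apply: le_trans (avg_jensen _ _) _; first by move=> ? _; do 1!(apply: avg_ge0 => ? _); exact: box_avg_ge0.
    apply: ler_avg => t2 t2T.
    apply: le_trans (avg_jensen _ _) _; first by move=> ? _; exact: box_avg_ge0.
    by apply: ler_avg => t3 t3T; exact: point.
  have split2 n : avg T (fun t1 => avg T (fun t2 => avg T (fun t3 =>
     badt t1 t2 t3 + kap ^+ 15 * W n t1 t2 t3))) =
     avg T (fun t1 => avg T (fun t2 => avg T (badt t1 t2))) +
     kap ^+ 15 * avg T (fun t1 => avg T (fun t2 => avg T (W n t1 t2))).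
    rewrite -avgZ -avgD; apply: eq_avg => t1 _; rewrite -avgZ -avgD; apply: eq_avg => t2 _.
    by rewrite -avgZ -avgD.
  rewrite (eq_avg (fun n _ => split2 n)) [leLHS]avgD (avg_cst _ (in_setT (0 : G))) [X in _ + X]avgZ.
  rewrite -/Z lerD2r.
  pose c : R := 88 / D%:R.
  have c0 : 0 <= c by rewrite divr_ge0.
  have -> : avg T (fun t1 => avg T (fun t2 => avg T (badt t1 t2))) =
     avg T (fun t1 => avg T (fun t2 => avg T (fun t3 => bad (t1, t2)))) +
     avg T (fun t1 => avg T (fun t2 => avg T (fun t3 => bad (t1 + t3, t3)))) +
     avg T (fun t1 => avg T (fun t2 => avg T (fun t3 => bad (t3, t2 + t3)))) +
     avg T (fun t1 => avg T (fun t2 => avg T (fun t3 => bad (t1 + t3, t2 + t3)))).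
    rewrite -!avgD; apply: eq_avg => t1 _; rewrite -!avgD; apply: eq_avg => t2 _.
    by rewrite -!avgD.
  have q1 : avg T (fun t1 => avg T (fun t2 => avg T (fun t3 => bad (t1, t2)))) <= c.
    have -> : avg T (fun t1 => avg T (fun t2 => avg T (fun t3 => bad (t1, t2)))) =
       avg T (fun t1 => avg T (fun t2 => bad (t1, t2))).
      by apply: eq_avg => t1 _; apply: eq_avg => t2 _; rewrite (avg_cst _ T0).
    apply: (avg_bad_pairs R hP M0 MP (phi := fun s t => (s, t)) DM) => s s' t t'.
    by move=> /pair_equal_spec.
  have q2 : avg T (fun t1 => avg T (fun t2 => avg T (fun t3 => bad (t1 + t3, t3)))) <= c.
    have -> : avg T (fun t1 => avg T (fun t2 => avg T (fun t3 => bad (t1 + t3, t3)))) =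
       avg T (fun t1 => avg T (fun t3 => bad (t1 + t3, t3))).
      by apply: eq_avg => t1 _; rewrite (avg_cst _ T0).
    apply: (avg_bad_pairs R hP M0 MP (phi := fun s t => (s + t, t)) DM) => s s' t t'.
    by move=> /pair_equal_spec[+ tt]; rewrite tt => /addIr.
  have q3 : avg T (fun t1 => avg T (fun t2 => avg T (fun t3 => bad (t3, t2 + t3)))) <= c.
    rewrite (avg_cst _ T0).
    apply: (avg_bad_pairs R hP M0 MP (phi := fun s t => (t, s + t)) DM) => s s' t t'.
    by move=> /pair_equal_spec[tt]; rewrite tt => /addIr.
  have q4 : avg T (fun t1 => avg T (fun t2 => avg T (fun t3 => bad (t1 + t3, t2 + t3)))) <= c.
    have -> : avg T (fun t1 => avg T (fun t2 => avg T (fun t3 => bad (t1 + t3, t2 + t3)))) =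
       avg T (fun t3 => avg T (fun t1 => avg T (fun t2 => bad (t1 + t3, t2 + t3)))).
      rewrite [RHS]exchange_avg; apply: eq_avg => t1 _; exact: exchange_avg.
    apply: avg_le => // t3 _.
    apply: (avg_bad_pairs R hP M0 MP (phi := fun s t => (s + t3, t + t3)) DM) => s s' t t'.
    by move=> /pair_equal_spec[/addIr -> /addIr ->].
  have -> : 352 / D%:R = c + c + c + c by rewrite /c; ring.
  by rewrite !lerD.
have h32 : eta ^+ 32 <= 352 / D%:R + kap ^+ 15 * Z.
  apply: le_trans hYZ; rewrite -[32%N]/(2 ^ 5)%N lerXn2r ?nnegrE ?(ltW e0) //.
  exact: le_trans (ltW e0) hY.
have b1 : 352 / D%:R <= eta ^+ 32 / 2.
  have : 32 * 44 * eta ^+ 11 <= 1.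
    by apply: (expr_absorb eta12); rewrite -natrX -natrM ler_nat.
  move: Di; rewrite (exprD eta 32 11); have := en 32%N; nra.
have h2 : eta ^+ 32 / 2 <= kap ^+ 15 * Z by lra.
have kb : kap * eta ^+ 100 <= 1.
  have De2 : D%:R ^+ 2 * eta ^+ 86 <= 1.
    by rewrite -[86%N]/(43 * 2)%N exprM -exprMn exprn_ile1 // mulr_ge0.
  have h4 := @expr_absorb2 R eta eta12 400 18 9 5 isT isT.
  have -> : kap * eta ^+ 100 = (400 * eta ^+ 9 * (18 * eta ^+ 5)) * (D%:R ^+ 2 * eta ^+ 86).
    rewrite /kap /K natrM natrX (_ : eta ^+ 100 = eta ^+ 9 * eta ^+ 5 * eta ^+ 86); last by rewrite -!exprD.
    by ring.
  apply: mulr_ile1 h4 De2; last exact: mulr_ge0 (sqr_ge0 _) (en _).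
  exact: mulr_ge0 (mulr_ge0 (ler0n R 400) (en _)) (mulr_ge0 (ler0n R 18) (en _)).
have kb15 : kap ^+ 15 * (eta ^+ 100) ^+ 15 <= 1.
  by rewrite -exprMn exprn_ile1 // mulr_ge0.
have h5 := ler_wpM2r (exprn_ge0 15 (en 100%N)) h2.
have h6 := ler_wpM2r Z0 kb15.
rewrite exprS; have h7 : eta * eta ^+ 32 <= eta ^+ 32 / 2.
  by have := ler_wpM2r (en 32%N) e12; lra.
have := ler_wpM2l (exprn_ge0 15 (en 100%N)) h7; lra.
Qed.

(** The exponents are variables constrained by equations because, as closed
    terms, they would be unary numerals of enormous size. *)
Lemma gowers_control_exponents (N2 N3 N : nat) (eta : R) (f0 f1 f2 : G -> C) :
  N2 = (3 * 32 * (8 * 128))%N -> N3 = (N2 * (100 * 15 + 33))%N -> N = (N3 * 83 * 83 * 83)%N ->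
  bounded1 f0 -> bounded1 f1 -> bounded1 f2 -> 0 < eta <= 1 / 2 -> 1 <= eta ^+ N * M%:R ->
  eta <= modc (quad_form B f0 f1 f2) -> eta ^+ N <= gowers 11 f2.
Proof.
move=> N2E N3E NE b0 b1 b2 eta12 Mbig hL; have /andP[e0 e12] := eta12.
have big n e : (n * e <= N)%N -> 1 <= (eta ^+ n) ^+ e * M%:R.
  move=> nN; apply: le_trans Mbig _; rewrite ler_wpM2r // -exprM.
  exact: (le_expr_anti eta12).
have N20 : (0 < N2)%N by rewrite N2E.
have N30 : (0 < N3)%N by rewrite N3E muln_gt0 N20.
have N40 : (0 < N3 * 83)%N by rewrite muln_gt0 N30.
have N50 : (0 < N3 * 83 * 83)%N by rewrite muln_gt0 N40.
have s2 := small_expr eta12 N20; have s3 := small_expr eta12 N30.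
have s4 := small_expr eta12 N40; have s5 := small_expr eta12 N50.
pose e1 := (eta ^+ 3) ^+ 32.
have e1E : e1 = eta ^+ (3 * 32) by rewrite /e1 exprM.
have e1s : 0 < e1 <= 1 / 2 by rewrite e1E; apply: (small_expr eta12).
have hbox := quad_form_box hP M0 MP b0 b1 b2.
set D1 := avg T _ in hbox.
have D10 : e1 <= D1.
  apply: le_trans hbox; rewrite -[(2 ^ 5)%N]/32%N /e1 lerXn2r ?nnegrE ?exprn_ge0 ?(ltW e0) //.
    by rewrite divr_ge0 // modc_ge0.
  have h2 : 4 * eta ^+ 2 <= 1 by apply: (expr_absorb eta12); rewrite -natrX ler_nat.
  have := exprS eta 2; nra.
have hseven := box_seven_forms hP M0 MP b2; rewrite -/D1 in hseven.
set Y := avg [set: G] _ in hseven.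
have hY : eta ^+ N2 <= Y.
  apply: le_trans hseven; rewrite N2E exprM -e1E exprM -[(2 ^ 7)%N]/128%N.
  have /andP[e10 _] := e1s.
  have D1p : 0 <= D1 by apply: le_trans D10; exact: ltW.
  rewrite lerXn2r ?nnegrE ?(exprn_ge0 8 (ltW e10)) ?divr_ge0 ?sqr_ge0 //.
  rewrite ler_pdivlMr //; apply: (@le_trans _ _ (e1 ^+ 2)); last by rewrite lerXn2r ?nnegrE // ltW.
  rewrite (exprD e1 2 6) -mulrA ler_piMr ?sqr_ge0 // mulrC.
  by apply: (expr_absorb e1s); rewrite -natrX ler_nat.
have leN3 : (N2 * 43 <= N)%N.
  rewrite NE N3E -!mulnA leq_mul2l; apply/orP; right.
  apply: (@leq_trans (100 * 15 + 33)); last by apply: leq_pmulr.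
  by [].
have hZ := rich_block b2 s2 (big _ _ leN3) hY.
have eN3 : ((eta ^+ N2) ^+ 100) ^+ 15 * (eta ^+ N2) ^+ 33 = eta ^+ N3.
  by rewrite N3E [in RHS]exprM [in RHS]exprD [in RHS]exprM.
rewrite eN3 in hZ.
pose S1 := [set: G]; pose S2 := setX S1 (setX T T2); pose S3 := setX S2 (setX T T2).
(* the three remaining directions are removed from the innermost outwards *)
pose h2 (i : G * (G * (G * G))) := mder (lin2 i.2.1 0 i.2.2) (mder i.1 f2).
pose h3 (i : (G * (G * (G * G))) * (G * (G * G))) := mder (lin2 0 i.2.1 i.2.2) (h2 i.1).
have bh2 i : bounded1 (h2 i) by do 2!apply: bounded1_mder.
have bh3 i : bounded1 (h3 i) by apply: bounded1_mder.
have le83 a : (26 <= 83 * a)%N = (0 < a)%N by case: a => [|a] //; rewrite mulnS.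
have st3 : (eta ^+ N3) ^+ 83 <= avg S3 (fun i => gowers 6 (h3 i)).
  apply: (concat_power dir_add bh3 s3); first by apply: big; rewrite NE -!mulnA leq_mul2l le83 orbT.
  apply: le_trans hZ _; rewrite le_eqVlt; apply/orP; left; apply/eqP.
  rewrite !avg_setX; apply: eq_avg => n _; rewrite avg_setX; apply: eq_avg => t1 _ /=.
  transitivity (avg T (fun t2 => avg T2 (fun v1 => avg T (fun t3 => avg T2 (fun v2 => avg T2 (fun v3 =>
    gowers 4 (three_ders n t1 t2 t3 v1 v2 v3 f2))))))).
    by apply: eq_avg => t2 _; rewrite exchange_avg.
  rewrite exchange_avg; apply: eq_avg => v1 _; rewrite avg_setX; apply: eq_avg => t2 _ /=.
  by rewrite exchange_avg.
have st2 : ((eta ^+ N3) ^+ 83) ^+ 83 <= avg S2 (fun i => gowers 8 (h2 i)).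
  rewrite -!exprM in st3 *.
  rewrite exprM; apply: (concat_power dir_snd bh2 s4); first by apply: big; rewrite NE -!mulnA !leq_mul2l orbT.
  apply: le_trans st3 _; rewrite le_eqVlt; apply/orP; left; apply/eqP.
  rewrite avg_setX; apply: eq_avg => i _; by rewrite avg_setX.
pose h1 n := mder n f2.
have bh1 n : bounded1 (h1 n) by apply: bounded1_mder.
have st1 : (((eta ^+ N3) ^+ 83) ^+ 83) ^+ 83 <= avg S1 (fun n => gowers 10 (h1 n)).
  have E : ((eta ^+ N3) ^+ 83) ^+ 83 = eta ^+ (N3 * 83 * 83) by rewrite !exprM.
  rewrite E in st2 *; apply: (concat_power dir_fst bh1 s5); first by apply: big; rewrite NE leq_mul2l orbT.
  apply: le_trans st2 _; rewrite le_eqVlt; apply/orP; left; apply/eqP.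
  rewrite avg_setX; apply: eq_avg => n _; by rewrite avg_setX.
by rewrite NE !exprM.
Qed.

End GowersControl.

(** Of the twelve degrees of the norm, one is the derivative $\Delta_n$ that
    [box_seven_forms] produces, four come from the combined directions, two
    from each of the three remaining ones, and one is inherent, since
    [gowers 0] is the square of a mean. *)
Lemma gowers_control (R : realType) : exists N : nat,
  forall (P M : nat) (eta : R) (f0 f1 f2 : 'Z_P -> R[i]),
  (1 < P)%N -> (0 < M)%N -> (100 * M ^ 2 <= P)%N -> (P <= 400 * M ^ 2)%N ->
  bounded1 f0 -> bounded1 f1 -> bounded1 f2 -> 0 < eta <= 1 / 2 -> 1 <= eta ^+ N * M%:R ->
  eta <= modc (quad_form (zinterval P M) f0 f1 f2) -> eta ^+ N <= gowers 11 f2.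
Proof.
eexists => P M eta f0 f1 f2 hP M0 MP PM b0 b1 b2.
exact: (gowers_control_exponents hP M0 MP PM erefl erefl erefl b0 b1 b2).
Qed.

(** * The inverse theorem in a cyclic group *)

Section CyclicInverse.
Import mathcomp.boot.finset.
Variable R : realType.
Local Notation C := R[i].

(** The dual function correlates with itself: after one Cauchy--Schwarz the
    arbitrary function $f_2$ is replaced by the conjugate of the dual function,
    which is the function whose high Gowers norm can be lowered. *)
Lemma quad_form_dual P (B : {set 'Z_P}) (f0 f1 f2 : 'Z_P -> C) : bounded1 f2 ->
  modc (quad_form B f0 f1 f2) ^+ 2 <=
  modc (quad_form B f0 f1 (fun x => (quad_dual B f0 f1 x)^*)).
Proof.
move=> b2; rewrite !quad_formE; set F := quad_dual _ _ _.
have -> : avg [set: 'Z_P] (fun x => (F x)^* * F x) = (avg [set: 'Z_P] (fun x => modc (F x) ^+ 2))%:C.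
  by rewrite avgC; apply: eq_avg => x _; rewrite sqr_modc mulrC.
rewrite modc_real; first exact: (@sqr_modc_avgM _ _ _ f2).
by apply: avg_ge0 => x _; exact: sqr_ge0.
Qed.

(** When $f_2$ is taken to be the dual function it has a large Gowers norm, which
    is lowered to the $U^2$ norm. So the dual function has a large Fourier
    coefficient and $f_2$ may even be taken to be a character, in which case
    $f_1$ has a large average on many progressions. *)
Lemma cyclic_inverse : exists K : nat, forall (P M : nat) (eta : R) (f0 f1 f2 : 'Z_P -> C),
  (1 < P)%N -> (0 < M)%N -> (100 * M ^ 2 <= P)%N -> (P <= 400 * M ^ 2)%N ->
  bounded1 f0 -> bounded1 f1 -> bounded1 f2 -> 0 < eta <= 1 / 2 -> 1 <= eta ^+ K * M%:R ->
  eta <= modc (quad_form (zinterval P M) f0 f1 f2) ->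
  exists q L : nat, [/\ (0 < q)%N, (0 < L)%N &
   [/\ q%:R <= (eta ^+ K)^-1, eta ^+ K * M%:R <= L%:R, (q * L <= M)%N &
     eta ^+ K * L%:R <= avg [set: 'Z_P] (fun x => modc (\sum_(j < L) f1 (x + (q * j.+1)%:R)))]].
Proof.
have [N gN] := gowers_control R; have [K1 gK] := gowers_lowering R 10.
pose A := (2 * N.+1)%N; pose D := (A * K1.+1)%N.
have A0 : (0 < A)%N by [].
have D0 : (0 < D)%N by rewrite muln_gt0.
exists (D * 31)%N => P M eta f0 f1 f2 hP M0 MP PM b0 b1 b2 eta12 Mbig hL.
have /andP[e0 e12] := eta12.
have big n : (n <= D * 31)%N -> 1 <= eta ^+ n * M%:R.
  by move=> nD; apply: le_trans Mbig _; rewrite ler_wpM2r // (le_expr_anti eta12).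
have [w pw] := exists_prim_root R (ltnW hP).
set F := quad_dual (zinterval P M) f0 f1.
have bF : bounded1 F by exact: bounded1_quad_dual.
have bFc : bounded1 (fun x => (F x)^*) by move=> x; rewrite modcJ.
have AD : (A <= D)%N by rewrite leq_pmulr.
have DD : (D <= D * 31)%N by rewrite leq_pmulr.
have h1 : eta ^+ 2 <= modc (quad_form (zinterval P M) f0 f1 (fun x => (F x)^*)).
  apply: le_trans (quad_form_dual _ _ _ b2).
  by rewrite lerXn2r // nnegrE ?modc_ge0 // ltW.
have h2 : eta ^+ A <= gowers 11 F.
  rewrite -gowers_conj; apply: le_trans (gN P M (eta ^+ 2) f0 f1 _ hP M0 MP PM b0 b1 bFc _ _ h1).
  - by rewrite -exprM (le_expr_anti eta12) // leq_mul2l leqnSn orbT.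
  - exact: (small_expr eta12).
  - rewrite -exprM; apply: big; apply: leq_trans DD; apply: leq_trans AD.
    by rewrite leq_mul2l leqnSn orbT.
have h3 : eta ^+ D <= gowers 1 F.
  apply: le_trans (gK P M w (eta ^+ A) f0 f1 hP pw M0 MP PM _ _ b0 b1 h2).
  - by rewrite -exprM (le_expr_anti eta12) // leq_mul2l leqnSn orbT.
  - exact: (small_expr eta12).
  - by rewrite -exprM; apply: big; apply: leq_trans DD; rewrite leq_mul2l leqnSn orbT.
have [xi hxi] := gowers1_fourier hP pw bF.
have m1 : modc (fourier w F xi) <= 1.
  by apply: modc_avg_le1 => x _; apply: le_modcM; rewrite ?(modc_zchar hP pw).
have h4 : eta ^+ D <= modc (quad_form (zinterval P M) f0 f1 (fun x => zchar w (- (xi * x)))).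
  rewrite quad_formE -/F.
  have -> : avg [set: 'Z_P] (fun x => zchar w (- (xi * x)) * F x) = fourier w F xi.
    by apply: eq_avg => x _; rewrite mulrC.
  apply: le_trans h3 _; apply: le_trans hxi _.
  by rewrite expr2 ler_piMr ?modc_ge0.
have [|q [L [q0 L0 [qle Lge qLM hav]]]] :=
    major_arc_structure hP pw M0 MP PM (small_expr eta12 D0) _ b0 b1 h4.
  by rewrite -exprM; apply: big; rewrite leq_mul2l orbT.
have en n : 0 < eta ^+ n by rewrite exprn_gt0.
exists q, L; split => //; split => //.
- apply: le_trans qle _; rewrite -exprM lef_pV2 ?posrE // (le_expr_anti eta12) //.
  by rewrite leq_mul2l orbT.
- by apply: le_trans Lge; rewrite -exprM.
- apply: le_trans hav; rewrite ler_wpM2r //; apply: (@le_trans _ _ (eta ^+ (D * 2))).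
    by rewrite (le_expr_anti eta12) // leq_mul2l orbT.
  have /andP[t0 t12] := small_expr eta12 D0.
  by rewrite exprM expr2 ler_wpM2l ?(ltW t0) // (le_trans t12) // div1r.
Qed.

End CyclicInverse.

(** * Functions on the integers and on a cyclic group *)

Section Transfer.
Variable R : realType.
Local Notation C := R[i].

Lemma sum_discrete_interval (V : nmodType) (X : R) (F : int -> V) :
  \sum_(y <- discrete_interval X) F y = \sum_(j < Num.truncn X) F (j.+1)%:Z.
Proof.
rewrite /discrete_interval big_map -(big_mkord predT (fun j => F (j.+1)%:Z)).
by rewrite /index_iota subn0 -[1%N]addn0 iotaDl big_map.
Qed.

Lemma mem_discrete_interval (N : nat) (z : int) :
  (z \in discrete_interval (N%:R : R)) = (1 <= z <= N%:Z).
Proof.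
rewrite /discrete_interval natrK; apply/mapP/idP => [[n]|zN].
  by rewrite mem_iota => nN ->; lia.
by exists (absz z); [rewrite mem_iota; lia | lia].
Qed.

Section Window.
Variable N : nat.
Hypothesis N0 : (0 < N)%N.
Local Notation P := (100 * N)%N.
Local Notation G := 'Z_P.

Let hP : (1 < P)%N. Proof. lia. Qed.

(** The representative of a residue in $[-N,99N)$. The window starts at $-N$ so
    that it contains the beginnings of all short progressions that meet $[1,N]$. *)
Definition zrep (x : G) : int :=
  if ((x : nat) < 99 * N)%N then (x : nat)%:Z else (x : nat)%:Z - P%:Z.

Lemma zval_lt (x : G) : ((x : nat) < P)%N.
Proof. by have := ltn_ord x; rewrite [X in (_ < X)%N]Zp_cast. Qed.

Lemma zrep_inj : injective zrep.
Proof.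
move=> x y; have := zval_lt x; have := zval_lt y; rewrite /zrep => yP xP xy.
by apply/val_inj => /=; move: xy; do 2!case: ltnP => ?; lia.
Qed.

Lemma zrep_surj z : - N%:Z <= z <= N%:Z -> exists x, zrep x = z.
Proof.
move=> zN; case: (lerP 0 z) => z0.
  exists (absz z)%:R; rewrite /zrep val_Zp_nat // modn_small; last by lia.
  by case: ltnP; lia.
exists (absz (P%:Z + z))%:R; rewrite /zrep val_Zp_nat // modn_small; last by lia.
by case: ltnP; lia.
Qed.

Lemma sum_zrep (V : nmodType) (F : int -> V) :
  (forall z, ~~ (- N%:Z <= z <= N%:Z) -> F z = 0) ->
  \sum_(z \in [set: int]) F z = \sum_(x : G) F (zrep x).
Proof.
move=> F0; have us : uniq [seq zrep x | x <- index_enum G].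
  by rewrite map_inj_uniq ?index_enum_uniq //; exact: zrep_inj.
rewrite -(big_map zrep predT F) (@fsbig_seq _ _ _ _ _ F us); apply/esym/fsbig_widen => // z /= [_ zs].
apply: F0; apply/negP => /zrep_surj[x xz]; apply: zs.
by rewrite -xz map_f ?mem_index_enum.
Qed.

Variable f : int -> C.
Hypothesis fN : forall z, ~~ (1 <= z <= N%:Z) -> f z = 0.
Definition zpull (x : G) : C := f (zrep x).

(** There is no wrap-around: a shift by at most $N$ leaves the window only
    through points where $f$ vanishes on both sides. *)
Lemma zpull_shift x v : (v <= N)%N -> zpull (x + v%:R) = f (zrep x + v%:Z).
Proof.
move=> vN; rewrite /zpull; have xP := zval_lt x.
have E : zrep (x + v%:R) = (if ((x + v) %% P < 99 * N)%N then ((x + v) %% P)%N%:Z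
    else ((x + v) %% P)%N%:Z - P%:Z).
  have xE : nat_of_ord (x + v%:R) = ((x + v) %% P)%N.
    by rewrite -[x in LHS]natr_Zp -natrD val_Zp_nat.
  by rewrite /zrep xE.
rewrite E /zrep; case: (ltnP (x + v) P) => xvP.
  rewrite modn_small //; case: ltnP => h1; case: ltnP => h2.
  - by congr f; lia.
  - by lia.
  - by rewrite !fN //; lia.
  - by congr f; lia.
have -> : ((x + v) %% P)%N = (x + v - P)%N.
  by rewrite -[in LHS](subnK xvP) modnDr modn_small //; lia.
case: ltnP => h1; case: ltnP => h2; first by lia.
- by congr f; lia.
- by lia.
- by lia.
Qed.

Lemma zpull_eq0 x : x \notin zinterval P N -> zpull x = 0.
Proof.
move=> xN; apply: fN; apply/negP => h; move/negP: xN; apply.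
apply/zintervalP; exists (x : nat); last by rewrite natr_Zp.
have xP := zval_lt x.
by move: h; rewrite /zrep; case: ltnP; lia.
Qed.

Lemma sum_config (M : nat) : (M ^ 2 <= N)%N ->
  \sum_(x \in [set: int]) \sum_(j < M)
     f x * f (x + (j.+1)%:Z) * f (x + (j.+1)%:Z ^+ 2) =
  (P * M)%:R * quad_form (zinterval P M) zpull zpull zpull.
Proof.
move=> MN; rewrite sum_zrep; last first.
  by move=> z zN; rewrite big1 // => j _; rewrite fN ?mul0r //; lia.
have MP : (M < P)%N.
  by case: (leqP M 1) => M1; [lia | have := leq_pmull M (ltnW M1); rewrite mulnn; lia].
rewrite /quad_form /avg cardsT card_ZpT // natrM mulrACA.
rewrite card_zinterval //.
case: (posnP M) => [->|M0].
  by rewrite mul0r mulr0 big1 // => x _; rewrite big_ord0.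
rewrite -mulr_sumr.
have P0 : P%:R != 0 :> C by rewrite pnatr_eq0; lia.
have M0' : M%:R != 0 :> C by rewrite pnatr_eq0; lia.
rewrite mulfV // mul1r mulrA mulfV // mul1r.
apply: eq_big => [x|x _]; first by rewrite finset.in_setT.
rewrite sum_zinterval //; apply: eq_bigr => j _.
have jM := ltn_ord j; have j1 : (j.+1 <= j.+1 ^ 2)%N by rewrite -mulnn leq_pmulr.
have j2 : (j.+1 ^ 2 <= N)%N by apply: leq_trans MN; rewrite leq_sqr.
by rewrite -natrX !zpull_shift // (leq_trans j1).
Qed.

Lemma sum_progressions (q L : nat) : (0 < q)%N -> (q * L <= N)%N ->
  \sum_(x \in [set: int]) `|\sum_(j < L) f (x + q%:Z * (j.+1)%:Z)| =
  (P%:R * avg [set: G]%SET (fun x => modc (\sum_(j < L) zpull (x + (q * j.+1)%:R))))%:C.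
Proof.
move=> q0 qL; have jN (j : 'I_L) : (0 < q * j.+1 <= N)%N.
  by rewrite muln_gt0 q0 (leq_trans _ qL) // leq_mul2l ltn_ord orbT.
rewrite sum_zrep; last first.
  move=> z zN; rewrite big1 ?normr0 // => j _; apply: fN; have := jN j.
  by rewrite -PoszM; lia.
rewrite /avg cardsT card_ZpT // mulrA mulfV ?pnatr_eq0; last by lia.
rewrite mul1r rmorph_sum /=; apply: eq_big => [x|x _]; first by rewrite finset.in_setT.
rewrite modcE; congr ((modc _)%:C); apply: eq_bigr => j _.
by have /andP[_ jN'] := jN j; rewrite zpull_shift // -PoszM.
Qed.

(** The trivial bound, which forces $\delta\le 1$: the base point is confined to
    $[N]$. *)
Lemma modc_quad_form_zpull (M : nat) : (M < P)%N -> bounded1 f ->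
  P%:R * modc (quad_form (zinterval P M) zpull zpull zpull) <= N%:R.
Proof.
move=> MP b; rewrite /quad_form; apply: le_trans (ler_wpM2l _ (modc_avg _ _)) _; first exact: ler0n.
rewrite {1}/avg cardsT card_ZpT // mulrA mulfV ?pnatr_eq0 ?mul1r; last by lia.
apply: (@le_trans _ _ (\sum_(x in zinterval P N) 1)); last first.
  by rewrite sumr_const card_zinterval //; lia.
rewrite [leRHS]big_mkcond [leLHS]big_mkcond /=; apply: ler_sum => x _.
rewrite finset.in_setT; case: ifP => xN; last first.
  rewrite (_ : avg _ _ = 0) ?modc0 //; rewrite /avg big1 ?mulr0 // => y _.
  by rewrite zpull_eq0 ?xN // !mul0r.
by apply: modc_avg_le1 => y _; apply: le_modcM; first apply: le_modcM; exact: b.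
Qed.

End Window.
End Transfer.

(** * The inverse theorem *)

(** The scale $M=\lfloor N^{1/2}\rfloor$ satisfies $100M^2\le 100N\le 400M^2$. *)
Lemma truncn_sqrt (R : realType) (N : nat) : (0 < N)%N ->
  let s := Num.sqrt (N%:R : R) in let M := Num.truncn s in
  [/\ (0 < M)%N, (M ^ 2 <= N)%N, (N <= 4 * M ^ 2)%N, M%:R <= s & s <= 2 * M%:R].
Proof.
move=> N0 s M; have s0 : 0 <= s by exact: sqrtr_ge0.
have s1 : 1 <= s by rewrite -[1]sqrtr1 ler_sqrt ?ler1n.
have ss : s ^+ 2 = N%:R by rewrite sqr_sqrtr.
have M0 : (0 < M)%N by rewrite truncn_gt0.
have Ms : M%:R <= s by rewrite truncn_le.
have sM : s <= 2 * M%:R.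
  have h : s < M%:R + 1 by rewrite natr1; exact: truncnS_gt.
  have M1 : 1 <= M%:R :> R by rewrite ler1n.
  by lra.
split => //.
- by rewrite -(ler_nat R) natrX -ss lerXn2r // nnegrE.
- rewrite -(ler_nat R) -ss natrM natrX.
  have := lerXn2r 2 (x := s) (y := 2 * M%:R).
  rewrite !nnegrE mulr_ge0 // => /(_ s0 isT sM); rewrite exprMn.
  by rewrite -[2 ^+ 2]natrX.
Qed.

Local Open Scope complex_scope.

Theorem theorem1p2 (R : realType) :
  exists c C : R, 0 < c /\ 0 < C /\
  forall (N : nat) (delta : R) (f : int -> R[i]),
    (0 < N)%N -> 0 < delta ->
    one_bounded f ->
    supported_in f (discrete_interval (N%:R : R)) ->
    (delta * N%:R `^ (3 / 2))%:C <=
      `|\sum_(x \in [set: int])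
          \sum_(y <- discrete_interval (N%:R `^ (1 / 2) : R))
            f x * f (x + y) * f (x + y ^+ 2)| ->
    N%:R <= C * delta `^ (- C) \/
    exists q N' : nat,
      [/\ (0 < q)%N, (0 < N')%N,
          q%:R <= C * delta `^ (- C),
          c * delta `^ C * N%:R `^ (1 / 2) <= N'%:R
        & (c * delta `^ C * N%:R * N'%:R)%:C <=
            \sum_(x \in [set: int])
              `|\sum_(y <- discrete_interval (N'%:R : R)) f (x + q%:Z * y)| ].
Proof.
have [K hK] := cyclic_inverse R.
pose A : R := 200 ^+ K; have A1 : 1 <= A by rewrite exprn_ege1 // ler1n.
have A0 : 0 < A by apply: lt_le_trans A1.
(* $A$ accounts for the factor $200$ between $\eta$ and $\delta$; the exponent $2K$ comes
   from $N\le 4M^2$ when $M<\eta^{-K}$ *)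
pose C : R := 4 * A ^+ 2 + (2 * K)%:R; pose c : R := A^-1 / 2.
have CA : 4 * A ^+ 2 <= C by rewrite lerDl.
have CK : (2 * K)%:R <= C by rewrite lerDr mulr_ge0 // sqr_ge0.
have C0 : 0 < C by apply: lt_le_trans CA; rewrite mulr_gt0 // exprn_gt0.
have c0 : 0 < c by rewrite divr_gt0 // invr_gt0.
exists c, C; split => //; split => // N delta f N0 d0 bf sf hsum.
have [M0 MN NM Ms sM] := truncn_sqrt R N0.
set s := Num.sqrt _ in Ms sM M0 MN NM; set M := Num.truncn s in Ms sM M0 MN NM.
have s0 : 0 < s by rewrite sqrtr_gt0 ltr0n.
have Es : N%:R `^ (1 / 2) = s :> R by rewrite div1r powR12_sqrt.
have NR0 : 0 < N%:R :> R by rewrite ltr0n.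
have E32 : N%:R `^ (3 / 2) = N%:R * s :> R.
  rewrite (_ : 3 / 2 = 1 + 1 / 2); last by lra.
  by rewrite powRD ?Es ?powRr1 ?gt_eqF ?implybT.
rewrite Es in hsum *; rewrite {}E32 in hsum.
have fN z : ~~ (1 <= z <= N%:Z) -> f z = 0.
  by move=> zN; apply: sf; rewrite mem_discrete_interval.
have bf' : bounded1 f by move=> z; rewrite -lecR -modcE; exact: bf.
pose P := (100 * N)%N; pose g : 'Z_P -> R[i] := zpull f.
have bg : bounded1 g by move=> x; exact: bf'.
have hP : (1 < P)%N by apply: leq_trans (leq_pmulr 100 N0).
have MP : (100 * M ^ 2 <= P)%N by rewrite leq_mul2l.
have PM : (P <= 400 * M ^ 2)%N by rewrite /P -[400%N]/(100 * 4)%N -mulnA leq_mul2l.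
have MltP := ltMP M0 MP.
set Lam := quad_form (zinterval P M) g g g.
have hLam : delta * (N%:R * s) <= (P * M)%:R * modc Lam.
  have /(_ _ MN)E := sum_config N0 fN.
  move: hsum; rewrite (eq_fsbigr (fun x => \sum_(j < M)
     f x * f (x + (j.+1)%:Z) * f (x + (j.+1)%:Z ^+ 2))); last first.
    by move=> x _; rewrite sum_discrete_interval.
  by rewrite E modcE lecR modcM modc_nat.
(* needed to compare the powers of $\delta$ with exponents $K$ and $C$ *)
have d1 : delta <= 1.
  have h := modc_quad_form_zpull N0 fN MltP bf'; rewrite -/P -/g -/Lam in h.
  have h2 : delta * (N%:R * s) <= 1 * (N%:R * s).
    apply: le_trans hLam _; rewrite mul1r natrM mulrAC.
    by apply: ler_pM => //; apply: mulr_ge0; rewrite ?modc_ge0.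
  by move: h2; rewrite ler_pM2r // mulr_gt0.
have hL2 : delta / 100 <= modc Lam.
  rewrite ler_pdivrMr // mulrC.
  have h2 : delta * (N%:R * s) <= 100 * modc Lam * (N%:R * s).
    apply: le_trans hLam _; rewrite !natrM.
    rewrite (_ : 100 * modc Lam * (N%:R * s) = 100 * N%:R * s * modc Lam); last by ring.
    by rewrite ler_wpM2r ?modc_ge0 // ler_wpM2l // mulr_ge0.
  by move: h2; rewrite ler_pM2r // mulr_gt0.
(* $\eta\le 1/2$ is needed to absorb constants *)
pose eta := delta / 200.
have eta12 : 0 < eta <= 1 / 2 by rewrite /eta; clear -d0 d1; apply/andP; split; lra.
have etaL : eta <= modc Lam by apply: le_trans hL2; rewrite /eta; lra.
have etaK : eta ^+ K = delta ^+ K / A by rewrite /eta expr_div_n.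
have dK0 n : 0 < delta ^+ n by rewrite exprn_gt0.
pose Q := delta `^ C.
have Q0 : 0 < Q by exact: powR_gt0.
have dK1 : delta ^+ K <= 1 by rewrite exprn_ile1 // ltW.
have Q2 : Q <= delta ^+ K ^+ 2.
  rewrite -exprM mulnC -powR_mulrn ?(ltW d0) //.
  by apply: ger_powR CK; rewrite d0.
have Q1 : Q <= delta ^+ K by apply: le_trans Q2 _; rewrite expr2 ler_piMl // ltW.
rewrite powRN -/Q.
have A2 : A <= C.
  apply: le_trans CA; have := ler_peMl (ltW A0) A1; rewrite -expr2.
  have := sqr_ge0 A; lra.
case: (lerP 1 (eta ^+ K * M%:R)) => big; last first.
  left; rewrite ler_pdivlMr //.
  have h : M%:R * delta ^+ K <= A.
    by move: big; rewrite etaK mulrAC ltr_pdivrMr // mul1r mulrC => /ltW.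
  have h2 : (M%:R * delta ^+ K) ^+ 2 <= A ^+ 2.
    by rewrite lerXn2r // nnegrE ?mulr_ge0 // ltW.
  apply: (@le_trans _ _ (4 * M%:R ^+ 2 * (delta ^+ K) ^+ 2)).
    apply: ler_pM => //; first exact: ltW.
    by rewrite -natrX -natrM ler_nat.
  by apply: le_trans CA; rewrite -mulrA -exprMn ler_wpM2l.
right.
have [q [L [q0 L0 [qle Lge qLM hav]]]] := hK P M eta g g g hP M0 MP PM bg bg bg eta12 big etaL.
exists q, L; split => //.
- apply: le_trans qle _; rewrite etaK invf_div.
  by apply: ler_pM => //; rewrite ?invr_ge0 ?(ltW A0) ?(ltW (dK0 _)) // lef_pV2 ?posrE.
- apply: le_trans Lge; rewrite etaK /c.
  rewrite (_ : A^-1 / 2 * Q * s = A^-1 * (Q * (s / 2))); last by ring.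
  rewrite (_ : delta ^+ K / A * M%:R = A^-1 * (delta ^+ K * M%:R)); last by ring.
  rewrite ler_wpM2l ?invr_ge0 ?(ltW A0) //.
  by apply: ler_pM => //; [exact: ltW | exact: divr_ge0 (ltW s0) _ | lra].
- rewrite (eq_fsbigr (fun x => `|\sum_(j < L) f (x + q%:Z * (j.+1)%:Z)|)); last first.
    by move=> x _; rewrite sum_discrete_interval natrK.
  rewrite (sum_progressions N0 fN q0); last first.
    by apply: leq_trans qLM _; apply: leq_trans MN; rewrite -mulnn leq_pmulr.
  rewrite lecR -/P -/g.
  rewrite (_ : c * Q * N%:R * L%:R = N%:R * (c * Q * L%:R)); last by ring.
  rewrite natrM -[100%:R * _ * _]mulrA.
  apply: (@le_trans _ _ (N%:R * (eta ^+ K * L%:R))); last first.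
    have h := ler_wpM2l (ltW NR0) hav; apply: le_trans h _.
    rewrite ler_peMl ?ler1n // mulr_ge0 // ?(ltW NR0) //.
    by apply: avg_ge0 => x _; exact: modc_ge0.
  rewrite ler_wpM2l // ler_wpM2r // etaK /c mulrC.
  apply: ler_pM => //; [exact: ltW | exact: ltW | ].
  by rewrite ler_pdivrMr // ler_peMr ?invr_ge0 ?(ltW A0) ?ler1n.
Qed.
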